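(* Let $$z=\frac{(q;q)_\infty(q^5;q^5)_\infty}{q(q,q^4;q^5)_\infty^2(q^{10};q^{10})_\infty^2(q,q^9;q^{10})_\infty}.$$ Then $$\frac{(q;q)_\infty^{92}(q^5;q^5)_\infty^{14}(q,q^4;q^5)_\infty^{52}(q^4,q^6;q^{10})_\infty^{4}}{q^{57}(q^2;q^2)_\infty^{58}(q^{10};q^{10})_\infty^{46}(q,q^9;q^{10})_\infty^{109}(q^5;q^{10})_\infty^{10}}\sum_{n=0}^\infty\Delta_2(25n+14)q^n$$ and $$\frac{(q;q)_\infty^{92}(q,q^4;q^5)_\infty^{62}(q^5;q^{10})_\infty^{6}}{q^{57}(q^2;q^2)_\infty^{59}(q^5;q^5)_\infty^{2}(q^{10};q^{10})_\infty^{29}(q,q^9;q^{10})_\infty^{119}(q^4,q^6;q^{10})_\infty^{4}}\sum_{n=0}^\infty\Delta_2(25n+24)q^n$$ are both polynomials in $z$ of degree $57$ with integer coefficients divisible by $5$.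
   Context: Here $|q|<1$, $(a;q)_\infty=\prod_{n=0}^\infty(1-aq^n)$ and $(a_1,\ldots,a_r;q)_\infty=\prod_{j=1}^r(a_j;q)_\infty$. $\Delta_k(n)$ is the number of broken $k$-diamond partitions of $n$ (Andrews--Paule), with generating function $\sum_{n\ge0}\Delta_k(n)q^n=\frac{(q^2;q^2)_\infty(q^{2k+1};q^{2k+1})_\infty}{(q;q)_\infty^3(q^{4k+2};q^{4k+2})_\infty}$; in particular $\sum_{n\ge0}\Delta_2(n)q^n=\frac{(q^2;q^2)_\infty(q^5;q^5)_\infty}{(q;q)_\infty^3(q^{10};q^{10})_\infty}$. *)

(* Defs.v *)
From HB Require Import structures.
From mathcomp Require Import all_boot all_order all_algebra.
From mathcomp Require Import complex.
From mathcomp Require Import all_classical all_reals all_analysis.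
Set Implicit Arguments.
Unset Strict Implicit.
Unset Printing Implicit Defensive.
Import Order.TTheory GRing.Theory Num.Theory.
Import numFieldNormedType.Exports.

(* The k-elongated partition diamonds of Andrews and Paule ("MacMahon's
   partition analysis XI", 2007), glued in a chain.  The vertices a_1, a_2, ...
   of the paper are numbered from 0 here.  One diamond consists of a source,
   k layers of two incomparable vertices, and a sink which is the source of the
   next diamond, so that vertices (2k+1)d are the sources; the arrows go from
   every vertex of a layer to every vertex of the next one. *)
Definition diamond_layer (k i : nat) : nat :=
  (i %/ k.*2.+1) * k.+1 + uphalf (i %% k.*2.+1).

Definition diamond_arrow (k i j : nat) : bool :=
  diamond_layer k j == (diamond_layer k i).+1.

(* Broken k-diamond partitions of N of length n: [ab.1] labels a chain of n
   diamonds, [ab.2] a chain of n diamonds from which the first source, vertex 0,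
   is deleted, so that the index i of [ab.2] stands for vertex i.+1.  The bound
   N on the labels only serves to make the type finite. *)
Definition broken_diamonds (k n N : nat) :=
  [set ab : {ffun 'I_(k.*2.+1 * n).+1 -> 'I_N.+1} *
            {ffun 'I_(k.*2.+1 * n) -> 'I_N.+1} |
    [&& [forall i : 'I_(k.*2.+1 * n).+1, forall j : 'I_(k.*2.+1 * n).+1,
           diamond_arrow k i j ==> (ab.1 j <= ab.1 i)%N],
        [forall i : 'I_(k.*2.+1 * n), forall j : 'I_(k.*2.+1 * n),
           diamond_arrow k i.+1 j.+1 ==> (ab.2 j <= ab.2 i)%N]
      & (\sum_i (ab.1 i : nat) + \sum_i (ab.2 i : nat))%N == N]].

(* Broken k-diamond partitions have unbounded length.  Length N suffices for
   partitions of N: a nonzero label beyond vertex (2k+1)N would force nonzero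
   labels on the preceding sources, at least N of them, and so a sum above N. *)
Definition Delta (k N : nat) : nat := #|broken_diamonds k N N|.

Local Open Scope ring_scope.

Definition qpoch (K : numFieldType) (a q : K) : K :=
  limn (fun N => \prod_(0 <= n < N) (1 - a * q ^+ n)).

Definition qpochs (K : numFieldType) (s : seq K) (q : K) : K :=
  \prod_(a <- s) qpoch a q.

Definition qseries (K : numFieldType) (c : nat -> nat) (q : K) : K :=
  limn (fun N => \sum_(0 <= n < N) (c n)%:R * q ^+ n).

Definition zfun (K : numFieldType) (q : K) : K :=
  (qpoch q q * qpoch (q ^+ 5) (q ^+ 5)) /
  (q * qpochs [:: q; q ^+ 4] (q ^+ 5) ^+ 2
     * qpoch (q ^+ 10) (q ^+ 10) ^+ 2
     * qpochs [:: q; q ^+ 9] (q ^+ 10)).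

(* Main.v *)
From Stdlib Require Import BinInt.
Require Import Defs.
From HB Require Import structures.
From mathcomp Require Import all_boot all_order all_algebra.
From mathcomp Require Import complex.
From mathcomp Require Import all_classical all_reals all_analysis.
From mathcomp Require Import ssrZ zify ring lra.
Import Order.TTheory GRing.Theory Num.Theory.
Import numFieldNormedType.Exports.
Local Open Scope ring_scope.
Set Implicit Arguments.
Unset Strict Implicit.
Unset Printing Implicit Defensive.

(** Put [k = p R(p) R(p^2)^2], where [R] is the Rogers-Ramanujan continued
    fraction without its fractional power. This is a Hauptmodul of level 10: the
    function called [zfun] is [1 + 1/k] ([zfun_k]), and [1 + k], [1 - k] are theta
    quotients like [k] itself ([one_plus_k], [one_minus_k]), so that identities
    between monomials in these functions and Euler products can be checked by
    comparing exponents. The two assertions say that, up to such monomials, the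
    generating functions of Delta_2(25 n + 14) and Delta_2(25 n + 24) are [k^-57 S(k)]
    and [S(-1/k)], for one integer polynomial [S] of degree 57 with nonzero constant
    term and all coefficients divisible by 5.

    An arithmetic progression modulo 5 is selected by averaging over [z^j q],
    with [z] a fifth root of unity and [q^5 = p] ([ev_section5]). The Euler product
    at [q] is [q (1/a - 1 - a)] times a function of [p], where [a = q R(p)]
    ([euler_dissect]), and the same holds for [q^2] with [b = q^2 R(p^2)]. Since
    [a b^2 = k] and [b (1 - k) = a^2 (1 + k)], the average of a rational function
    of [a] and [b] over [a |-> z^j a], [b |-> z^2j b] is a power of [a] times a
    rational function of [k]. Denominators are cleared by the norm
    [1/a^5 - 11 - a^5] of [1/a - 1 - a], an eta quotient ([norm_val_euler]).

    One average gives the generating function of Delta_2(5 n + 4) in terms of eta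
    quotients ([ev_first]); a second one gives [S] by an exact computation with
    polynomials in [k] ([second_check], [second_average]). The substitution
    [k |-> -1/k], [a |-> -1/a], [b |-> -1/b] preserves the relations above and the
    functions that are averaged, which turns the first progression modulo 25 into
    the second ([ev_second_4_root]).

    The ingredients are proved from the definitions. The product formula for the
    numbers Delta_2 comes from a recurrence on labellings of a chain of layers
    ([labelling_first], [labelling_second]). The dissection of the Euler product
    and the formulas for [1 + k] and [1 - k] are theta series identities; they are
    proved for formal power series, from the triple product and from rearrangements
    of double sums over the integers, and are then evaluated in the unit disc. *)

(** * Formal power series with integer coefficients *)

Record fps := FPS { coefs :> nat -> int }.

Lemma fpsP (f g : fps) : (forall n, f n = g n) -> f = g.
Proof. by case: f => f; case: g => g /= fg; congr FPS; apply/funext. Qed.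

HB.instance Definition _ := gen_eqMixin fps.
HB.instance Definition _ := gen_choiceMixin fps.

Definition fps_add (f g : fps) := FPS (fun n => f n + g n).
Definition fps_opp (f : fps) := FPS (fun n => - f n).
Definition fps_cst (a : int) := FPS (fun n => if n == 0%N then a else 0).

Fact fps_addA : associative fps_add.
Proof. by move=> f g h; apply: fpsP => n /=; rewrite addrA. Qed.
Fact fps_addC : commutative fps_add.
Proof. by move=> f g; apply: fpsP => n /=; rewrite addrC. Qed.
Fact fps_add0 : left_id (fps_cst 0) fps_add.
Proof. by move=> f; apply: fpsP => n /=; case: ifP; rewrite add0r. Qed.
Fact fps_addN : left_inverse (fps_cst 0) fps_opp fps_add.
Proof. by move=> f; apply: fpsP => n /=; case: ifP; rewrite addNr. Qed.

HB.instance Definition _ :=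
  GRing.isZmodule.Build fps fps_addA fps_addC fps_add0 fps_addN.

Definition fps_mul (f g : fps) :=
  FPS (fun n => \sum_(i < n.+1) f i * g (n - i)%N).

Definition trunc N (f : fps) : {poly int} := \poly_(i < N) f i.

Lemma coef_trunc_mul N (f g : fps) n : (n < N)%N ->
  (trunc N f * trunc N g)`_n = fps_mul f g n.
Proof.
move=> ltnN; rewrite coefM; apply: eq_bigr => i _.
rewrite !coef_poly (leq_ltn_trans _ ltnN) ?(leq_ltn_trans _ ltnN) ?leq_subr //.
by rewrite -ltnS.
Qed.

Fact fps_mulC : commutative fps_mul.
Proof.
by move=> f g; apply: fpsP => n; rewrite -!(@coef_trunc_mul n.+1) // mulrC.
Qed.

Lemma coef_trunc_mul3 N (f g h : fps) n : (n < N)%N ->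
  (trunc N f * trunc N g * trunc N h)`_n = fps_mul (fps_mul f g) h n.
Proof.
move=> ltnN; rewrite coefM; apply: eq_bigr => i _.
have iN : (i < N)%N by rewrite (leq_ltn_trans _ ltnN) // -ltnS.
by rewrite coef_trunc_mul // coef_poly (leq_ltn_trans _ ltnN) // leq_subr.
Qed.

Fact fps_mulA : associative fps_mul.
Proof.
move=> f g h; rewrite fps_mulC; apply: fpsP => n.
by rewrite -!(@coef_trunc_mul3 n.+1) // (mulrC _ (trunc _ f)) mulrA.
Qed.

Fact fps_mul1 : left_id (fps_cst 1) fps_mul.
Proof.
move=> f; apply: fpsP => n /=; rewrite big_ord_recl /= mul1r subn0 big1 ?addr0 //.
by move=> i _; rewrite mul0r.
Qed.

Fact fps_mulDl : left_distributive fps_mul fps_add.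
Proof.
move=> f g h; apply: fpsP => n /=; rewrite -big_split /=.
by apply: eq_bigr => i _; rewrite mulrDl.
Qed.

Fact fps_1neq0 : fps_cst 1 != 0.
Proof. by apply/eqP => /(congr1 (fun f : fps => f 0%N)). Qed.

HB.instance Definition _ :=
  GRing.Zmodule_isComNzRing.Build fps fps_mulA fps_mulC fps_mul1 fps_mulDl fps_1neq0.

Lemma fpsD (f g : fps) n : (f + g) n = f n + g n. Proof. by []. Qed.
Lemma fpsN (f : fps) n : (- f) n = - f n. Proof. by []. Qed.
Lemma fpsB (f g : fps) n : (f - g) n = f n - g n. Proof. by []. Qed.
Lemma fps0 n : (0 : fps) n = 0. Proof. by rewrite /GRing.zero /= if_same. Qed.
Lemma fps1 n : (1 : fps) n = (n == 0%N)%:R.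
Proof. by rewrite /GRing.one /=; case: eqP. Qed.
Lemma fpsM (f g : fps) n : (f * g) n = \sum_(i < n.+1) f i * g (n - i)%N.
Proof. by []. Qed.
Lemma fps_sum (I : Type) (r : seq I) (P : pred I) (F : I -> fps) n :
  (\sum_(i <- r | P i) F i) n = \sum_(i <- r | P i) F i n.
Proof. by apply: (big_morph (fun f : fps => f n)); rewrite ?fps0. Qed.

Definition fpsX k := FPS (fun n => (n == k)%:R).
Arguments fpsX k%_N.

Lemma fpsX0 : fpsX 0 = 1.
Proof. by apply: fpsP => n; rewrite fps1. Qed.

Lemma fpsXM k (f : fps) n : (fpsX k * f) n = if (k <= n)%N then f (n - k)%N else 0.
Proof.
rewrite fpsM /=; case: leqP => kn.
  rewrite (bigD1 (Ordinal (kn : (k < n.+1)%N))) //= eqxx mul1r big1 ?addr0 //.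
  by move=> i /eqP ik; case: eqP => // ik'; [case: ik; apply: val_inj|rewrite mul0r].
rewrite big1 // => i _; case: eqP => [ik|]; last by rewrite mul0r.
by have := ltn_ord i; rewrite ik ltnS leqNgt kn.
Qed.

Lemma fpsXD j k : fpsX (j + k)%N = fpsX j * fpsX k.
Proof.
apply: fpsP => n; rewrite fpsXM /=; case: leqP => jn; last first.
  by case: eqP => // e; rewrite e ltnNge leq_addr in jn.
by rewrite -(eqn_add2l j (n - j)) subnKC.
Qed.

Lemma fpsX_exp k m : fpsX k ^+ m = fpsX (k * m)%N.
Proof.
elim: m => [|m IH]; first by rewrite expr0 muln0 fpsX0.
by rewrite exprS IH mulnS fpsXD.
Qed.

(** Congruence modulo the [N]-th power of the variable: infinite sums and
    products are reached as limits for these congruences. *)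
Definition eqm N (f g : fps) := forall n, (n < N)%N -> f n = g n.

Lemma eqm_refl N f : eqm N f f. Proof. by []. Qed.
Lemma eqm_sym {N f g} : eqm N f g -> eqm N g f.
Proof. by move=> fg n /fg ->. Qed.
Lemma eqm_trans N g f h : eqm N f g -> eqm N g h -> eqm N f h.
Proof. by move=> fg gh n nN; rewrite fg ?gh. Qed.
Lemma eqm_le M N f g : (M <= N)%N -> eqm N f g -> eqm M f g.
Proof. by move=> MN fg n nM; apply: fg; apply: leq_trans MN. Qed.
Lemma eqmD N f g f' g' : eqm N f g -> eqm N f' g' -> eqm N (f + f') (g + g').
Proof. by move=> h h' n nN; rewrite !fpsD h ?h'. Qed.
Lemma eqmM N f g f' g' : eqm N f g -> eqm N f' g' -> eqm N (f * f') (g * g').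
Proof.
move=> h h' n nN; rewrite !fpsM; apply: eq_bigr => i _.
rewrite h ?h' ?(leq_ltn_trans _ nN) ?leq_subr //; by rewrite -ltnS.
Qed.
Lemma eqm_all f g : (forall N, eqm N f g) -> f = g.
Proof. by move=> h; apply: fpsP => n; apply: (h n.+1). Qed.

Lemma eqm_fpsX N k : (N <= k)%N -> eqm N (fpsX k) 0.
Proof.
move=> Nk n nN; rewrite fps0 /=; case: eqP => // e.
by move: nN; rewrite e ltnNge Nk.
Qed.

Lemma eqm_sum N (I : Type) (r : seq I) (P : pred I) (F G : I -> fps) :
  (forall i, P i -> eqm N (F i) (G i)) ->
  eqm N (\sum_(i <- r | P i) F i) (\sum_(i <- r | P i) G i).
Proof.
move=> FG; apply: (big_ind2 (eqm N)) => // f g f' g'; exact: eqmD.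
Qed.

Lemma eqm_prod N (I : Type) (r : seq I) (P : pred I) (F G : I -> fps) :
  (forall i, P i -> eqm N (F i) (G i)) ->
  eqm N (\prod_(i <- r | P i) F i) (\prod_(i <- r | P i) G i).
Proof.
move=> FG; apply: (big_ind2 (eqm N)) => // f g f' g'; exact: eqmM.
Qed.

(** By induction on [n]: the coefficient of degree [n] of [u * f] is that of [f]
    plus terms in which only coefficients of [f] of lower degree occur. *)
Lemma eqm_cancel N (u f g : fps) : u 0%N = 1 -> eqm N (u * f) (u * g) -> eqm N f g.
Proof.
move=> u0 h n; elim/ltn_ind: n => n IH nN.
have := h n nN; rewrite !fpsM !big_ord_recl /= !u0 !mul1r !subn0.
under eq_bigr => i _.
  rewrite IH; first over.
  - by rewrite /bump /= add1n ltn_subrL /= (leq_ltn_trans (leq0n i)).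
  - by apply: leq_ltn_trans nN; apply: leq_subr.
by move/addIr.
Qed.

(** * Infinite products *)

(** The factors of index [n] and more do not contribute to the coefficient of
    degree [n] as soon as [f] is [prodable]. *)
Definition fprod (f : nat -> fps) := FPS (fun n => (\prod_(0 <= i < n) f i) n).

Definition prodable (f : nat -> fps) := forall i, eqm i.+1 (f i) 1.

Lemma prodable_partial f M N : prodable f -> (M <= N)%N ->
  eqm M.+1 (\prod_(0 <= i < N) f i) (\prod_(0 <= i < M) f i).
Proof.
move=> hf; elim: N => [|N IH]; first by rewrite leqn0 => /eqP ->.
rewrite leq_eqVlt => /orP[/eqP -> //|]; rewrite ltnS => MN.
rewrite big_nat_recr //= -[X in eqm _ _ X]mulr1.
apply: eqmM; first exact: IH.
exact: eqm_le (hf N).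
Qed.

Lemma fprod_partial f N : prodable f -> eqm N.+1 (fprod f) (\prod_(0 <= i < N) f i).
Proof.
move=> hf n; rewrite ltnS => nN /=.
by rewrite (prodable_partial hf nN).
Qed.

Lemma prodableM f g : prodable f -> prodable g -> prodable (fun i => f i * g i).
Proof. by move=> hf hg i; rewrite -[X in eqm _ _ X]mulr1; apply: eqmM. Qed.

Lemma fprodM f g : prodable f -> prodable g ->
  fprod f * fprod g = fprod (fun i => f i * g i).
Proof.
move=> hf hg; apply: eqm_all => N; apply: (@eqm_le _ N.+1) => //.
apply: eqm_trans (eqm_sym (fprod_partial (N := N) (prodableM hf hg))).
by rewrite big_split /=; apply: eqmM; apply: fprod_partial.
Qed.

Lemma fprod1 f : (forall i, f i = 1) -> fprod f = 1.
Proof. by move=> f1; apply: fpsP => n /=; rewrite big1. Qed.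

(** * Locally finite sums of monomials *)

(** The sum of the monomials [c t X^(e t)]. The index type is arbitrary, so that
    series can be compared by bijections of their index types. *)
Definition gsum (T : choiceType) (e : T -> nat) (c : T -> int) :=
  FPS (fun n => \sum_(t \in [set t | e t = n]) c t).

Definition locfin (T : choiceType) (e : T -> nat) :=
  forall n, finite_set [set t | e t = n].

Lemma gsumE (T : choiceType) (e : T -> nat) (c : T -> int) (s : seq T) n :
  uniq s -> (forall t, e t = n -> t \in s) ->
  gsum e c n = \sum_(t <- s) (if e t == n then c t else 0).
Proof.
move=> us es /=; rewrite -big_mkcond /= (bigfs _ us).
  by apply: eq_fsbigl; apply/seteqP; split=> t /=; rewrite ?inE => /eqP.
by move=> t /eqP /es ->.
Qed.

Lemma locfin_seq (T : choiceType) (e : T -> nat) n : locfin e ->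
  exists2 s : seq T, uniq s & forall t, (e t <= n)%N -> t \in s.
Proof.
move=> lf.
have fin : finite_set [set t | (e t <= n)%N].
  apply: (@sub_finite_set _ _ (\bigcup_(i in `I_n.+1) [set t | e t = i])%classic).
    by move=> t /= h; exists (e t).
  by apply: bigcup_finite => // i _; apply: lf.
exists (finmap.enum_fset (fset_set [set t | (e t <= n)%N])); first exact: finmap.fset_uniq.
by move=> t tn; rewrite in_fset_set // inE.
Qed.

Lemma seq_locfin (T : choiceType) (e : T -> nat) :
  (forall n, exists s : seq T, forall t, e t = n -> t \in s) -> locfin e.
Proof.
move=> h n; have [s hs] := h n.
by apply: (sub_finite_set _ (finite_seq s)) => t /= /hs.
Qed.

Lemma gsum_eq (T : choiceType) (e e' : T -> nat) (c c' : T -> int) :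
  e =1 e' -> c =1 c' -> gsum e c = gsum e' c'.
Proof. by move=> /funext -> /funext ->. Qed.

Lemma gsum_reindex (T U : choiceType) (h : T -> U) (e : U -> nat) (c : U -> int) :
  bijective h -> gsum e c = gsum (e \o h) (c \o h).
Proof.
case=> g hK gK; apply: fpsP => n /=.
apply: (reindex_fsbig h); split=> [t //|x y _ _ exy|t /= ent].
  exact: can_inj exy.
by exists (g t); rewrite /= gK.
Qed.

Lemma locfin_inj (T U : choiceType) (h : T -> U) (e : U -> nat) :
  injective h -> locfin e -> locfin (e \o h).
Proof.
move=> hi lf n; have := finite_preimage _ (lf n).
by move=> /(_ _ h); apply => x y _ _; apply: hi.
Qed.

Lemma gsumN (T : choiceType) (e : T -> nat) (c : T -> int) :
  - gsum e c = gsum e (fun t => - c t).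
Proof.
apply: fpsP => n /=; rewrite -mulN1r mulr_fsumr.
by apply: eq_fsbigr => t _; rewrite mulN1r.
Qed.

Lemma gsumX (T : choiceType) k (e : T -> nat) (c : T -> int) :
  fpsX k * gsum e c = gsum (fun t => k + e t)%N c.
Proof.
apply: fpsP => n; rewrite fpsXM /=; case: leqP => kn.
  by apply: eq_fsbigl; apply/seteqP; split=> t /=; lia.
by rewrite fsbig1 // => t /= h; move: kn; rewrite -h ltnNge leq_addr.
Qed.

Lemma locfinM (T U : choiceType) (e : T -> nat) (e' : U -> nat) :
  locfin e -> locfin e' -> locfin (fun p : T * U => e p.1 + e' p.2)%N.
Proof.
move=> lf lf'; apply: seq_locfin => n.
have [s _ hs] := locfin_seq n lf; have [s' _ hs'] := locfin_seq n lf'.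
exists [seq (x, y) | x <- s, y <- s'] => -[x y] /= exy.
by apply: allpairs_f; [apply: hs|apply: hs']; rewrite -exy ?leq_addr ?leq_addl.
Qed.

Lemma gsumM (T U : choiceType) (e : T -> nat) (e' : U -> nat) c c' :
  locfin e -> locfin e' ->
  gsum e c * gsum e' c' =
  gsum (fun p : T * U => e p.1 + e' p.2)%N (fun p => c p.1 * c' p.2).
Proof.
move=> lf lf'; apply: fpsP => n; rewrite fpsM.
have [s us hs] := locfin_seq n lf; have [s' us' hs'] := locfin_seq n lf'.
rewrite (@gsumE _ _ _ [seq (x, y) | x <- s, y <- s']); first last.
- move=> [x y] /= exy.
  by apply: allpairs_f; [apply: hs|apply: hs']; rewrite -exy ?leq_addr ?leq_addl.
- by rewrite allpairs_uniq // => -[? ?] [? ?].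
rewrite big_allpairs_dep [X in _ = X]/=.
transitivity (\sum_(i < n.+1) \sum_(x <- s) \sum_(y <- s')
   (if (e x == i) && (e' y == n - i)%N then c x * c' y else 0)).
  apply: eq_bigr => i _; have lein : (i <= n)%N by rewrite -ltnS.
  rewrite (@gsumE _ _ _ s) //; last by move=> t et; apply: hs; rewrite et.
  rewrite (@gsumE _ _ _ s') //; last by move=> t et; apply: hs'; rewrite et leq_subr.
  rewrite mulr_suml; apply: eq_bigr => x _; rewrite mulr_sumr.
  by apply: eq_bigr => y _; do 2![case: eqP => _ //=]; rewrite ?mul0r ?mulr0.
rewrite exchange_big /=; apply: eq_bigr => x _; rewrite exchange_big /=.
apply: eq_bigr => y _; case: eqP => [exy|nexy].
  have lt : (e x < n.+1)%N by rewrite ltnS -exy leq_addr.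
  rewrite (bigD1 (Ordinal lt)) //= eqxx big1 => [|i /eqP ni].
    by rewrite -exy addKn eqxx addr0.
  by case: eqP => // ei; case: ni; apply: val_inj.
rewrite big1 // => i _; case: eqP => //= ei; case: eqP => //= e'i.
by case: nexy; rewrite ei e'i subnKC // -ltnS.
Qed.

(** After a bijection onto [T * F], this cuts a series into residue classes. *)
Lemma gsum_split (T : choiceType) (F : finType) (e : T * F -> nat) c : locfin e ->
  gsum e c = \sum_(i : F) gsum (fun t => e (t, i)) (fun t => c (t, i)).
Proof.
move=> lf; apply: fpsP => n; rewrite fps_sum.
have [s us hs] := locfin_seq n lf; pose s1 := undup [seq x.1 | x <- s].
have hs1 t i : e (t, i) = n -> t \in s1.
  move=> et; rewrite mem_undup; apply/mapP; exists (t, i) => //.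
  by apply: hs; rewrite et.
rewrite (@gsumE _ _ _ [seq (x, y) | x <- s1, y <- enum F]); first last.
- by move=> [t i] /= /hs1 h; rewrite allpairs_f ?mem_enum.
- by rewrite allpairs_uniq ?undup_uniq ?enum_uniq // => -[? ?] [? ?].
rewrite big_allpairs_dep exchange_big big_enum; apply: eq_bigr => i _.
by rewrite (@gsumE _ _ _ s1) ?undup_uniq // => t; apply: hs1.
Qed.

(** * Theta series and the triple product identity *)

(** The exponent [b j (j - 1) / 2 + a j] of the triple product; the formula for
    negative [j] avoids negative terms when [a <= b]. *)
Definition theta_exp a b (j : int) : nat :=
  match j with
  | Posz m => b * 'C(m, 2) + a * m
  | Negz m => b * 'C(m.+1, 2) + (b - a) * m.+1
  end%N.

Lemma bin2_double n : ('C(n, 2) * 2)%N = (n * n.-1)%N.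
Proof. by rewrite (bin_ffact n 2) ffactnS ffactn1. Qed.

Lemma theta_exp2 a b j : (a <= b)%N ->
  (theta_exp a b j)%:Z * 2 = b%:Z * (j * (j - 1)) + 2 * a%:Z * j.
Proof.
move=> ab; case: j => m /=.
  have h : ('C(m, 2))%:Z * 2 = m%:Z * (m%:Z - 1).
    by have := bin2_double m; case: m => [|m] //=; lia.
  by rewrite PoszD !PoszM mulrDl -mulrA h; ring.
have h : ('C(m.+1, 2))%:Z * 2 = (m.+1)%:Z * ((m.+1)%:Z - 1).
  by have := bin2_double m.+1 => /=; lia.
rewrite PoszD !PoszM -(subzn ab) NegzE mulrDl -mulrA h.
by move: (m.+1)%:Z => M; ring.
Qed.

Lemma theta_exp_ge a b j : (0 < a < b)%N -> (`|j| <= theta_exp a b j)%N.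
Proof.
move=> /andP[a0 ab]; case: j => m /=; rewrite ?absz_nat ?NegzE ?abszN ?absz_nat.
  by apply: leq_trans (leq_addl _ _); rewrite leq_pmull.
by apply: leq_trans (leq_addl _ _); rewrite leq_pmull // subn_gt0.
Qed.

Lemma locfin_theta a b : (0 < a < b)%N -> locfin (theta_exp a b).
Proof.
move=> hab; apply: seq_locfin => n.
exists ([seq Posz i | i <- iota 0 n.+1] ++ [seq Negz i | i <- iota 0 n.+1]) => t tn.
have := theta_exp_ge t hab; rewrite tn mem_cat.
case: t {tn} => m h; apply/orP; [left|right]; rewrite mem_map ?mem_iota //.
- by move=> ? ? [].
- by move: h; rewrite NegzE abszN absz_nat => /ltnW; rewrite ltnS.
- by move=> ? ? [].
Qed.

Definition theta a b := gsum (theta_exp a b) (fun j => (-1) ^+ `|j|%N).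
Definition utheta a b := gsum (theta_exp a b) (fun=> 1).
Arguments theta (a b)%_N.
Arguments utheta (a b)%_N.

(** The series of the infinite product [(q^a; q^b)]. *)
Definition qprod a b := fprod (fun i => 1 - fpsX (a + b * i)%N).
Arguments qprod (a b)%_N.

Lemma prodable_qprod a b : (0 < a)%N -> (0 < b)%N ->
  prodable (fun i => 1 - fpsX (a + b * i)%N).
Proof.
move=> a0 b0 i; rewrite -[X in eqm _ _ X]subr0.
apply: eqmD => // n ni; rewrite !fpsN (@eqm_fpsX i.+1) //; nia.
Qed.

Section FiniteTripleProduct.
Variables (R : comNzRingType) (x y t : R).
Hypothesis xy : x * y = t.

(** The Gaussian binomial coefficient of [2 n] over [n + j] in base [t], through
    the recurrence that multiplication by [(1 + x t^n) (1 + y t^n)] induces. *)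
Fixpoint cgauss n j : R :=
  if n is n'.+1 then
    (1 + t ^+ (2 * n' + 1)%N) * cgauss n' j
    + t ^+ (n'.+1 - j)%N * cgauss n' (if j is j'.+1 then j' else 1)
    + t ^+ (n'.+1 + j)%N * cgauss n' j.+1
  else (j == 0%N)%:R.

Lemma cgauss_gt n j : (n < j)%N -> cgauss n j = 0.
Proof.
elim: n j => [|n IH] [|j] //= nj.
by rewrite !IH ?mulr0 ?addr0 // ltnW // ltnW.
Qed.

Lemma cgauss_diag n : cgauss n n = 1.
Proof.
by elim: n => //= n ->; rewrite subnn expr0 !cgauss_gt ?mulr0 ?addr0 ?add0r ?mulr1.
Qed.

(* The terms of index [j] and [- j] of the triple product are summed together. *)
Let w j := if j is 0 then 1 else x ^+ j + y ^+ j.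

Lemma finite_triple n :
  \prod_(0 <= i < n) ((1 + x * t ^+ i) * (1 + y * t ^+ i)) =
  \sum_(0 <= j < n.+1) cgauss n j * t ^+ 'C(j, 2) * w j.
Proof.
elim: n => [|n IH]; first by rewrite big_geq // big_nat1 /= expr0 !mulr1.
rewrite big_nat_recr // {}IH.
pose f j := cgauss n j * t ^+ 'C(j, 2).
pose w' j := if j is j'.+1 then (if j' is 0 then 2 else w j') else 0.
have fgt j : (n < j)%N -> f j = 0 by move=> nj; rewrite /f cgauss_gt ?mul0r.
have stepw j : (x + y) * w j = w j.+1 + t * w' j.
  case: j => [|[|j]] /=; first by rewrite !expr1; ring.
    by rewrite -xy; ring.
  by rewrite -xy !exprS; ring.
have stepg j : cgauss n.+1 j * t ^+ 'C(j, 2) = (1 + t ^+ (2 * n + 1)%N) * f j +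
    t ^+ n * (if j is j'.+1 then f j' else t * f 1%N) + t ^+ n * t * f j.+1.
  rewrite /= !mulrDl -!mulrA -/(f j); congr (_ + _ + _).
    case: j => [|j]; first by rewrite /f subn0 exprS !bin_small //; ring.
    case: (leqP j n) => jn; last by rewrite fgt ?cgauss_gt ?mulr0 ?mul0r ?mulr0.
    rewrite /f mulrCA -exprD binS bin1 mulrCA -exprD; congr (_ * t ^+ _); lia.
  by rewrite /f binS bin1 addSn exprS !exprD; ring.
rewrite [X in X = _]/= [RHS](eq_bigr (fun j => (1 + t ^+ (2 * n + 1)%N) * (f j * w j) +
    t ^+ n * ((if j is j'.+1 then f j' else t * f 1%N) * w j) +
    t ^+ n * t * (f j.+1 * w j))); last first.
  by move=> j _; rewrite stepg; ring.
rewrite !big_split -!mulr_sumr /=.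
set A := \sum_(0 <= j < n.+2) f j * w j.
set B := \sum_(0 <= j < n.+2) _; set C := \sum_(0 <= j < n.+2) _.
rewrite [X in X * _ = _](_ : _ = A); last first.
  by rewrite /A [in RHS]big_nat_recr //= fgt // mul0r addr0.
have key : (x + y) * A = B + t * C; last first.
  have -> : (1 + x * t ^+ n) * (1 + y * t ^+ n) =
            1 + t ^+ (2 * n + 1)%N + t ^+ n * (x + y).
    by rewrite exprD mulnC exprM expr1 -xy; ring.
  rewrite mulrDr (_ : A * (_ * (x + y)) = t ^+ n * ((x + y) * A)); last by ring.
  by rewrite key; ring.
rewrite /A mulr_sumr (eq_bigr (fun j => f j * w j.+1 + t * (f j * w' j))); last first.
  by move=> j _; rewrite mulrCA stepw; ring.
rewrite big_split -mulr_sumr /= /B [X in _ = X + _]big_nat_recl //= mulr1.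
rewrite [X in X + _ = _]big_nat_recr //= fgt // mul0r addr0.
rewrite [X in _ + _ * X = _]big_nat_recl //= mulr0 add0r.
set D := (X in _ + t * X = _); suff -> : D = f 1%N + C by ring.
have -> : C = \sum_(0 <= j < n) f j.+1 * w j.
  by rewrite /C 2?big_nat_recr //= !fgt ?mul0r ?addr0.
rewrite {}/D; case: n {stepg A B C} f fgt => [|n] f fgt.
  by rewrite big_nat1 big_geq // fgt //; ring.
by rewrite big_nat_recl // [in RHS]big_nat_recl //= big_nat_recr //= (fgt n.+2) //; ring.
Qed.

Let P m : R := \prod_(0 <= i < m) (1 - t ^+ i.+1).

Let PS m : P m.+1 = P m * (1 - t ^+ m.+1).
Proof. by rewrite /P big_nat_recr. Qed.

Lemma cgaussE n j : (j <= n)%N -> cgauss n j * P (n + j)%N * P (n - j)%N = P (2 * n)%N.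
Proof.
elim: n j => [|n IH] j.
  by rewrite leqn0 => /eqP ->; rewrite /P /= big_geq // !mulr1.
rewrite leq_eqVlt => /orP[/eqP -> {j}|].
  by rewrite cgauss_diag subnn /P [X in _ * X]big_geq // mul1r mulr1 mul2n addnn.
rewrite ltnS => jn.
have T0 : cgauss n j * P (n.+1 + j)%N * P (n.+1 - j)%N =
          P (2 * n)%N * (1 - t ^+ (n + j).+1) * (1 - t ^+ (n - j).+1).
  by rewrite -(IH j jn) subSn // addSn !PS; ring.
have T2 : cgauss n j.+1 * P (n.+1 + j)%N * P (n.+1 - j)%N =
          P (2 * n)%N * (1 - t ^+ (n - j)) * (1 - t ^+ (n - j).+1).
  move: jn; rewrite leq_eqVlt => /orP[/eqP ->|jn].
    by rewrite cgauss_gt // subnn expr0 subrr mulr0 !mul0r.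
  rewrite -(IH j.+1 jn) addSnnS subSn ?PS 1?ltnW //.
  by have -> : (n - j)%N = (n - j.+1).+1 by [lia]; rewrite PS; ring.
have T1 : cgauss n (if j is j'.+1 then j' else 1) * P (n.+1 + j)%N * P (n.+1 - j)%N =
          P (2 * n)%N * (1 - t ^+ (n + j)) * (1 - t ^+ (n + j).+1).
  case: j jn {T0} T2 => [_ ->|j jn _]; first by rewrite addn0 subn0.
  by rewrite -(IH j (ltnW jn)) subSS addSn addnS !PS; ring.
rewrite /= !mulrDl -!mulrA !(mulrA (cgauss _ _)) T0 T1 T2.
rewrite mulnS !PS.
have -> : (2 * n).+1 = ((n + j) + (n - j).+1)%N by lia.
have -> : ((n + j) + (n - j).+1).+1 = ((n + j) + 2 + (n - j))%N by lia.
have -> : (2 * n + 1)%N = ((n + j) + (n - j) + 1)%N by lia.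
have -> : (n.+1 - j)%N = (n - j).+1 by lia.
have -> : (n.+1 + j)%N = (n + j).+1 by lia.
move: (n + j)%N (n - j)%N => u v; rewrite !exprD !exprS expr0; ring.
Qed.

End FiniteTripleProduct.

Lemma one_sub_fpsX_unit k : (0 < k)%N -> eqm 1 (1 - fpsX k) 1.
Proof.
move=> k0; rewrite -[X in eqm _ _ X]subr0; apply: eqmD => // n n1.
by rewrite !fpsN (@eqm_fpsX 1).
Qed.

(** In [cgaussE], the three products all agree with [(t; t)] to the order
    [n - j]. *)
Lemma cgauss_lim b n j : (0 < b)%N -> (j <= n)%N ->
  eqm (n - j).+1 (qprod b b * cgauss (fpsX b) n j) 1.
Proof.
move=> b0 jn; set g := cgauss _ _ _.
pose P m : fps := \prod_(0 <= i < m) (1 - fpsX b ^+ i.+1).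
have limP m : (n - j <= m)%N -> eqm (n - j).+1 (qprod b b) (P m).
  move=> h; apply: (@eqm_le _ m.+1); first by rewrite ltnS.
  apply: eqm_trans (fprod_partial (prodable_qprod b0 b0)) _.
  rewrite /P; under eq_bigr => i _ do rewrite -mulnS -fpsX_exp.
  exact: eqm_refl.
apply: (@eqm_cancel _ (P (n + j)%N * P (n - j)%N)).
  have c1 m : P m 0%N = 1.
    suff h : eqm 1 (P m) (\prod_(0 <= i < m) 1) by rewrite h // big1 // fps1.
    apply: eqm_prod => i _; rewrite fpsX_exp; apply: one_sub_fpsX_unit.
    by rewrite muln_gt0 b0.
  by rewrite fpsM big_ord1 subn0 !c1 mulr1.
have -> : P (n + j)%N * P (n - j)%N * (qprod b b * g) =
          qprod b b * (g * P (n + j)%N * P (n - j)%N) by ring.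
rewrite mulr1 (cgaussE (fpsX b) jn) -/(P _).
apply: (@eqm_trans _ (qprod b b * qprod b b)).
  by apply: eqmM => //; apply: eqm_sym; apply: limP; lia.
by apply: eqmM; apply: limP; lia.
Qed.

Lemma sum_int_range (V : zmodType) n (F : int -> V) :
  \sum_(j <- [seq Posz i | i <- iota 0 n.+1] ++ [seq Negz i | i <- iota 0 n]) F j =
  F 0 + \sum_(0 <= i < n) (F (Posz i.+1) + F (Negz i)).
Proof.
have iotaE m : iota 0 m = index_iota 0 m by rewrite /index_iota subn0.
by rewrite big_cat !big_map !iotaE [X in _ X _ = _]big_nat_recl //= -addrA -big_split.
Qed.

(** Jacobi's triple product, as the limit of [finite_triple] at [x = - X^a] and
    [y = - X^(b - a)]. *)
Lemma triple_product a b : (0 < a < b)%N ->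
  theta a b = qprod a b * qprod (b - a) b * qprod b b.
Proof.
move=> hab; have /andP[a0 ab] := hab; have b0 : (0 < b)%N by apply: ltn_trans ab.
have ba0 : (0 < b - a)%N by rewrite subn_gt0.
apply: eqm_all => N; set n := (2 * N)%N.
pose x : fps := - fpsX a; pose y : fps := - fpsX (b - a); pose t : fps := fpsX b.
have xy : x * y = t by rewrite /x /y mulrNN -fpsXD subnKC // ltnW.
have := finite_triple xy n; rewrite big_split /= => fin.
apply: eqm_sym; apply: (@eqm_trans _ (qprod b b * (\prod_(0 <= i < n) (1 + x * t ^+ i) *
    \prod_(0 <= i < n) (1 + y * t ^+ i)))).
  rewrite mulrC; apply: eqmM => //; apply: eqmM; apply: (@eqm_le _ n.+1);
    rewrite /n; try lia.
  - apply: eqm_trans (fprod_partial (prodable_qprod a0 b0)) _.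
    under eq_bigr => i _ do rewrite fpsXD -fpsX_exp -mulNr.
    exact: eqm_refl.
  - apply: eqm_trans (fprod_partial (prodable_qprod ba0 b0)) _.
    under eq_bigr => i _ do rewrite fpsXD -fpsX_exp -mulNr.
    exact: eqm_refl.
rewrite {}fin mulr_sumr.
pose w j := if j is 0 then 1 else x ^+ j + y ^+ j.
have xE j : x ^+ j = (-1) ^+ j * fpsX (a * j) by rewrite /x (exprNn (fpsX a)) fpsX_exp.
have yE j : y ^+ j = (-1) ^+ j * fpsX ((b - a) * j).
  by rewrite /y (exprNn (fpsX _)) fpsX_exp.
apply: (@eqm_trans _ (\sum_(0 <= j < n.+1) t ^+ 'C(j, 2) * w j)).
  rewrite big_nat [X in eqm _ _ X]big_nat; apply: eqm_sum => j /andP[_ jn].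
  have [jN|Nj] := ltnP j N.
    rewrite 2!mulrA -[X in eqm _ _ X]mul1r -[X in eqm _ X _]mulrA.
    apply: eqmM => //; apply: (@eqm_le _ (n - j).+1); first by rewrite /n; lia.
    exact: cgauss_lim.
  have w0 : eqm N (w j) 0.
    case: j Nj {jn} => [|j] Nj; first by rewrite leqn0 in Nj; rewrite (eqP Nj).
    rewrite /w xE yE -[X in eqm _ _ X](addr0 0).
    by apply: eqmD; rewrite -[X in eqm _ _ X](mulr0 ((-1) ^+ j.+1));
       apply: eqmM => //; apply: eqm_fpsX; nia.
  apply: (@eqm_trans _ 0); [|apply: eqm_sym].
    rewrite mulrA -[X in eqm _ _ X](mulr0 (qprod b b * (cgauss t n j * t ^+ 'C(j, 2)))).
    exact: eqmM.
  rewrite -[X in eqm _ _ X](mulr0 (t ^+ 'C(j, 2))).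
  exact: eqmM.
move=> k kN; rewrite (@gsumE _ _ _
  ([seq Posz i | i <- iota 0 n.+1] ++ [seq Negz i | i <- iota 0 n])); first last.
- move=> j jk; have := theta_exp_ge j hab; rewrite jk mem_cat.
  case: j {jk} => m h; apply/orP; [left|right]; rewrite mem_map ?mem_iota //=.
  + by rewrite absz_nat in h; rewrite add0n /n; lia.
  + by move=> ? ? [].
  + by rewrite NegzE abszN absz_nat in h; rewrite add0n /n; lia.
  + by move=> ? ? [].
- rewrite cat_uniq !map_inj_uniq ?iota_uniq /=; try by move=> ? ? [].
  rewrite andbT; apply/hasPn => j /mapP[i _ ->]; apply/negP => /mapP[] //.
have signX c m e : ((-1) ^+ c * fpsX m : fps) e = if m == e then (-1) ^+ c else 0.
  rewrite -signr_odd (_ : _ ^+ odd c = if odd c then -1 else 1 :> fps); last by case: odd.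
  rewrite -[in RHS]signr_odd.
  by case: (odd c); rewrite ?mulN1r ?mul1r ?fpsN /= (eq_sym e); case: eqP => _ //=; rewrite oppr0.
rewrite sum_int_range big_nat_recl // fpsD fps_sum.
congr (_ + _).
  by rewrite /w mulr1 bin_small // expr0 fps1 /= !muln0 addn0 eq_sym; case: eqP.
apply: eq_bigr => i _; rewrite /w xE yE mulrDr fpsD.
rewrite !(mulrCA (t ^+ _)) /t fpsX_exp -!fpsXD !signX NegzE.
by rewrite abszN absz_nat.
Qed.

(** * Products of two theta series *)

Lemma sign_absz (i j : int) :
  (-1) ^+ absz (i + j) = (-1) ^+ absz i * (-1) ^+ absz j :> int.
Proof.
rewrite -exprD -signr_odd -[RHS]signr_odd; congr (_ ^+ nat_of_bool _); lia.
Qed.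

(** The coordinates [(m + n) / 2] and [(m - n) / 2], rounded, on the two classes
    of the parity of [m + n]. *)
Lemma parity_bij : bijective (fun p : (int * int) * bool =>
  (p.1.1 + p.1.2, p.1.1 - p.1.2 + (if p.2 then 1 else 0))).
Proof.
pose S (m n : int) := ((m + n) %/ 2)%Z.
exists (fun p : int * int => ((S p.1 p.2, p.1 - S p.1 p.2), ((p.1 + p.2) %% 2)%Z == 1)).
  move=> [[i j] b] /=; rewrite /S.
  have e : i + j + (i - j + (if b then 1 else 0)) = i * 2 + (if b then 1 else 0) by ring.
  by rewrite e; congr (_, _, _); case: b {e} => /=; lia.
move=> [m n] /=; rewrite /S; congr (_, _); first by ring.
by case: eqP => /= h; lia.
Qed.

Definition theta2_even a b c d :=
  gsum (fun p : int * int => theta_exp a b (p.1 + p.2) + theta_exp c d (p.1 - p.2))%N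
       (fun=> 1).
Definition theta2_odd a b c d :=
  gsum (fun p : int * int => theta_exp a b (p.1 + p.2) + theta_exp c d (p.1 - p.2 + 1))%N
       (fun=> 1).

(** In the coordinates of [parity_bij] the sign [(-1)^(m + n)] depends only on the
    class, which leaves two series without signs. *)
Lemma thetaM a b c d : (0 < a < b)%N -> (0 < c < d)%N ->
  theta a b * theta c d = theta2_even a b c d - theta2_odd a b c d.
Proof.
move=> hab hcd; have lf := locfinM (locfin_theta hab) (locfin_theta hcd).
rewrite /theta (gsumM _ _ (locfin_theta hab) (locfin_theta hcd)).
rewrite (gsum_reindex _ _ parity_bij) gsum_split; last first.
  by apply: locfin_inj lf; apply: bij_inj parity_bij.
rewrite big_bool addrC /= gsumN; congr (_ + _); apply: gsum_eq => -[i j] //=.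
- rewrite -sign_absz (_ : i + j + (i - j + 1) = i * 2 + 1); last by ring.
  by rewrite sign_absz abszM mulnC exprM (_ : _ ^+ absz 2 = 1) // expr1n mul1r.
- by rewrite addr0.
- rewrite addr0 -sign_absz (_ : i + j + (i - j) = i * 2); last by ring.
  by rewrite abszM mulnC exprM (_ : _ ^+ absz 2 = 1) // expr1n.
Qed.

Lemma eq_doubled (m n : nat) : m%:Z * 2 = n%:Z * 2 -> m = n.
Proof. by lia. Qed.

Lemma gsum_one_reindex (T U : choiceType) (h : T -> U) (e : T -> nat) (e' : U -> nat) :
  bijective h -> e =1 e' \o h -> gsum e (fun=> 1) = gsum e' (fun=> 1).
Proof. by move=> hb ee'; rewrite (gsum_reindex _ _ hb); apply: gsum_eq. Qed.

Lemma uthetaM a b c d : (0 < a < b)%N -> (0 < c < d)%N ->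
  utheta a b * utheta c d =
  gsum (fun p : int * int => theta_exp a b p.1 + theta_exp c d p.2)%N (fun=> 1).
Proof.
move=> hab hcd; rewrite /utheta (gsumM _ _ (locfin_theta hab) (locfin_theta hcd)).
by apply: gsum_eq => // p; rewrite mulr1.
Qed.

(** Products of two theta series of the same modulus lie in the span of products
    of unsigned theta series of twice the modulus: they are 2 by 2 minors, and
    three-term relations between theta series are Pluecker relations. *)
Lemma thetaM_minor b p r : (0 < r < p)%N -> (p + r < b)%N ->
  theta p b * theta r b =
  utheta (p + r) (2 * b) * utheta (b + (p - r)) (2 * b)
  - fpsX r * (utheta (b + (p + r)) (2 * b) * utheta (p - r) (2 * b)).
Proof.
move=> /andP[r0 rp] prb; rewrite thetaM ?uthetaM ?gsumX; try by lia.
have e1 : (p - r)%N%:Z = p%:Z - r%:Z by rewrite subzn // ltnW.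
congr (_ - _); apply: gsum_eq => // -[i j] /=; apply: eq_doubled;
  rewrite !PoszD !mulrDl !theta_exp2 ?PoszM ?PoszD ?e1; try lia; ring.
Qed.

(** * Four theta identities *)

Ltac theta_reindex h g :=
  apply: (@gsum_one_reindex _ _ h);
    [by exists g => -[i j] /=; congr (_, _); ring
    |move=> [i j] /=; apply: eq_doubled; rewrite !PoszD !mulrDl !theta_exp2 //; ring].

Lemma theta_sym a b : (0 < a < b)%N -> theta a b = theta (b - a) b.
Proof.
move=> /[dup] hab /andP[a0 ab]; rewrite !triple_product ?subKn ?(ltnW ab) //.
  by congr (_ * _); rewrite mulrC.
by rewrite subn_gt0 ab /= ltn_subrL a0 (ltn_trans a0).
Qed.

(** The two relations below are Pluecker relations between the minors of
    [thetaM_minor]; the factor [theta 4 10] is also used as [theta 6 10]. *)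
Lemma theta10_sum :
  theta 2 10 ^+ 2 * theta 3 10 * theta 5 10 =
  theta 1 10 * theta 3 10 * theta 4 10 ^+ 2
  + fpsX 1 * (theta 1 10 ^+ 2 * theta 2 10 * theta 4 10).
Proof.
have e46 : theta 4 10 = theta 6 10 by rewrite theta_sym.
transitivity ((theta 5 10 * theta 2 10) * (theta 3 10 * theta 2 10)); first by ring.
transitivity ((theta 4 10 * theta 3 10) * (theta 4 10 * theta 1 10)
   + fpsX 1 * ((theta 2 10 * theta 1 10) * (theta 6 10 * theta 1 10))); last first.
  by rewrite -e46; ring.
have X2 : fpsX 2 = fpsX 1 * fpsX 1 by rewrite -fpsXD.
have X3 : fpsX 3 = fpsX 1 * fpsX 1 * fpsX 1 by rewrite -!fpsXD.
have m52 : theta 5 10 * theta 2 10 =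
    utheta 7 20 * utheta 13 20 - fpsX 2 * (utheta 17 20 * utheta 3 20).
  exact: (@thetaM_minor 10).
have m32 : theta 3 10 * theta 2 10 =
    utheta 5 20 * utheta 11 20 - fpsX 2 * (utheta 15 20 * utheta 1 20).
  exact: (@thetaM_minor 10).
have m43 : theta 4 10 * theta 3 10 =
    utheta 7 20 * utheta 11 20 - fpsX 3 * (utheta 17 20 * utheta 1 20).
  exact: (@thetaM_minor 10).
have m41 : theta 4 10 * theta 1 10 =
    utheta 5 20 * utheta 13 20 - fpsX 1 * (utheta 15 20 * utheta 3 20).
  exact: (@thetaM_minor 10).
have m21 : theta 2 10 * theta 1 10 =
    utheta 3 20 * utheta 11 20 - fpsX 1 * (utheta 13 20 * utheta 1 20).
  exact: (@thetaM_minor 10).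
have m61 : theta 6 10 * theta 1 10 =
    utheta 7 20 * utheta 15 20 - fpsX 1 * (utheta 17 20 * utheta 5 20).
  exact: (@thetaM_minor 10).
by rewrite m52 m32 m43 m41 m21 m61 X2 X3; ring.
Qed.

Lemma theta10_diff :
  theta 1 10 * theta 4 10 ^+ 2 * theta 5 10 =
  theta 2 10 * theta 3 10 ^+ 2 * theta 4 10
  - fpsX 1 * (theta 1 10 * theta 2 10 ^+ 2 * theta 3 10).
Proof.
have e46 : theta 4 10 = theta 6 10 by rewrite theta_sym.
have e37 : theta 3 10 = theta 7 10 by rewrite theta_sym.
transitivity ((theta 5 10 * theta 4 10) * (theta 4 10 * theta 1 10)); first by ring.
transitivity ((theta 6 10 * theta 3 10) * (theta 3 10 * theta 2 10)
   - fpsX 1 * ((theta 2 10 * theta 1 10) * (theta 7 10 * theta 2 10))); last first.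
  by rewrite -e46 -e37; ring.
have X2 : fpsX 2 = fpsX 1 * fpsX 1 by rewrite -fpsXD.
have X3 : fpsX 3 = fpsX 1 * fpsX 1 * fpsX 1 by rewrite -!fpsXD.
have X4 : fpsX 4 = fpsX 1 * fpsX 1 * fpsX 1 * fpsX 1 by rewrite -!fpsXD.
have m54 : theta 5 10 * theta 4 10 =
    utheta 9 20 * utheta 11 20 - fpsX 4 * (utheta 19 20 * utheta 1 20).
  exact: (@thetaM_minor 10).
have m41 : theta 4 10 * theta 1 10 =
    utheta 5 20 * utheta 13 20 - fpsX 1 * (utheta 15 20 * utheta 3 20).
  exact: (@thetaM_minor 10).
have m63 : theta 6 10 * theta 3 10 =
    utheta 9 20 * utheta 13 20 - fpsX 3 * (utheta 19 20 * utheta 3 20).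
  exact: (@thetaM_minor 10).
have m32 : theta 3 10 * theta 2 10 =
    utheta 5 20 * utheta 11 20 - fpsX 2 * (utheta 15 20 * utheta 1 20).
  exact: (@thetaM_minor 10).
have m21 : theta 2 10 * theta 1 10 =
    utheta 3 20 * utheta 11 20 - fpsX 1 * (utheta 13 20 * utheta 1 20).
  exact: (@thetaM_minor 10).
have m72 : theta 7 10 * theta 2 10 =
    utheta 9 20 * utheta 15 20 - fpsX 2 * (utheta 19 20 * utheta 5 20).
  exact: (@thetaM_minor 10).
by rewrite m54 m41 m63 m32 m21 m72 X2 X3 X4; ring.
Qed.

(** The quintuple product identity, at the two places where the 5-dissection
    of the Euler product needs it: under a rotation of the quadratic form
    [3 m^2 + n^2] the parity classes of the lattices match or cancel. *)
Lemma quintuple_A :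
  (theta 7 15 + fpsX 1 * theta 2 15) * theta 1 5 = theta 5 15 * theta 2 5.
Proof.
rewrite mulrDl -mulrA !thetaM // mulrBr /theta2_even /theta2_odd !gsumX.
set l1e := gsum _ _; set l1o := gsum _ _; set l2e := gsum _ _; set l2o := gsum _ _.
set re := gsum _ _; set ro := gsum _ _.
have -> : l1e = re by theta_reindex
  (fun p : int * int => (- p.2, p.1 + p.2))
  (fun p : int * int => (p.1 + p.2, - p.1)).
have -> : l1o = l2e by theta_reindex
  (fun p : int * int => (- p.1, p.1 + p.2))
  (fun p : int * int => (- p.1, p.1 + p.2)).
have -> : l2o = ro by theta_reindex
  (fun p : int * int => (- p.1 - p.2, p.2))
  (fun p : int * int => (- p.1 - p.2, p.2)).
by ring.
Qed.

Lemma quintuple_B :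
  (theta 4 15 - fpsX 1 * theta 1 15) * theta 2 5 = theta 5 15 * theta 1 5.
Proof.
rewrite mulrBl -mulrA !thetaM // mulrBr /theta2_even /theta2_odd !gsumX.
set l1e := gsum _ _; set l1o := gsum _ _; set l2e := gsum _ _; set l2o := gsum _ _.
set re := gsum _ _; set ro := gsum _ _.
have -> : l1e = re by theta_reindex
  (fun p : int * int => (p.1 + p.2, - p.2))
  (fun p : int * int => (p.1 + p.2, - p.2)).
have -> : l1o = l2o by theta_reindex
  (fun p : int * int => (- p.1 - p.2, p.1 + 1))
  (fun p : int * int => (p.2 - 1, - p.1 - p.2 + 1)).
have -> : l2e = ro by theta_reindex
  (fun p : int * int => (- p.1, p.1 + p.2))
  (fun p : int * int => (- p.1, p.1 + p.2)).
by ring.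
Qed.

Lemma sign_parity (i j : int) : odd (absz i) = odd (absz j) ->
  (-1) ^+ absz i = (-1) ^+ absz j :> int.
Proof. by move=> h; rewrite -signr_odd h signr_odd. Qed.

Lemma mod5_bij : bijective (fun p : int * 'I_5 =>
  match p.2 : nat with
  | 0 => p.1 * 5 | 1 => 1 - p.1 * 5 | 2 => 2 - p.1 * 5
  | 3 => p.1 * 5 - 2 | _ => p.1 * 5 - 1 end).
Proof.
pose r (j : int) := absz (j %% 5)%Z.
exists (fun j => (match r j with
   | 0 => (j %/ 5)%Z | 1 => ((1 - j) %/ 5)%Z | 2 => ((2 - j) %/ 5)%Z
   | 3 => ((j + 2) %/ 5)%Z | _ => ((j + 1) %/ 5)%Z end, inord (r j))).
- move=> [m i] /=; case: i => -[|[|[|[|[|]]]]] //= lt;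
  [ have -> : r (m * 5) = 0%N by (rewrite /r; lia)
  | have -> : r (1 - m * 5) = 1%N by (rewrite /r; lia)
  | have -> : r (2 - m * 5) = 2%N by (rewrite /r; lia)
  | have -> : r (m * 5 - 2) = 3%N by (rewrite /r; lia)
  | have -> : r (m * 5 - 1) = 4%N by (rewrite /r; lia) ];
  (congr (_, _); [lia | by apply: val_inj; rewrite /= inordK]).
- move=> j /=; have r5 : (r j < 5)%N by rewrite /r; lia.
  rewrite inordK //; have : r j = absz (j %% 5)%Z by [].
  by case: (r j) r5 => [|[|[|[|[|]]]]] //= _; lia.
Qed.

Lemma sign_parityN (i j : int) : odd (absz i) = ~~ odd (absz j) ->
  (-1) ^+ absz i = - (-1) ^+ absz j :> int.
Proof. by move=> h; rewrite -signr_odd h signrN signr_odd. Qed.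

(** The residues modulo 5 of the pentagonal numbers [n (3 n - 1) / 2] are 0, 1
    and 2; the classes of [n] modulo 5 give the five theta series. *)
Lemma pentagonal_dissection :
  theta 1 3 = theta 35 75 + fpsX 5 * theta 10 75 - fpsX 1 * theta 25 75
              - fpsX 2 * (theta 20 75 - fpsX 5 * theta 5 75).
Proof.
have lf := locfin_theta (isT : (0 < 1 < 3)%N).
have -> : theta 35 75 + fpsX 5 * theta 10 75 - fpsX 1 * theta 25 75
              - fpsX 2 * (theta 20 75 - fpsX 5 * theta 5 75) =
          theta 35 75 - fpsX 1 * theta 25 75 + fpsX 5 * theta 10 75
              + fpsX 7 * theta 5 75 - fpsX 2 * theta 20 75.
  by rewrite (fpsXD 2 5); ring.
rewrite {1}/theta (gsum_reindex _ _ mod5_bij) gsum_split; last first.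
  by apply: locfin_inj lf; apply: bij_inj mod5_bij.
rewrite !big_ord_recl big_ord0 addr0 !addrA /= /theta !gsumX !gsumN.
congr (_ + _ + _ + _ + _); apply: gsum_eq => m /=;
  try (apply: eq_doubled; rewrite ?PoszD ?mulrDl !theta_exp2 //; lia);
  by [apply: sign_parity; lia|apply: sign_parityN; lia].
Qed.

(** * Infinite products as products of shorter progressions *)

Lemma qprod_split m a b : (0 < a)%N -> (0 < b)%N -> (0 < m)%N ->
  qprod a b = \prod_(c < m) qprod (a + b * c) (b * m).
Proof.
move=> a0 b0 m0; apply: eqm_all => N.
apply: (@eqm_trans _ (\prod_(0 <= i < N * m) (1 - fpsX (a + b * i)))).
  apply: (@eqm_le _ (N * m).+1); first by nia.
  exact: fprod_partial (prodable_qprod a0 b0).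
rewrite big_nat_mul; apply: (@eqm_trans _ (\prod_(c < m) \prod_(0 <= i < N)
    (1 - fpsX (a + b * c + b * m * i)))); last first.
  apply: eqm_prod => c _; apply: eqm_sym; apply: (@eqm_le _ N.+1) => //.
  by apply: fprod_partial; apply: prodable_qprod; rewrite ?muln_gt0 ?b0 ?addn_gt0 ?a0.
rewrite exchange_big /=; apply: eqm_prod => i _.
rewrite -{1}[(i * m)%N]add0n big_addn mulSn addnK big_mkord.
apply: eqm_prod => c _; rewrite (_ : (a + b * (c + i * m) = a + b * c + b * m * i)%N) //.
by nia.
Qed.

(** * Evaluation of power series in the unit disc *)

Lemma triangle_sum (V : zmodType) M (F : nat -> nat -> V) :
  \sum_(0 <= n < M) \sum_(i < n.+1) F i (n - i)%N =
  \sum_(0 <= i < M) \sum_(0 <= j < M - i) F i j.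
Proof.
elim: M => [|M IH]; first by rewrite !big_geq.
rewrite big_nat_recr //= IH [RHS]big_nat_recr //= subSnn big_nat1.
rewrite big_ord_recr /= subnn addrA; congr (_ + _).
rewrite -(big_mkord xpredT (fun i => F i (M - i)%N)) -big_split /=.
rewrite big_nat [RHS]big_nat; apply: eq_bigr => i /andP[_ iM].
by rewrite subSn ?(ltnW iM) // big_nat_recr.
Qed.

Section Bounds.
Variable K : numFieldType.
Implicit Types (f g : fps) (t B : K).

Definition bnd f t B := forall N, \sum_(0 <= n < N) `|f n|%:~R * t ^+ n <= B.

(** Absolute convergence in the open unit disc, by bounds for the partial sums at
    every radius: no limit occurs, so that the algebra of such series is formal. *)
Definition good f := forall t, 0 < t < 1 -> exists B, bnd f t B.

Lemma bnd_ge0 f t B : bnd f t B -> 0 <= B.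
Proof. by move=> /(_ 0%N); rewrite big_geq. Qed.

Let term_ge0 f t n : 0 <= t -> 0 <= `|f n|%:~R * t ^+ n.
Proof. by move=> t0; rewrite mulr_ge0 ?exprn_ge0 // ler0z. Qed.

Lemma bndD f g t B B' : 0 <= t -> bnd f t B -> bnd g t B' -> bnd (f + g) t (B + B').
Proof.
move=> t0 hf hg N; apply: le_trans (lerD (hf N) (hg N)).
rewrite -big_split /=; apply: ler_sum => n _; rewrite -mulrDl.
by rewrite ler_wpM2r ?exprn_ge0 // -intrD ler_int ler_normD.
Qed.

Lemma bndN f t B : bnd f t B -> bnd (- f) t B.
Proof. by move=> hf N; under eq_bigr do rewrite fpsN normrN; apply: hf. Qed.

Lemma bndM f g t B B' : 0 <= t -> bnd f t B -> bnd g t B' -> bnd (f * g) t (B * B').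
Proof.
move=> t0 hf hg N.
pose F i j := (`|f i|%:~R * t ^+ i) * (`|g j|%:~R * t ^+ j) : K.
apply: (@le_trans _ _ (\sum_(0 <= n < N) \sum_(i < n.+1) F i (n - i)%N)).
  apply: ler_sum => n _; rewrite fpsM.
  apply: (@le_trans _ _ ((\sum_(i < n.+1) `|f i * g (n - i)%N|)%:~R * t ^+ n)).
    by rewrite ler_wpM2r ?exprn_ge0 // ler_int ler_norm_sum.
  rewrite rmorph_sum mulr_suml; apply: ler_sum => i _ /=.
  have -> : t ^+ n = t ^+ i * t ^+ (n - i) by rewrite -exprD subnKC // -ltnS.
  by rewrite normrM intrM mulrACA.
rewrite triangle_sum.
apply: (@le_trans _ _ (\sum_(0 <= i < N) (`|f i|%:~R * t ^+ i) * B')).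
  apply: ler_sum => i _; rewrite -mulr_sumr ler_wpM2l ?term_ge0 //; exact: hg.
by rewrite -mulr_suml ler_wpM2r // (bnd_ge0 hg).
Qed.

Lemma bndX k t : 0 <= t -> bnd (fpsX k) t (t ^+ k).
Proof.
move=> t0 N; case: (ltnP k N) => kN.
  rewrite (bigD1_seq k) ?mem_index_iota ?iota_uniq //= eqxx mul1r big1 ?addr0 //.
  by move=> i /negPf ->; rewrite normr0 mul0r.
rewrite big_nat big1 ?exprn_ge0 // => i /andP[_ iN] /=.
by rewrite ltn_eqF ?normr0 ?mul0r // (leq_trans iN).
Qed.

Lemma bnd1 t : 0 <= t -> bnd 1 t 1.
Proof. by move=> t0; rewrite -fpsX0 -(expr0 t); apply: bndX. Qed.

Lemma bnd_le f t B B' : B <= B' -> bnd f t B -> bnd f t B'.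
Proof. by move=> BB h N; apply: le_trans BB. Qed.

Lemma goodX k : good (fpsX k).
Proof. by move=> t /andP[t0 _]; exists (t ^+ k); apply: bndX; apply: ltW. Qed.
Lemma good1 : good 1.
Proof. by rewrite -fpsX0; apply: goodX. Qed.
Lemma goodD f g : good f -> good g -> good (f + g).
Proof.
move=> hf hg t /[dup] /andP[t0 _] ht; have [B hB] := hf t ht; have [B' hB'] := hg t ht.
by exists (B + B'); apply: bndD => //; apply: ltW.
Qed.
Lemma goodN f : good f -> good (- f).
Proof. by move=> hf t ht; have [B hB] := hf t ht; exists B; apply: bndN. Qed.
Lemma goodB f g : good f -> good g -> good (f - g).
Proof. by move=> hf hg; apply: goodD => //; apply: goodN. Qed.
Lemma goodM f g : good f -> good g -> good (f * g).
Proof.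
move=> hf hg t /[dup] /andP[t0 _] ht; have [B hB] := hf t ht; have [B' hB'] := hg t ht.
by exists (B * B'); apply: bndM => //; apply: ltW.
Qed.
Lemma good_prod (I : Type) (r : seq I) (P : pred I) (F : I -> fps) :
  (forall i, P i -> good (F i)) -> good (\prod_(i <- r | P i) F i).
Proof. by move=> h; apply: big_ind => //; [exact: good1|exact: goodM]. Qed.

(** The terms at [|q|] are at most [(|q| / t)^n] times those at [t], and only
    [n >= N] occurs. *)
Lemma tail_le f (q : K) t B N M : 0 < t -> bnd f t B -> `|q| <= t -> eqm N f 0 ->
  \sum_(0 <= n < M) `|(f n)%:~R * q ^+ n| <= (`|q| / t) ^+ N * B.
Proof.
move=> t0 hf qt hN; apply: le_trans (ler_wpM2l _ (hf M)); last first.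
  by rewrite exprn_ge0 // divr_ge0 // ltW.
rewrite mulr_sumr; apply: ler_sum => n _; have [nN|Nn] := ltnP n N.
  by rewrite hN // fps0 mul0r normr0 normr0 mul0r mulr0.
rewrite normrM normrX intr_norm [leRHS]mulrCA ler_wpM2l //.
rewrite -[in leLHS](divfK (lt0r_neq0 t0) `|q|) exprMn ler_wpM2r ?exprn_ge0 ?(ltW t0) //.
by rewrite ler_wiXn2l ?divr_ge0 ?(ltW t0) // ler_pdivrMr ?mul1r.
Qed.

End Bounds.

Definition tends (K : numFieldType) (u : nat -> K) (l : K) : Prop :=
  (u n @[n --> \oo] --> l)%classic.

Section Tends.
Variable K : numFieldType.
Implicit Types (u v : nat -> K) (l B : K).

Lemma tendsP u l : tends u l <->
  (forall e, 0 < e -> exists N, forall n, (N <= n)%N -> `|l - u n| < e).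
Proof.
split=> [/cvgrPdist_lt h e e0|h].
  by have [N _ hN] := h e e0; exists N => n Nn; apply: hN.
apply/cvgrPdist_lt => e e0; have [N hN] := h e e0.
by exists N => // n /= Nn; apply: hN.
Qed.

Lemma tends_lim u l : tends u l -> limn u = l.
Proof. by move=> h; apply: cvg_lim => //; apply: norm_hausdorff. Qed.

Lemma tends_unique u l l' : tends u l -> tends u l' -> l = l'.
Proof. by move=> /tends_lim <- /tends_lim <-. Qed.

Lemma tends_cst l : tends (fun=> l) l.
Proof. exact: cvg_cst. Qed.
Lemma tendsD u v l l' : tends u l -> tends v l' -> tends (fun n => u n + v n) (l + l').
Proof. exact: cvgD. Qed.
Lemma tendsN u l : tends u l -> tends (fun n => - u n) (- l).
Proof. exact: cvgN. Qed.
Lemma tendsM u v l l' : tends u l -> tends v l' -> tends (fun n => u n * v n) (l * l').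
Proof. exact: cvgM. Qed.
Lemma tends_eq u v l : u =1 v -> tends u l -> tends v l.
Proof. by move=> /funext ->. Qed.
Lemma tends_sub u l (s : nat -> nat) : (forall n, (n <= s n)%N) ->
  tends u l -> tends (fun n => u (s n)) l.
Proof.
move=> hs /tendsP h; apply/tendsP => e /h[N hN]; exists N => n Nn.
by apply: hN; apply: leq_trans (hs n).
Qed.
Lemma tends_sum (I : Type) (r : seq I) (u : I -> nat -> K) (l : I -> K) :
  (forall i, tends (u i) (l i)) ->
  tends (fun n => \sum_(i <- r) u i n) (\sum_(i <- r) l i).
Proof.
move=> h; elim: r => [|i r IH].
  by rewrite big_nil; under eq_fun do rewrite big_nil; apply: tends_cst.
by rewrite big_cons; under eq_fun do rewrite big_cons; apply: tendsD.
Qed.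
Lemma tends_prod (I : Type) (r : seq I) (u : I -> nat -> K) (l : I -> K) :
  (forall i, tends (u i) (l i)) ->
  tends (fun n => \prod_(i <- r) u i n) (\prod_(i <- r) l i).
Proof.
move=> h; elim: r => [|i r IH].
  by rewrite big_nil; under eq_fun do rewrite big_nil; apply: tends_cst.
by rewrite big_cons; under eq_fun do rewrite big_cons; apply: tendsM.
Qed.

Lemma tends_norm_le u l B : 0 <= B -> tends u l -> (forall n, `|u n| <= B) -> `|l| <= B.
Proof.
move=> B0 /tendsP h hB; rewrite real_leNgt ?ger0_real //; apply/negP => Bl.
have [|N /(_ N (leqnn N)) lt] := h (`|l| - B); first by rewrite subr_gt0.
suff le : `|l| - B <= `|l - u N| by have := le_lt_trans le lt; rewrite ltxx.
rewrite lerBlDr -{1}(subrK (u N) l); apply: le_trans (ler_normD _ _) _.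
by rewrite lerD2l.
Qed.

Lemma tends_squeeze u v l : (forall n, `|l - u n| <= v n) -> tends v 0 -> tends u l.
Proof.
move=> uv /tendsP h; apply/tendsP => e /h[N hN]; exists N => n /hN.
rewrite sub0r normrN; apply: le_lt_trans.
by rewrite (ger0_norm (le_trans (normr_ge0 _) (uv n))).
Qed.

(** The analytic facts on which the evaluation of power series rests. The proofs
    below use nothing else of the complex numbers than these facts and the
    structure of an algebraically closed field with a norm. *)
Record disc_analysis : Prop := DiscAnalysis {
  abs_tends : forall (a : nat -> K) B,
    (forall N, \sum_(0 <= n < N) `|a n| <= B) ->
    exists l, tends (fun N => \sum_(0 <= n < N) a n) l;
  tends_expr0 : forall s : K, 0 <= s < 1 -> tends (fun n => s ^+ n) 0;
  prod_le_bounded : forall c t : K, 0 <= c -> 0 <= t < 1 ->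
    exists B, forall N, \prod_(0 <= i < N) (1 + c * t ^+ i) <= B }.

End Tends.

Section ComplexAnalysis.
Variable R : realType.
Local Notation C := R[i].

Lemma normc_real (a : R) : `|a%:C%C| = `|a|%:C%C :> C.
Proof. by rewrite normc_def /= expr0n addr0 sqrtr_sqr. Qed.

Lemma normc_i : `|'i%C| = 1 :> C.
Proof. by rewrite normc_def /= expr0n add0r expr1n sqrtr1. Qed.

Lemma gt0_complex (e : C) : 0 < e -> exists2 r : R, 0 < r & e = r%:C%C.
Proof.
by case: e => a b; rewrite ltcE /= => /andP[/eqP -> a0]; exists a.
Qed.

Lemma ge0_complex (e : C) : 0 <= e -> exists2 r : R, 0 <= r & e = r%:C%C.
Proof.
by case: e => a b; rewrite lecE /= => /andP[/eqP -> a0]; exists a.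
Qed.

Lemma tends_complex (x y : nat -> R) (a b : R) :
  tends x a -> tends y b ->
  tends (fun n => (x n)%:C + 'i * (y n)%:C : C)%C (a%:C + 'i * b%:C)%C.
Proof.
move=> /tendsP hx /tendsP hy; apply/tendsP => _ /gt0_complex[r r0 ->].
have r2 : 0 < r / 2 by rewrite divr_gt0.
have [N hN] := hx _ r2; have [M hM] := hy _ r2.
exists (maxn N M) => n; rewrite geq_max => /andP[/hN Nn /hM Mn].
rewrite opprD addrACA -mulrBr -!rmorphB /=; apply: le_lt_trans (ler_normD _ _) _.
rewrite normrM normc_i mul1r !normc_real -rmorphD /= ltcR (splitr r).
exact: ltrD.
Qed.

Lemma tends_expc0 (s : C) : 0 <= s < 1 -> tends (fun n => s ^+ n) 0.
Proof.
move=> /andP[/ge0_complex[r r0 ->]]; rewrite ltcR => r1.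
have h : tends (fun n => r ^+ n) 0 by apply: cvg_expr; rewrite ger0_norm.
move/tendsP: h => h; apply/tendsP => _ /gt0_complex[e /h[N hN] ->].
exists N => n /hN; rewrite !sub0r !normrN => lt.
by rewrite -rmorphXn normc_real ltcR.
Qed.

(** The real and the imaginary parts converge absolutely. *)
Lemma abs_tendsc (a : nat -> C) (B : C) :
  (forall N, \sum_(0 <= n < N) `|a n| <= B) ->
  exists l, tends (fun N => \sum_(0 <= n < N) a n) l.
Proof.
move=> hB; have [b b0 eB] : exists2 b : R, 0 <= b & B = b%:C%C.
  by apply: ge0_complex; have := hB 0%N; rewrite big_geq.
have key (x : nat -> R) : (forall n, `|x n|%:C%C <= `|a n|) ->
    exists l, tends (fun N => \sum_(0 <= n < N) x n) l.
  move=> hx; suff /cvg_ex h : cvgn (series x) by [].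
  apply: normed_cvg; apply: nondecreasing_is_cvgn.
    by apply/nondecreasing_seqP => n; rewrite /= /series /= big_nat_recr //= lerDl.
  exists b => _ [N _ <-]; rewrite /= /series /= -lecR rmorph_sum /= -eB.
  by apply: le_trans (hB N); apply: ler_sum => n _; apply: hx.
have [x hx] := key (fun n => complex.Re (a n)) (fun n => normc_ge_Re (a n)).
have [y hy] : exists l, tends (fun N => \sum_(0 <= n < N) complex.Im (a n)) l.
  apply: key => n; rewrite -normc_real normc_def [leRHS]normc_def lecR /=.
  by rewrite expr0n addr0 ler_wsqrtr // lerDr sqr_ge0.
exists (x%:C + 'i%C * y%:C)%C; have := tends_complex hx hy.
apply: tends_eq => N.
rewrite !rmorph_sum mulr_sumr -big_split /=; apply: eq_bigr => n _.
by rewrite -complexE.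
Qed.

(** From [1 + x <= exp x] and the sum [r / (1 - s)] of the geometric series. *)
Lemma prod_le_boundedc (c t : C) : 0 <= c -> 0 <= t < 1 ->
  exists B, forall N, \prod_(0 <= i < N) (1 + c * t ^+ i) <= B.
Proof.
move=> /ge0_complex[r r0 ->] /andP[/ge0_complex[s s0 ->]]; rewrite ltcR => s1.
exists (expR (r / (1 - s)))%:C%C => N.
have -> : \prod_(0 <= i < N) (1 + r%:C%C * s%:C%C ^+ i) =
          (\prod_(0 <= i < N) (1 + r * s ^+ i))%:C%C :> C.
  by rewrite rmorph_prod; apply: eq_bigr => i _; rewrite rmorphD rmorphM rmorphXn.
rewrite lecR; apply: (@le_trans _ _ (expR (\sum_(0 <= i < N) r * s ^+ i))).
  rewrite expR_sum; apply: ler_prod => i _.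
  by rewrite addr_ge0 ?mulr_ge0 ?exprn_ge0 //= expR_ge1Dx.
rewrite ler_expR -mulr_sumr ler_wpM2l //.
rewrite -[leRHS]mul1r ler_pdivlMr ?subr_gt0 // mulrC.
have -> : (1 - s) * (\sum_(0 <= i < N) s ^+ i) = 1 - s ^+ N.
  rewrite -[X in X - _ ^+ _](expr1n _ N) subrXX; congr (_ * _).
  by rewrite big_mkord; apply: eq_bigr => i _; rewrite expr1n mul1r.
by rewrite gerBl exprn_ge0.
Qed.

Lemma complex_disc_analysis : disc_analysis (R[i] : numFieldType).
Proof.
by split; [exact: abs_tendsc|exact: tends_expc0|exact: prod_le_boundedc].
Qed.

End ComplexAnalysis.

Section Evaluation.
Variable K : numFieldType.
Hypothesis hK : disc_analysis K.
Implicit Types (f g : fps) (q t : K).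

Definition psum f q N := \sum_(0 <= n < N) (f n)%:~R * q ^+ n.
Definition ev f q : K := limn (psum f q).

Lemma between (q : K) : `|q| < 1 -> exists t, [/\ 0 < t, t < 1 & `|q| < t].
Proof.
move=> q1; exists ((`|q| + 1) / 2); split.
- by rewrite divr_gt0 // ltr_wpDl.
- by rewrite ltr_pdivrMr // mul1r (natrD _ 1 1) ltrD2r.
- by rewrite ltr_pdivlMr // mulr_natr mulr2n ltrD2l.
Qed.

Lemma ratio_lt1 (q t : K) : 0 < t -> `|q| < t -> 0 <= `|q| / t < 1.
Proof. by move=> t0 qt; rewrite divr_ge0 ?(ltW t0) //= ltr_pdivrMr // mul1r. Qed.

Lemma ev_tends f q : good K f -> `|q| < 1 -> tends (psum f q) (ev f q).
Proof.
move=> hf q1; have [t [t0 t1 qt]] := between q1.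
have [|B hB] := hf t; first by rewrite t0.
have [|l hl] := @abs_tends _ hK (fun n => (f n)%:~R * q ^+ n) B.
  move=> N; have := @tail_le _ f q t B 0 N t0 hB (ltW qt) (fun n => ltac:(by [])).
  by rewrite expr0 mul1r.
by rewrite /ev (tends_lim hl).
Qed.

Lemma ev_lim f q l : tends (psum f q) l -> ev f q = l.
Proof. exact: tends_lim. Qed.

Lemma evD f g q : good K f -> good K g -> `|q| < 1 -> ev (f + g) q = ev f q + ev g q.
Proof.
move=> hf hg q1; apply: ev_lim; apply: tends_eq (tendsD (ev_tends hf q1) (ev_tends hg q1)).
by move=> N; rewrite /psum -big_split /=; apply: eq_bigr => n _; rewrite intrD mulrDl.
Qed.

Lemma evN f q : good K f -> `|q| < 1 -> ev (- f) q = - ev f q.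
Proof.
move=> hf q1; apply: ev_lim; apply: tends_eq (tendsN (ev_tends hf q1)).
by move=> N; rewrite /psum -sumrN; apply: eq_bigr => n _; rewrite mulrNz mulNr.
Qed.

Lemma evB f g q : good K f -> good K g -> `|q| < 1 -> ev (f - g) q = ev f q - ev g q.
Proof. by move=> hf hg q1; rewrite evD ?evN //; apply: goodN. Qed.

Lemma evX k q : ev (fpsX k) q = q ^+ k.
Proof.
apply: ev_lim; apply/tendsP => e e0; exists k.+1 => N kN.
rewrite /psum (bigD1_seq k) ?mem_index_iota ?iota_uniq //= eqxx mul1r big1.
  by rewrite addr0 subrr normr0.
by move=> i /negPf ->; rewrite mul0r.
Qed.

Lemma ev1 q : ev 1 q = 1.
Proof. by rewrite -fpsX0 evX. Qed.

(** The Cauchy product: what the square of indices below [N] has in excess of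
    the triangle has total degree at least [N]. *)
Lemma evM f g q : good K f -> good K g -> `|q| < 1 -> ev (f * g) q = ev f q * ev g q.
Proof.
move=> hf hg q1; apply: ev_lim.
have [t [t0 t1 qt]] := between q1; have t01 : 0 < t < 1 by rewrite t0.
have [B hB] := hf t t01; have [B' hB'] := hg t t01.
pose a n := (f n)%:~R * q ^+ n; pose b n := (g n)%:~R * q ^+ n.
pose d N := \sum_(0 <= i < N) \sum_(N - i <= j < N) a i * b j.
have e N : psum (f * g) q N = psum f q N * psum g q N - d N.
  rewrite (_ : psum (f * g) q N =
      \sum_(0 <= i < N) \sum_(0 <= j < N - i) a i * b j); last first.
    rewrite -(triangle_sum N (fun i j => a i * b j)); apply: eq_bigr => n _.
    rewrite fpsM rmorph_sum mulr_suml; apply: eq_bigr => i _ /=.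
    have -> : q ^+ n = q ^+ i * q ^+ (n - i) by rewrite -exprD subnKC // -ltnS.
    by rewrite intrM mulrACA.
  rewrite /d /psum -/a -/b mulr_suml -sumrB; apply: eq_bigr => i _; rewrite mulr_sumr.
  by rewrite [X in _ = X - _](@big_cat_nat _ _ _ (N - i)%N) ?leq_subr //= addrK.
have d0 : tends d 0.
  apply: (@tends_squeeze _ _ (fun N => (`|q| / t) ^+ N * (B * B'))); last first.
    by have := tendsM (tends_expr0 hK (ratio_lt1 t0 qt)) (@tends_cst _ (B * B')); rewrite mul0r.
  move=> N; rewrite sub0r normrN /d.
  have fe i : `|a i| = `|f i|%:~R * `|q| ^+ i by rewrite normrM normrX intr_norm.
  have ge i : `|b i| = `|g i|%:~R * `|q| ^+ i by rewrite normrM normrX intr_norm.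
  apply: (@le_trans _ _ (\sum_(0 <= i < N) \sum_(0 <= j < N)
     (`|q| / t) ^+ N * ((`|f i|%:~R * t ^+ i) * (`|g j|%:~R * t ^+ j)))).
    apply: le_trans (ler_norm_sum _ _ _) _; apply: ler_sum => i _.
    apply: le_trans (ler_norm_sum _ _ _) _.
    apply: (@le_trans _ _ (\sum_(N - i <= j < N) (`|q| / t) ^+ N *
             ((`|f i|%:~R * t ^+ i) * (`|g j|%:~R * t ^+ j)))).
      rewrite big_nat [leRHS]big_nat; apply: ler_sum => j /andP[ij jN].
      rewrite normrM fe ge mulrACA [in leRHS]mulrACA [leRHS]mulrCA.
      rewrite ler_wpM2l ?mulr_ge0 ?ler0z //.
      rewrite -!exprD -[in leLHS](divfK (lt0r_neq0 t0) `|q|) exprMn.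
      rewrite ler_wpM2r ?exprn_ge0 ?(ltW t0) //.
      by rewrite ler_wiXn2l ?divr_ge0 ?(ltW t0) ?ler_pdivrMr ?mul1r ?(ltW qt) //; lia.
    rewrite [leRHS](@big_cat_nat _ _ _ (N - i)%N) ?leq_subr //= lerDr.
    by apply: sumr_ge0 => j _; rewrite !mulr_ge0 ?exprn_ge0 ?divr_ge0 ?ler0z ?(ltW t0).
  under eq_bigr do rewrite -mulr_sumr -mulr_sumr; rewrite -mulr_sumr -mulr_suml.
  rewrite ler_wpM2l ?exprn_ge0 ?divr_ge0 ?(ltW t0) //.
  apply: ler_pM (hB N) (hB' N); apply: sumr_ge0 => j _;
    by rewrite mulr_ge0 ?exprn_ge0 ?ler0z ?(ltW t0).
have := tendsD (tendsM (ev_tends hf q1) (ev_tends hg q1)) (tendsN d0).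
by rewrite oppr0 addr0; apply: tends_eq => N; rewrite e.
Qed.

Lemma ev_prod (I : Type) (r : seq I) (F : I -> fps) q :
  (forall i, good K (F i)) -> `|q| < 1 ->
  ev (\prod_(i <- r) F i) q = \prod_(i <- r) ev (F i) q.
Proof.
move=> hF q1; elim: r => [|i r IH]; first by rewrite !big_nil ev1.
by rewrite !big_cons evM ?IH //; apply: good_prod.
Qed.

(** The majorant [1 + c t^i] of the factors makes the infinite product of the
    majorants finite. *)
Definition goodprod (F : nat -> fps) := prodable F /\
  forall t, 0 < t < 1 -> exists2 c, 0 <= c & forall i, bnd (F i) t (1 + c * t ^+ i).

Lemma bnd_partial_prod (F : nat -> fps) t (b : nat -> K) N : 0 <= t ->
  (forall i, bnd (F i) t (b i)) ->
  bnd (\prod_(0 <= i < N) F i) t (\prod_(0 <= i < N) b i).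
Proof.
move=> t0 h; elim: N => [|N IH]; first by rewrite !big_geq //; apply: bnd1.
by rewrite !big_nat_recr //=; apply: bndM.
Qed.

Lemma bnd_eqm f t B :
  (forall N, exists2 g, eqm N f g & bnd g t B) -> bnd f t B.
Proof.
move=> h N; have [g fg hg] := h N; apply: le_trans (hg N).
by rewrite big_nat [leRHS]big_nat; apply: ler_sum => i /andP[_ iN]; rewrite fg.
Qed.

Lemma goodprod_bnd (F : nat -> fps) t : goodprod F -> 0 < t < 1 ->
  exists B, bnd (fprod F) t B /\ forall N, bnd (\prod_(0 <= i < N) F i) t B.
Proof.
move=> [pF hF] /[dup] /andP[t0 t1] t01; have [c c0 hc] := hF t t01.
have [|B hB] := @prod_le_bounded _ hK c t c0; first by rewrite (ltW t0).
have hP N : bnd (\prod_(0 <= i < N) F i) t B.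
  by apply: bnd_le (hB N) _; apply: bnd_partial_prod => //; apply: ltW.
exists B; split=> //; apply: bnd_eqm => N; exists (\prod_(0 <= i < N) F i) => //.
by apply: (@eqm_le _ N.+1) => //; apply: fprod_partial.
Qed.

Lemma good_fprod F : goodprod F -> good K (fprod F).
Proof. by move=> hF t t01; have [B []] := goodprod_bnd hF t01; exists B. Qed.

Lemma goodprod_good F i : goodprod F -> good K (F i).
Proof. by move=> [_ hF] t t01; have [c _ hc] := hF t t01; exists (1 + c * t ^+ i). Qed.

(** What the first [N] factors miss starts in degree [N], and [tail_le] applies
    with a bound that does not depend on [N]. *)
Lemma ev_fprod F q : goodprod F -> `|q| < 1 ->
  tends (fun N => \prod_(0 <= i < N) ev (F i) q) (ev (fprod F) q).
Proof.
move=> hF q1; have [t [t0 t1 qt]] := between q1; have t01 : 0 < t < 1 by rewrite t0.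
have [B [hB hP]] := goodprod_bnd hF t01.
have gF i : good K (F i) by apply: goodprod_good.
apply: (@tends_squeeze _ _ (fun N => (`|q| / t) ^+ N * (B + B))); last first.
  by have := tendsM (tends_expr0 hK (ratio_lt1 t0 qt)) (@tends_cst _ (B + B)); rewrite mul0r.
have gP := good_fprod hF.
have gN N : good K (\prod_(0 <= i < N) F i) by apply: good_prod.
move=> N; rewrite -ev_prod // -evB //.
set f := fprod F - _; have hf : bnd f t (B + B) by apply: bndD; [exact: ltW|exact: hB|exact: bndN].
have f0 : eqm N f 0.
  move=> n nN; rewrite fpsB fps0 (@fprod_partial _ N) ?subrr ?(leqW nN) //.
  by case: hF.
have gf : good K f by apply: goodB.
apply: tends_norm_le (ev_tends gf q1) _.
  by rewrite mulr_ge0 ?exprn_ge0 ?divr_ge0 ?(ltW t0) ?(bnd_ge0 hf).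
move=> M; apply: le_trans (ler_norm_sum _ _ _) _.
exact: tail_le (ltW qt) f0.
Qed.

End Evaluation.

(** * Infinite products as analytic functions *)

(** The geometric series [1 / (1 - X^m)]. *)
Definition geo m := FPS (fun n => (m %| n)%:R).

Lemma geoE m : (0 < m)%N -> (1 - fpsX m) * geo m = 1.
Proof.
move=> m0; apply: fpsP => n; rewrite mulrBl mul1r fpsB fpsXM fps1 /=.
case: leqP => [mn|nm].
  by rewrite dvdn_subl // subrr; case: n mn => //; rewrite leqn0 => /eqP m1; rewrite m1 in m0.
by rewrite subr0; case: n nm => [|n] nm; rewrite ?dvdn0 // gtnNdvd.
Qed.

Definition qinv a b := fprod (fun i => geo (a + b * i)%N).

Lemma prodable_geo a b : (0 < a)%N -> (0 < b)%N -> prodable (fun i => geo (a + b * i)%N).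
Proof.
move=> a0 b0 i n ni; rewrite fps1 /=; case: n ni => [|n] ni; first by rewrite dvdn0.
by rewrite gtnNdvd //; nia.
Qed.

Lemma qprodK a b : (0 < a)%N -> (0 < b)%N -> qprod a b * qinv a b = 1.
Proof.
move=> a0 b0; rewrite fprodM; [|exact: prodable_qprod|exact: prodable_geo].
by apply: fprod1 => i; rewrite geoE // addn_gt0 a0.
Qed.

Section QPoch.
Variable K : numFieldType.
Hypothesis hK : disc_analysis K.
Implicit Types (q t : K).

Lemma expr_le_shift t m i : 0 < t < 1 -> (i <= m)%N -> t ^+ m <= t ^+ i.
Proof. by move=> /andP[t0 t1] im; rewrite ler_wiXn2l // ltW. Qed.

Lemma goodprod_qprod a b : (0 < a)%N -> (0 < b)%N ->
  goodprod K (fun i => 1 - fpsX (a + b * i)%N).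
Proof.
move=> a0 b0; split; first exact: prodable_qprod.
move=> t /[dup] /andP[t0 _] t01; exists 1 => // i.
apply: (@bnd_le _ _ _ (1 + t ^+ (a + b * i))).
  by rewrite mul1r lerD2l expr_le_shift //; nia.
by apply: bndD; [exact: ltW|apply: bnd1; exact: ltW|apply/bndN/bndX; exact: ltW].
Qed.

Lemma bnd_geo m t : 0 < t < 1 -> (0 < m)%N -> bnd (geo m) t (1 / (1 - t ^+ m)).
Proof.
move=> /andP[t0 t1] m0 N.
have tm1 : t ^+ m < 1 by rewrite exprn_ilt1 ?ltW // -lt0n.
apply: (@le_trans _ _ (\sum_(0 <= i < N) t ^+ (m * i))); last first.
  rewrite ler_pdivlMr ?subr_gt0 // mulrC.
  under eq_bigr do rewrite exprM; rewrite big_mkord -[1 - _]opprB mulNr -subrX1 opprB.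
  by rewrite gerBl exprn_ge0 // exprn_ge0 // ltW.
have [N0|N0] := posnP N; first by rewrite N0 !big_geq.
rewrite (eq_bigr (fun n => if (m %| n)%N then t ^+ n else 0)); last first.
  by move=> n _ /=; case: (m %| n)%N; rewrite ?normr1 ?mul1r ?normr0 ?mul0r.
apply: (@le_trans _ _ (\sum_(0 <= n < N * m) (if (m %| n)%N then t ^+ n else 0))).
  rewrite [leRHS](@big_cat_nat _ _ _ N) ?leq_pmulr //= lerDl.
  by apply: sumr_ge0 => n _; case: ifP => // _; rewrite exprn_ge0 // ltW.
rewrite big_nat_mul; apply: ler_sum => i _.
rewrite -{1}[(i * m)%N]add0n big_addn mulSn addnK.
case: m m0 {tm1} => // m _; rewrite big_nat_recl // add0n dvdn_mull // mulnC.
rewrite big_nat big1 => [|j /andP[_ jm]]; first by rewrite /= addr0.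
by rewrite dvdn_addl ?dvdn_mulr // gtnNdvd //.
Qed.

Lemma goodprod_geo a b : (0 < a)%N -> (0 < b)%N ->
  goodprod K (fun i => geo (a + b * i)%N).
Proof.
move=> a0 b0; split; first exact: prodable_geo.
move=> t /[dup] /andP[t0 t1] t01.
have u0 : 0 < 1 - t by rewrite subr_gt0.
exists (1 - t)^-1; first by rewrite invr_ge0 ltW.
move=> i; apply: bnd_le (bnd_geo t01 _); last by rewrite addn_gt0 a0.
set m := (a + b * i)%N; have im : (i <= m)%N by rewrite /m; nia.
have m0 : (0 < m)%N by rewrite /m addn_gt0 a0.
have tmt : t ^+ m <= t by rewrite -[leRHS]expr1 expr_le_shift.
have v0 : 0 < 1 - t ^+ m by rewrite subr_gt0 (le_lt_trans tmt).
rewrite ler_pdivrMr // mulrDl mul1r -lerBlDl opprB addrCA subrr addr0.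
rewrite mulrAC; apply: (@le_trans _ _ (1 * t ^+ i)).
  by rewrite mul1r expr_le_shift.
rewrite ler_wpM2r ?exprn_ge0 ?(ltW t0) // -[leLHS](mulVf (lt0r_neq0 u0)).
by rewrite ler_wpM2l ?invr_ge0 ?(ltW u0) // lerD2l lerN2.
Qed.

Lemma good_qprod a b : (0 < a)%N -> (0 < b)%N -> good K (qprod a b).
Proof. by move=> a0 b0; apply: good_fprod => //; apply: goodprod_qprod. Qed.

Lemma good_qinv a b : (0 < a)%N -> (0 < b)%N -> good K (qinv a b).
Proof. by move=> a0 b0; apply: good_fprod => //; apply: goodprod_geo. Qed.

Lemma good_theta a b : (0 < a < b)%N -> good K (theta a b).
Proof.
move=> /[dup] /andP[a0 ab] hab; rewrite triple_product //.
have b0 := ltn_trans a0 ab.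
by do 2?apply: goodM; apply: good_qprod; rewrite ?subn_gt0.
Qed.

Lemma qpoch_ev a b q : (0 < a)%N -> (0 < b)%N -> `|q| < 1 ->
  qpoch (q ^+ a) (q ^+ b) = ev (qprod a b) q.
Proof.
move=> a0 b0 q1; apply: tends_lim.
apply: tends_eq (ev_fprod hK (goodprod_qprod a0 b0) q1) => N.
apply: eq_bigr => i _.
by rewrite evB ?ev1 ?evX ?exprD ?exprM //; [exact: good1|exact: goodX].
Qed.

Lemma qpoch_tends a b q : (0 < a)%N -> (0 < b)%N -> `|q| < 1 ->
  tends (fun N => \prod_(0 <= n < N) (1 - q ^+ (a + b * n)%N)) (qpoch (q ^+ a) (q ^+ b)).
Proof.
move=> a0 b0 q1; rewrite qpoch_ev //.
apply: tends_eq (ev_fprod hK (goodprod_qprod a0 b0) q1) => N.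
apply: eq_bigr => i _.
by rewrite evB ?ev1 ?evX //; [exact: good1|exact: goodX].
Qed.

Lemma qpoch_neq0 a b q : (0 < a)%N -> (0 < b)%N -> `|q| < 1 ->
  qpoch (q ^+ a) (q ^+ b) != 0.
Proof.
move=> a0 b0 q1; rewrite qpoch_ev //; apply/eqP => h.
have := ev1 q; rewrite -(qprodK a0 b0) evM //; [|exact: good_qprod|exact: good_qinv].
by rewrite h mul0r => /eqP; rewrite eq_sym oner_eq0.
Qed.

Lemma qpoch_split m a b q : (0 < a)%N -> (0 < b)%N -> (0 < m)%N -> `|q| < 1 ->
  qpoch (q ^+ a) (q ^+ b) = \prod_(c < m) qpoch (q ^+ (a + b * c)%N) (q ^+ (b * m)%N).
Proof.
move=> a0 b0 m0 q1; rewrite qpoch_ev // (qprod_split a0 b0 m0) ev_prod //.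
  by apply: eq_bigr => c _; rewrite qpoch_ev // ?muln_gt0 ?b0 // addn_gt0 a0.
by move=> c; apply: good_qprod; rewrite ?muln_gt0 ?b0 // addn_gt0 a0.
Qed.

Lemma ev_theta a b q : (0 < a < b)%N -> `|q| < 1 ->
  ev (theta a b) q =
  qpoch (q ^+ a) (q ^+ b) * qpoch (q ^+ (b - a)%N) (q ^+ b) * qpoch (q ^+ b) (q ^+ b).
Proof.
move=> /[dup] /andP[a0 ab] hab q1; rewrite triple_product //.
have b0 := ltn_trans a0 ab; have ba0 : (0 < b - a)%N by rewrite subn_gt0.
have g1 := good_qprod a0 b0; have g2 := good_qprod ba0 b0; have g3 := good_qprod b0 b0.
by rewrite !evM ?qpoch_ev //; apply: goodM.
Qed.

Lemma ev_theta_scale m a b q : (0 < m)%N -> (0 < a < b)%N -> `|q| < 1 ->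
  ev (theta (m * a) (m * b)) q = ev (theta a b) (q ^+ m).
Proof.
move=> m0 hab q1.
have qm1 : `|q ^+ m| < 1 by rewrite normrX exprn_ilt1 // -lt0n.
rewrite !ev_theta //; last by nia.
by rewrite -mulnBr !exprM.
Qed.

End QPoch.

Section EulerProduct.
Variable K : numFieldType.
Hypothesis hK : disc_analysis K.
Implicit Types q : K.

(** The Euler product and the Rogers-Ramanujan continued fraction without its
    factor [q^(1/5)]. *)
Definition euler q := qpoch q q.
Definition rrcf q := qpoch q (q ^+ 5) * qpoch (q ^+ 4) (q ^+ 5)
                     / (qpoch (q ^+ 2) (q ^+ 5) * qpoch (q ^+ 3) (q ^+ 5)).

Lemma norm_exprn_lt1 q n : `|q| < 1 -> (0 < n)%N -> `|q ^+ n| < 1.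
Proof. by move=> q1 n0; rewrite normrX exprn_ilt1 // -lt0n. Qed.

Lemma euler_neq0 q : `|q| < 1 -> euler q != 0.
Proof. by move=> q1; have := @qpoch_neq0 K hK 1 1 q isT isT q1; rewrite expr1. Qed.

Lemma rrcf_neq0 q : `|q| < 1 -> rrcf q != 0.
Proof.
move=> q1; have h a : (0 < a)%N -> qpoch (q ^+ a) (q ^+ 5) != 0.
  by move=> a0; apply: qpoch_neq0.
have := h 1%N isT; rewrite expr1 => h1; apply: mulf_neq0; last apply: invr_neq0.
  exact: mulf_neq0 h1 (h 4%N isT).
exact: mulf_neq0 (h 2%N isT) (h 3%N isT).
Qed.

(** In the dissection of the pentagonal series, [A] and [B] are the components of
    degree 0 and 2 modulo 5; the quintuple product identities give their quotients
    by the component of degree 1. *)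
Lemma euler_dissection q : `|q| < 1 ->
  euler q = euler ((q ^+ 5) ^+ 5) * ((rrcf (q ^+ 5))^-1 - q - q ^+ 2 * rrcf (q ^+ 5)).
Proof.
move=> q1; set p := q ^+ 5; have p1 : `|p| < 1 by apply: norm_exprn_lt1.
have eth : euler q = ev (theta 1 3) q.
  rewrite ev_theta // /euler; have := @qpoch_split K hK 3 1 1 q isT isT isT q1.
  by rewrite !big_ord_recl big_ord0 !expr1 /= !mulr1 !mulrA.
have gth a b : (0 < a < b)%N -> good K (theta a b) by apply: good_theta.
have gX m g : good K g -> good K (fpsX m * g) by move=> hg; apply: goodM => //; apply: goodX.
have eX m g (x : K) : good K g -> `|x| < 1 -> ev (fpsX m * g) x = x ^+ m * ev g x.
  by move=> hg x1; rewrite (evM hK (@goodX K m) hg x1) evX.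
pose A := ev (theta 7 15 + fpsX 1 * theta 2 15) p.
pose B := ev (theta 4 15 - fpsX 1 * theta 1 15) p.
have sc a b : (0 < a < b)%N -> ev (theta (5 * a) (5 * b)) q = ev (theta a b) p.
  by move=> h; apply: ev_theta_scale.
have AE : A = ev (theta 7 15) p + p * ev (theta 2 15) p.
  rewrite /A (evD hK (gth 7%N 15%N isT) (gX 1%N _ (gth 2%N 15%N isT)) p1).
  by rewrite eX ?expr1 //; apply: gth.
have BE : B = ev (theta 4 15) p - p * ev (theta 1 15) p.
  rewrite /B (evB hK (gth 4%N 15%N isT) (gX 1%N _ (gth 1%N 15%N isT)) p1).
  by rewrite eX ?expr1 //; apply: gth.
have e5 : ev (theta 5 15) p = euler (p ^+ 5).
  rewrite ev_theta // /euler; have := @qpoch_split K hK 3 5 5 p isT isT isT p1.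
  by rewrite !big_ord_recl big_ord0 /= !mulr1 !mulrA.
have dis : euler q = A - q * euler (p ^+ 5) - q ^+ 2 * B.
  have s35 : ev (theta 35 75) q = _ := sc 7 15 isT.
  have s10 : ev (theta 10 75) q = _ := sc 2 15 isT.
  have s25 : ev (theta 25 75) q = _ := sc 5 15 isT.
  have s20 : ev (theta 20 75) q = _ := sc 4 15 isT.
  have s05 : ev (theta 5 75) q = _ := sc 1 15 isT.
  have g35 := gth 35%N 75%N isT; have g10 := gX 5%N _ (gth 10%N 75%N isT).
  have g25 := gX 1%N _ (gth 25%N 75%N isT); have g05 := gX 5%N _ (gth 5%N 75%N isT).
  have gs := goodD g35 g10; have gd := goodB (gth 20%N 75%N isT) g05.
  rewrite eth pentagonal_dissection (evB hK (goodB gs g25) (gX 2%N _ gd) q1).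
  rewrite (evB hK gs g25 q1) (evD hK g35 g10 q1) (eX 2%N _ q gd q1).
  rewrite (evB hK (gth 20%N 75%N isT) g05 q1) !eX //; try exact: gth.
  by rewrite s35 s10 s25 s20 s05 e5 AE BE expr1 -/p.
have th0 a : (0 < a < 5)%N -> ev (theta a 5) p =
    qpoch (p ^+ a) (p ^+ 5) * qpoch (p ^+ (5 - a)%N) (p ^+ 5) * euler (p ^+ 5).
  by move=> h; rewrite ev_theta.
have nz a : (0 < a)%N -> qpoch (p ^+ a) (p ^+ 5) != 0 by move=> a0; apply: qpoch_neq0.
have n5 : euler (p ^+ 5) != 0 by apply/euler_neq0/norm_exprn_lt1.
have gA := goodD (gth 7%N 15%N isT) (gX 1%N _ (gth 2%N 15%N isT)).
have gB := goodB (gth 4%N 15%N isT) (gX 1%N _ (gth 1%N 15%N isT)).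
have hA : A * ev (theta 1 5) p = euler (p ^+ 5) * ev (theta 2 5) p.
  rewrite -e5 -(evM hK gA (gth 1%N 5%N isT) p1) -(evM hK (gth 5%N 15%N isT) (gth 2%N 5%N isT) p1).
  by rewrite quintuple_A.
have hB : B * ev (theta 2 5) p = euler (p ^+ 5) * ev (theta 1 5) p.
  rewrite -e5 -(evM hK gB (gth 2%N 5%N isT) p1) -(evM hK (gth 5%N 15%N isT) (gth 1%N 5%N isT) p1).
  by rewrite quintuple_B.
move: hA hB; rewrite !th0 //= => hA hB.
have n1 := nz 1%N isT; have n2 := nz 2%N isT; have n3 := nz 3%N isT; have n4 := nz 4%N isT.
have A' : A = euler (p ^+ 5) * (rrcf p)^-1.
  apply: (mulIf (mulf_neq0 (mulf_neq0 n1 n4) n5)); rewrite hA /rrcf -(expr1 p).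
  by field; rewrite n1 n2 n3 n4.
have B' : B = euler (p ^+ 5) * rrcf p.
  apply: (mulIf (mulf_neq0 (mulf_neq0 n2 n3) n5)); rewrite hB /rrcf -(expr1 p).
  by field; rewrite n2 n3.
by rewrite dis A' B'; ring.
Qed.

End EulerProduct.

(** * The level 10 functions *)

Section Level10.
Variable K : numFieldType.
Hypothesis hK : disc_analysis K.
Variable p : K.
Hypothesis p1 : `|p| < 1.

Definition bracket (j : nat) : K :=
  qpoch (p ^+ j) (p ^+ 10) * qpoch (p ^+ (10 - j)%N) (p ^+ 10).

Local Notation t1 := (bracket 1).
Local Notation t2 := (bracket 2).
Local Notation t3 := (bracket 3).
Local Notation t4 := (bracket 4).
Local Notation f := (qpoch (p ^+ 5) (p ^+ 10)).
Local Notation e := (euler (p ^+ 10)).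

Lemma bracket_neq0 j : (0 < j < 10)%N -> bracket j != 0.
Proof.
by move=> /andP[j0 j10]; rewrite mulf_neq0 // qpoch_neq0 // subn_gt0.
Qed.

Lemma qpochs_bracket1 : qpochs [:: p; p ^+ 9] (p ^+ 10) = t1.
Proof. by rewrite /qpochs big_cons big_seq1 /bracket expr1. Qed.

Lemma qpochs_bracket4 : qpochs [:: p ^+ 4; p ^+ 6] (p ^+ 10) = t4.
Proof. by rewrite /qpochs big_cons big_seq1. Qed.

Lemma split5 a : (0 < a)%N ->
  qpoch (p ^+ a) (p ^+ 5) = qpoch (p ^+ a) (p ^+ 10) * qpoch (p ^+ (a + 5)%N) (p ^+ 10).
Proof.
move=> a0; rewrite (@qpoch_split K hK 2) // !big_ord_recl big_ord0 /= mulr1.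
by rewrite muln0 addn0.
Qed.

Lemma qpochs_bracket14 : qpochs [:: p; p ^+ 4] (p ^+ 5) = t1 * t4.
Proof.
rewrite /qpochs big_cons big_seq1 -{1}[p]expr1 !split5 //= /bracket.
by rewrite -!/(4 + 5)%N -!/(1 + 5)%N; ring.
Qed.

Lemma euler5_bracket : euler (p ^+ 5) = f * e.
Proof. by rewrite /euler split5. Qed.

Lemma euler2_bracket : euler (p ^+ 2) = t2 * t4 * e.
Proof.
have := @qpoch_split K hK 5 2 2 p isT isT isT p1.
rewrite !big_ord_recl big_ord0 /= mulr1 => h; rewrite /euler [LHS]h /bracket /=.
by rewrite mulrA; ring.
Qed.

Lemma euler1_bracket : euler p = t1 * t2 * t3 * t4 * f * e.
Proof.
have := @qpoch_split K hK 10 1 1 p isT isT isT p1.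
rewrite !big_ord_recl big_ord0 /= mulr1 => h; rewrite /euler.
have -> : qpoch p p = qpoch (p ^+ 1) (p ^+ 1) by rewrite expr1.
by rewrite [LHS]h /bracket /=; ring.
Qed.

Lemma rrcf_bracket : rrcf p = t1 * t4 / (t2 * t3).
Proof.
have e1 : qpoch p (p ^+ 5) = qpoch (p ^+ 1) (p ^+ 5) by rewrite expr1.
rewrite /rrcf e1 !split5 // /bracket /=; congr (_ / _); ring.
Qed.

Lemma rrcf2_bracket : rrcf (p ^+ 2) = t2 / t4.
Proof. by rewrite /rrcf -!exprM. Qed.

Lemma bracket_theta j : (0 < j < 10)%N -> ev (theta j 10) p = bracket j * e.
Proof. by move=> h; rewrite ev_theta. Qed.

(** The shape of [theta10_sum] and [theta10_diff], for arbitrary series. *)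
Lemma ev_relation (a b c d x y : fps) : good K a -> good K b -> good K c -> good K d ->
  good K x -> good K y ->
  (b ^+ 2 * c * x = a * c * d ^+ 2 + y * (a ^+ 2 * b * d) ->
   ev b p ^+ 2 * ev c p * ev x p =
   ev a p * ev c p * ev d p ^+ 2 + ev y p * (ev a p ^+ 2 * ev b p * ev d p)) /\
  (a * d ^+ 2 * x = b * c ^+ 2 * d - y * (a * b ^+ 2 * c) ->
   ev a p * ev d p ^+ 2 * ev x p =
   ev b p * ev c p ^+ 2 * ev d p - ev y p * (ev a p * ev b p ^+ 2 * ev c p)).
Proof.
move=> ga gb gc gd gx gy; have gM := @goodM K.
by split=> /(congr1 (fun f => ev f p)); rewrite !expr2 => h;
  [rewrite -!(evM hK) -?(evD hK)|rewrite -!(evM hK) -?(evB hK)]; rewrite ?h; auto 10.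
Qed.

Lemma bracket_relations :
  t2 ^+ 2 * t3 * f ^+ 2 = t1 * t3 * t4 ^+ 2 + p * (t1 ^+ 2 * t2 * t4) /\
  t1 * t4 ^+ 2 * f ^+ 2 = t2 * t3 ^+ 2 * t4 - p * (t1 * t2 ^+ 2 * t3).
Proof.
have n0 : e ^+ 4 != 0 by rewrite expf_neq0 // euler_neq0 // norm_exprn_lt1.
have gth j : (0 < j < 10)%N -> good K (theta j 10) by apply: good_theta.
have [h1 h2] := ev_relation (gth 1%N isT) (gth 2%N isT) (gth 3%N isT) (gth 4%N isT)
  (gth 5%N isT) (@goodX K 1).
have := h1 theta10_sum; have := h2 theta10_diff.
rewrite !bracket_theta // evX expr1 => {h1 h2}.
have -> : bracket 5 = f ^+ 2 by rewrite /bracket expr2.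
move: e n0 => x n0 h2 h1.
by split; apply: (mulIf n0); [apply: etrans (etrans h1 _)|apply: etrans (etrans h2 _)]; ring.
Qed.

(** Ramanujan's parameter, a Hauptmodul in terms of which everything at level
    10 is rational. *)
Definition kparam := p * rrcf p * rrcf (p ^+ 2) ^+ 2.
Local Notation k := kparam.

Lemma kparam_bracket : k = p * t1 * t2 / (t3 * t4).
Proof.
rewrite /kparam rrcf_bracket rrcf2_bracket.
move: (@bracket_neq0 2 isT) (@bracket_neq0 3 isT) (@bracket_neq0 4 isT).
by move: t1 t2 t3 t4 => a b c d nb nc nd; field; rewrite nb nc nd.
Qed.

Lemma one_plus_k : 1 + k = t2 ^+ 2 * f ^+ 2 / (t1 * t4 ^+ 2).
Proof.
rewrite kparam_bracket; have [+ _] := bracket_relations.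
move: (@bracket_neq0 1 isT) (@bracket_neq0 3 isT) (@bracket_neq0 4 isT).
move: t1 t2 t3 t4 f => a b c d x na nc nd h.
apply: (mulfI (mulf_neq0 (mulf_neq0 na nc) (expf_neq0 2 nd))).
transitivity (a * c * d ^+ 2 + p * (a ^+ 2 * b * d)); first by field; rewrite nc nd.
by rewrite -h; field; rewrite na nd.
Qed.

Lemma one_minus_k : 1 - k = t1 * t4 * f ^+ 2 / (t2 * t3 ^+ 2).
Proof.
rewrite kparam_bracket; have [_ +] := bracket_relations.
move: (@bracket_neq0 2 isT) (@bracket_neq0 3 isT) (@bracket_neq0 4 isT).
move: t1 t2 t3 t4 f => a b c d x nb nc nd h.
apply: (mulfI (mulf_neq0 (mulf_neq0 nb (expf_neq0 2 nc)) nd)).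
transitivity (b * c ^+ 2 * d - p * (a * b ^+ 2 * c)); first by field; rewrite nc nd.
by rewrite -h; field; rewrite nb nc.
Qed.

Lemma f_neq0 : f != 0.
Proof. exact: qpoch_neq0. Qed.

Ltac nonzero := repeat first [done | exact: bracket_neq0 | exact: f_neq0
  | apply: invr_neq0 | apply: expf_neq0 | apply: mulf_neq0].

Lemma one_plus_k_neq0 : 1 + k != 0.
Proof. by rewrite one_plus_k; nonzero. Qed.

Lemma one_minus_k_neq0 : 1 - k != 0.
Proof. by rewrite one_minus_k; nonzero. Qed.

(** Ramanujan's relation between [R(q)] and [R(q^2)]. *)
Lemma rrcf2_rrcf : rrcf (p ^+ 2) * (1 - k) = rrcf p ^+ 2 * (1 + k).
Proof.
rewrite one_plus_k one_minus_k rrcf_bracket rrcf2_bracket.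
move: (@bracket_neq0 1 isT) (@bracket_neq0 2 isT).
move: (@bracket_neq0 3 isT) (@bracket_neq0 4 isT).
by move: t1 t2 t3 t4 f => a b c d x nc nd na nb; field; rewrite na nb nc nd.
Qed.

Hypothesis p0 : p != 0.

Lemma kparam_neq0 : k != 0.
Proof. by rewrite kparam_bracket; nonzero. Qed.

Lemma zfun_k : zfun p = 1 + k^-1.
Proof.
have -> : 1 + k^-1 = (1 + k) / k by field; exact: kparam_neq0.
rewrite /zfun -/(euler p) -/(euler (p ^+ 5)) -/(euler (p ^+ 10)).
rewrite euler1_bracket euler5_bracket qpochs_bracket14 qpochs_bracket1.
rewrite one_plus_k kparam_bracket.
move: (@bracket_neq0 1 isT) (@bracket_neq0 2 isT).
move: (@bracket_neq0 3 isT) (@bracket_neq0 4 isT).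
have : e != 0 by rewrite euler_neq0 // norm_exprn_lt1.
move: t1 t2 t3 t4 f e => a b c d x y ny nc nd na nb.
by field; rewrite na nb nc nd ny p0.
Qed.

End Level10.

(** * Fifth roots of unity *)

Section FifthRoots.
Variable K : numClosedFieldType.
Implicit Types (z w x a : K).

Definition zeta5 z := 1 + z + z ^+ 2 + z ^+ 3 + z ^+ 4 = 0.

Lemma zeta5_expr5 z : zeta5 z -> z ^+ 5 = 1.
Proof.
move=> hz; apply/eqP; rewrite -subr_eq0; apply/eqP.
transitivity ((z - 1) * (1 + z + z ^+ 2 + z ^+ 3 + z ^+ 4)); first by ring.
by rewrite hz mulr0.
Qed.

Lemma zeta5_exists : exists z, zeta5 z.
Proof.
pose P : {poly K} := \poly_(i < 5) 1.
have : size P != 1%N by rewrite size_poly_eq ?oner_neq0.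
move/closed_rootP => [z /rootP h]; exists z; rewrite /zeta5 -[RHS]h horner_poly.
by rewrite !big_ord_recl big_ord0 /= !mul1r expr0 expr1 addr0 !addrA.
Qed.

Lemma zeta5_expr z n : zeta5 z -> ~~ (5 %| n)%N -> zeta5 (z ^+ n).
Proof.
move=> hz; have z5 := zeta5_expr5 hz.
rewrite (divn_eq n 5) addnC dvdn_addl ?dvdn_mull //.
rewrite exprD mulnC exprM z5 expr1n mulr1 /zeta5.
have := ltn_pmod n (isT : (0 < 5)%N); case: (n %% 5)%N => [_ /negP[] //|[_ _|[_ _|[_ _|[_ _|//]]]]].
- by rewrite expr1.
- rewrite -[RHS]hz (_ : _ ^+ 2 ^+ 3 = z ^+ 5 * z); last by ring.
  rewrite (_ : _ ^+ 2 ^+ 4 = z ^+ 5 * z ^+ 3); last by ring.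
  by rewrite z5; ring.
- rewrite -[RHS]hz (_ : _ ^+ 3 ^+ 2 = z ^+ 5 * z); last by ring.
  rewrite (_ : _ ^+ 3 ^+ 3 = z ^+ 5 * z ^+ 4); last by ring.
  rewrite (_ : _ ^+ 3 ^+ 4 = z ^+ 5 * z ^+ 5 * z ^+ 2); last by ring.
  by rewrite z5; ring.
- rewrite -[RHS]hz (_ : _ ^+ 4 ^+ 2 = z ^+ 5 * z ^+ 3); last by ring.
  rewrite (_ : _ ^+ 4 ^+ 3 = z ^+ 5 * z ^+ 5 * z ^+ 2); last by ring.
  rewrite (_ : _ ^+ 4 ^+ 4 = z ^+ 5 * z ^+ 5 * z ^+ 5 * z); last by ring.
  by rewrite z5; ring.
Qed.

Lemma zeta5_sum z n : zeta5 z ->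
  \sum_(j < 5) (z ^+ j) ^+ n = if (5 %| n)%N then 5 else 0.
Proof.
move=> hz; under eq_bigr do rewrite exprAC.
case: ifP => [/dvdnP[m ->]|/negbT h].
  rewrite mulnC exprM (zeta5_expr5 hz) expr1n.
  by rewrite !big_ord_recl big_ord0 !expr1n; ring.
rewrite -[RHS](zeta5_expr hz h) !big_ord_recl big_ord0 /= expr0; ring.
Qed.

Lemma zeta5_prod w x : zeta5 w -> \prod_(j < 5) (1 - w ^+ j * x) = 1 - x ^+ 5.
Proof.
move=> hw; have w5 := zeta5_expr5 hw.
rewrite !big_ord_recl big_ord0 /= expr0.
pose A := w + w ^+ 4; pose B := w ^+ 2 + w ^+ 3.
have AB1 : A + B = -1 by apply: (addrI 1); rewrite subrr -[RHS]hw /A /B; ring.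
have AB : A * B = -1.
  apply: (addrI 1); rewrite subrr -[RHS]hw /A /B.
  transitivity (1 + w ^+ 3 + w ^+ 4 + w ^+ 5 * w + w ^+ 5 * w ^+ 2); first by ring.
  by rewrite w5; ring.
have h1 : (1 - w ^+ 1 * x) * (1 - w ^+ 4 * x) = 1 - A * x + x ^+ 2.
  by transitivity (1 - A * x + w ^+ 5 * x ^+ 2); [rewrite /A; ring|rewrite w5 mul1r].
have h2 : (1 - w ^+ 2 * x) * (1 - w ^+ 3 * x) = 1 - B * x + x ^+ 2.
  by transitivity (1 - B * x + w ^+ 5 * x ^+ 2); [rewrite /B; ring|rewrite w5 mul1r].
transitivity ((1 - x) * ((1 - w ^+ 1 * x) * (1 - w ^+ 4 * x))
   * ((1 - w ^+ 2 * x) * (1 - w ^+ 3 * x))); first by ring.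
rewrite h1 h2.
transitivity ((1 - x) * (1 - (A + B) * x + (2 + A * B) * x ^+ 2 - (A + B) * x ^+ 3 + x ^+ 4)).
  by ring.
by rewrite AB1 AB; ring.
Qed.

(** The dissection of the Euler product at [q] is [q * dissect a] with
    [a = q R(q^5)], up to a function of [q^5]; see [euler_dissect]. *)
Definition dissect a := a^-1 - 1 - a.

(** [1 - a - a^2 = (1 - f a) (1 - g a)] with [f] the golden ratio and [g] its
    conjugate; the norm of [1 - f a] is [1 - (f a)^5], and [f^5 + g^5 = 11]. *)
Lemma dissect_norm z a : zeta5 z -> a != 0 ->
  \prod_(j < 5) dissect (z ^+ j * a) = a ^- 5 - 11 - a ^+ 5.
Proof.
move=> hz a0; have z5 := zeta5_expr5 hz.
have z0 : z != 0 by apply/eqP => z0; move: z5; rewrite z0 expr0n => /eqP; rewrite eq_sym oner_eq0.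
pose f : K := (1 + sqrtC 5) / 2; pose g := 1 - f.
have ff : f ^+ 2 = f + 1.
  by rewrite /f expr_div_n sqrrD sqrtCK; field.
have fg : f * g = -1 by rewrite /g mulrBr mulr1 -expr2 ff opprD addrA subrr add0r.
have fg5 : f ^+ 5 + g ^+ 5 = 11.
  transitivity ((f + g) ^+ 5 - 5 * (f * g) * (f + g) ^+ 3 + 5 * (f * g) ^+ 2 * (f + g)).
    by ring.
  by rewrite fg /g addrCA subrr addr0; ring.
have dE b : b != 0 -> dissect b = b^-1 * ((1 - f * b) * (1 - g * b)).
  move=> b0; rewrite /dissect.
  have -> : (1 - f * b) * (1 - g * b) = 1 - (f + g) * b + f * g * b ^+ 2 by ring.
  by rewrite fg /g addrCA subrr addr0; field.
under eq_bigr => j _ do rewrite dE ?mulf_neq0 ?expf_neq0 //.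
rewrite big_split big_split /=.
have mulz c : \prod_(j < 5) (1 - c * (z ^+ j * a)) = 1 - (c * a) ^+ 5.
  by rewrite -(zeta5_prod _ hz); apply: eq_bigr => j _; rewrite mulrCA.
rewrite !mulz prodfV big_split /= prodr_const card_ord.
have -> : \prod_(j < 5) z ^+ j = 1.
  rewrite !big_ord_recl big_ord0 /=.
  by transitivity ((z ^+ 5) ^+ 2); [ring|rewrite z5 expr1n].
rewrite mul1r; transitivity (a ^- 5 * (1 - (f ^+ 5 + g ^+ 5) * a ^+ 5 + (f * g) ^+ 5 * a ^+ 10)).
  by ring.
by rewrite fg5 fg; field.
Qed.

Lemma root5_exists (p : K) : `|p| < 1 -> exists2 q, q ^+ 5 = p & `|q| < 1.
Proof.
move=> p1; exists (5.-root p); first by rewrite rootCK.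
rewrite real_ltNge ?normr_real ?real1 //; apply/negP => h.
have := exprn_ege1 5 h; rewrite -normrX rootCK // => h'.
by have := le_lt_trans h' p1; rewrite ltxx.
Qed.

Hypothesis hK : disc_analysis K.

Lemma norm_zeta z j q : zeta5 z -> `|z ^+ j * q| = `|q|.
Proof.
move=> hz; have z5 := zeta5_expr5 hz.
have z1 : `|z| = 1.
  by apply/eqP; rewrite -(@pexpr_eq1 _ _ 5) // -normrX z5 normr1.
by rewrite normrM normrX z1 expr1n mul1r.
Qed.

(** The product of [1 - (z^j q)^n] over [j] is [1 - q^(5n)] or [(1 - q^n)^5]. *)
Lemma euler_norm z q : zeta5 z -> `|q| < 1 ->
  (\prod_(j < 5) euler (z ^+ j * q)) * euler (q ^+ 25) = euler (q ^+ 5) ^+ 6.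
Proof.
move=> hz q1; have z5 := zeta5_expr5 hz.
pose P x N : K := \prod_(0 <= n < N) (1 - x ^+ n.+1).
have tP x : `|x| < 1 -> tends (P x) (euler x).
  move=> x1; have := @qpoch_tends K hK 1 1 x isT isT x1; rewrite expr1 -/(euler x).
  by apply: tends_eq => N; apply: eq_bigr => n _; rewrite mul1n.
have five N : (N <= N * 5)%N by rewrite leq_pmulr.
(* The first [5 N] factors on both sides have the same exponents. *)
have fin N : (\prod_(j < 5) P (z ^+ j * q) (N * 5)%N) * P (q ^+ 25) N =
             P (q ^+ 5) (N * 5)%N * P (q ^+ 5) N ^+ 5.
  elim: N => [|N IH].
    by rewrite /P !big_geq // expr1n mulr1 big1 ?mul1r // => j _; rewrite big_geq.
  have block x : P x (N.+1 * 5)%N = P x (N * 5)%N *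
      ((1 - x ^+ (N * 5).+1) * (1 - x ^+ (N * 5).+2) * (1 - x ^+ (N * 5).+3)
       * (1 - x ^+ (N * 5).+4) * (1 - x ^+ (N * 5).+4.+1)).
    by rewrite mulSn addnC /P !addnS addn0 !big_nat_recr //= !mulrA.
  have blockS x : P x N.+1 = P x N * (1 - x ^+ N.+1) by rewrite /P big_nat_recr.
  under eq_bigr do rewrite block.
  rewrite !big_split /= !blockS block.
  have nd m : ~~ (5 %| m)%N -> \prod_(j < 5) (1 - (z ^+ j * q) ^+ m) = 1 - (q ^+ 5) ^+ m.
    move=> h; rewrite exprAC -(zeta5_prod _ (zeta5_expr hz h)).
    by apply: eq_bigr => j _; rewrite exprMn exprAC.
  rewrite (nd (N * 5).+1) ?(nd (N * 5).+2) ?(nd (N * 5).+3) ?(nd (N * 5).+4); try by lia.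
  have -> : \prod_(j < 5) (1 - (z ^+ j * q) ^+ (N * 5).+4.+1) = (1 - (q ^+ 5) ^+ N.+1) ^+ 5.
    transitivity (\prod_(j < 5) (1 - (q ^+ 5) ^+ N.+1)); last by rewrite prodr_const card_ord.
    apply: eq_bigr => j _.
    have -> : (N * 5).+4.+1 = (5 * N.+1)%N by lia.
    by rewrite exprM; congr (1 - _ ^+ _); rewrite exprMn exprAC z5 expr1n mul1r.
  have -> : (q ^+ 25) ^+ N.+1 = (q ^+ 5) ^+ (N * 5).+4.+1.
    by rewrite -!exprM; congr (_ ^+ _); lia.
  set X := (1 - _ ^+ (N * 5).+1); set Y := (1 - _ ^+ (N * 5).+2).
  set Z := (1 - _ ^+ (N * 5).+3); set W := (1 - _ ^+ (N * 5).+4).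
  set V := (1 - _ ^+ (N * 5).+4.+1); set U := 1 - _.
  move: IH; move: (\prod_(j < 5) _) (P (q ^+ 25) N) (P (q ^+ 5) N) (P (q ^+ 5) (N * 5)%N).
  move=> a b c d IH; rewrite exprMn.
  transitivity ((a * b) * (X * Y * Z * W * U ^+ 5 * V)); first by ring.
  by rewrite IH; ring.
have n5 : `|q ^+ 5| < 1 by apply: norm_exprn_lt1.
have n25 : `|q ^+ 25| < 1 by apply: norm_exprn_lt1.
have nj (j : 'I_5) : `|z ^+ j * q| < 1 by rewrite norm_zeta.
have L := tendsM (@tends_prod K _ (index_enum 'I_5) _ _
  (fun j => tends_sub five (tP _ (nj j)))) (tP _ n25).
have T5 := tP _ n5.
have Rt := tendsM (tends_sub five T5) (tendsM T5 (tendsM T5 (tendsM T5 (tendsM T5 T5)))).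
have -> : euler (q ^+ 5) ^+ 6 = euler (q ^+ 5) * (euler (q ^+ 5) * (euler (q ^+ 5) *
   (euler (q ^+ 5) * (euler (q ^+ 5) * euler (q ^+ 5))))) by ring.
apply: tends_unique L _; apply: tends_eq Rt => N; rewrite fin; ring.
Qed.

(** * Arithmetic progressions modulo 5 *)

Lemma sum_blocks (V : zmodType) m N (F : nat -> V) :
  \sum_(0 <= i < N * m) F i = \sum_(0 <= i < N) \sum_(0 <= c < m) F (i * m + c)%N.
Proof.
rewrite big_nat_mul; apply: eq_bigr => i _.
by rewrite -{1}[(i * m)%N]add0n big_addn mulSn addnK; apply: eq_bigr => c _; rewrite addnC.
Qed.

Definition section5 r (f : fps) := FPS (fun n => f (5 * n + r)%N).

Lemma good_section5 r f : good K f -> good K (section5 r f).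
Proof.
move=> hf t /andP[t0 t1]; pose s := 5.-root t.
have s5 : s ^+ 5 = t by rewrite rootCK.
have s0 : 0 < s by rewrite rootC_gt0.
have s1 : s < 1 by rewrite rootC_lt1 // ltW.
have [|B hB] := hf s; first by rewrite s0.
exists (B / s ^+ r) => N; rewrite ler_pdivlMr ?exprn_gt0 //.
apply: le_trans (hB (N * 5 + r)%N); rewrite mulr_suml.
have ge0 n : 0 <= `|f n|%:~R * s ^+ n :> K by rewrite mulr_ge0 ?ler0z ?exprn_ge0 // ltW.
rewrite [leRHS](@big_cat_nat _ _ _ r) ?leq_addl //=.
rewrite -[leLHS]add0r; apply: lerD; first by apply: sumr_ge0.
have -> : \sum_(r <= i < N * 5 + r) `|f i|%:~R * s ^+ i =
          \sum_(0 <= i < N * 5) `|f (i + r)%N|%:~R * s ^+ (i + r) :> K.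
  by rewrite -{1}[r]add0n big_addn addnK.
rewrite sum_blocks; apply: ler_sum => i _.
rewrite big_nat_recl // -[leLHS]addr0.
apply: lerD; last by apply: sumr_ge0.
by rewrite addn0 mulnC -s5 -exprM -mulrA -exprD mulnC.
Qed.

(** The coefficient of degree [n] is multiplied by the sum of the [(z^j)^(n + s)],
    which is 5 or 0. *)
Lemma ev_section5 z r s f q : zeta5 z -> (r < 5)%N -> (5 %| r + s)%N ->
  good K f -> `|q| < 1 -> q != 0 ->
  \sum_(j < 5) (z ^+ j) ^+ s * ev f (z ^+ j * q) = 5 * q ^+ r * ev (section5 r f) (q ^+ 5).
Proof.
move=> hz r5 rs hf q1 q0.
have five N : (N <= N * 5)%N by rewrite leq_pmulr.
have gq : good K (section5 r f) by apply: good_section5.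
have q51 : `|q ^+ 5| < 1 by apply: norm_exprn_lt1.
have nj (j : 'I_5) : `|z ^+ j * q| < 1 by rewrite norm_zeta.
have L := @tends_sum K _ (index_enum 'I_5) _ _ (fun j : 'I_5 =>
  tendsM (@tends_cst K ((z ^+ j) ^+ s)) (tends_sub five (ev_tends hK hf (nj j)))).
have Rt := tendsM (@tends_cst K (5 * q ^+ r)) (ev_tends hK gq q51).
apply: tends_unique L _; apply: tends_eq Rt => N.
rewrite /psum; under [RHS]eq_bigr do rewrite mulr_sumr; rewrite exchange_big /=.
rewrite [RHS](eq_bigr (fun n => (f n)%:~R * q ^+ n
    * (if (5 %| n + s)%N then 5 else 0))); last first.
  move=> n _; rewrite -(zeta5_sum _ hz) mulr_sumr; apply: eq_bigr => j _.
  by rewrite exprMn exprD; ring.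
rewrite sum_blocks mulr_sumr; apply: eq_bigr => i _.
rewrite (bigD1_seq r) ?mem_index_iota ?iota_uniq //= big_nat_cond big1 ?addr0.
  have -> : (5 %| i * 5 + r + s)%N by rewrite -addnA dvdn_addr // dvdn_mull.
  by rewrite /= (mulnC i 5) exprD exprM; ring.
move=> c /andP[/andP[_ c5] cr]; case: ifP; rewrite ?mulr0 // => h; exfalso; move: h cr rs; lia.
Qed.

End FifthRoots.

(** * Counting labellings of layered posets *)

Section Labellings.
(** [l i] is the layer of vertex [i]; a layer has one or two vertices and its
    vertices are consecutive. *)
Variable l : nat -> nat.
Hypothesis l_step : forall i, l i.+1 = l i \/ l i.+1 = (l i).+1.
Hypothesis l_two : forall i, l i.+2 <> l i.

Definition second i := (0 < i)%N && (l i == l i.-1).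

Definition ordered V (a : seq nat) := forall i j, (i < V)%N -> (j < V)%N ->
  l j = (l i).+1 -> (nth 0%N a j <= nth 0%N a i)%N.

Definition labellings V n : set (seq nat) :=
  [set a | [/\ size a = V, ordered V a & sumn a = n]]%classic.

Definition labelling_series V := FPS (fun n => \sum_(a \in labellings V n) (1 : int)).

Lemma l_mono i j : (i <= j)%N -> (l i <= l j)%N.
Proof.
elim: j => [|j IH]; first by rewrite leqn0 => /eqP ->.
rewrite leq_eqVlt => /orP[/eqP -> //|]; rewrite ltnS => /IH h.
by case: (l_step j) => ->; lia.
Qed.

Lemma next_layer i V : (i <= V)%N -> (l i < l V)%N ->
  exists2 j, (j <= V)%N & l j = (l i).+1.
Proof.
elim: V => [|V IH]; first by rewrite leqn0 => /eqP ->; rewrite ltnn.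
rewrite leq_eqVlt => /orP[/eqP ->|]; first by rewrite ltnn.
rewrite ltnS => iV lt; have := l_mono iV; rewrite leq_eqVlt => /orP[/eqP e|lt'].
  by exists V.+1 => //; case: (l_step V) lt => ->; rewrite e ?ltnn.
by have [j jV lj] := IH iV lt'; exists j => //; apply: leqW.
Qed.

Lemma all_pos V a : ordered V.+1 a ->
  (forall j, (j <= V)%N -> l j = l V -> (0 < nth 0%N a j)%N) ->
  forall i, (i <= V)%N -> (0 < nth 0%N a i)%N.
Proof.
move=> oa top i; have [m] := ubnP (l V - l i); elim: m i => // m IH i lm iV.
have := l_mono iV; rewrite leq_eqVlt => /orP[/eqP e|lt]; first exact: top.
have [j jV lj] := next_layer iV lt.
by apply: leq_trans (oa i j iV jV lj); apply: IH => //; lia.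
Qed.

Lemma finite_labellings V n : finite_set (labellings V n).
Proof.
pose h (f : {ffun 'I_V -> 'I_n.+1}) : seq nat := [seq (f i : nat) | i <- enum 'I_V].
apply: (@sub_finite_set _ _ (h @` setT)%classic); last first.
  by apply: finite_image; apply: finite_finset.
move=> a [sa _ suma]; exists [ffun i : 'I_V => inord (nth 0%N a i)] => //.
apply: (@eq_from_nth _ 0%N); first by rewrite size_map size_enum_ord sa.
move=> i; rewrite size_map size_enum_ord => iV.
rewrite (nth_map (Ordinal iV)) ?size_enum_ord // ffunE nth_enum_ord // inordK //.
rewrite ltnS -suma; have ia : (i < size a)%N by rewrite sa.
elim: a i ia {sa suma iV} => // x a IH [|i] /= ia; first exact: leq_addr.
by apply: leq_trans (IH i ia) (leq_addl _ _).
Qed.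

Lemma sumn_succ a : sumn (map succn a) = (sumn a + size a)%N.
Proof. by elim: a => //= x a ->; lia. Qed.

Lemma map_pred_succ a : (forall i, (i < size a)%N -> (0 < nth 0%N a i)%N) ->
  map succn (map predn a) = a.
Proof.
move=> h; rewrite -map_comp -[RHS]map_id; apply: (@eq_from_nth _ 0%N).
  by rewrite !size_map.
move=> i; rewrite size_map => ia; rewrite !(nth_map 0%N) //= prednK //; exact: h.
Qed.

Lemma ordered_succ V a : size a = V -> ordered V (map succn a) <-> ordered V a.
Proof.
move=> sa; split=> h i j iV jV lij; have := h i j iV jV lij;
  by rewrite !(nth_map 0%N) ?sa.
Qed.

Lemma ordered_rcons0 V a : size a = V -> ordered V.+1 (rcons a 0%N) <-> ordered V a.
Proof.
move=> sa; split=> h i j iV jV lij.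
  have := h i j (leqW iV) (leqW jV) lij.
  by rewrite !nth_rcons sa iV jV.
rewrite !nth_rcons sa; case: (ltnP j V) => jV'; last by case: eqP.
have iV' : (i < V)%N.
  rewrite ltn_neqAle -ltnS iV andbT; apply/eqP => iV'.
  by have := l_mono (ltnW jV'); rewrite lij iV' ltnn.
by rewrite iV'; apply: h.
Qed.

Lemma set_inj_succ (A : set (seq nat)) : set_inj A (map succn).
Proof. by move=> x y _ _; apply: inj_map => ? ? []. Qed.

Lemma set_inj_rcons (A : set (seq nat)) : set_inj A (rcons^~ 0%N).
Proof. by move=> x y _ _ /rcons_inj[]. Qed.

Lemma fsum_image (A : set (seq nat)) (h : seq nat -> seq nat) : set_inj A h ->
  \sum_(a \in (h @` A)%classic) (1 : int) = \sum_(a \in A) (1 : int).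
Proof. by move=> hi; rewrite fsbig_image. Qed.

(** By subtraction of 1 from every label. *)
Lemma pos_labellings V n :
  [set a | labellings V n a /\ forall i, (i < V)%N -> (0 < nth 0%N a i)%N]%classic =
  (if (V <= n)%N then map succn @` labellings V (n - V)%N else set0)%classic.
Proof.
apply/seteqP; split=> a.
  move=> [[sa oa suma] pos].
  have e : map succn (map predn a) = a by apply: map_pred_succ => i; rewrite sa; apply: pos.
  have sp : size (map predn a) = V by rewrite size_map.
  have sumE : (sumn (map predn a) + V)%N = n by rewrite -suma -{2}e sumn_succ sp.
  rewrite -{1}sumE leq_addl; exists (map predn a) => //; split=> //.
    by apply/(ordered_succ sp); rewrite e.
  by rewrite -sumE addnK.
case: leqP => // Vn [b [sb ob sumb] <-]; split; last first.
  by move=> i iV; rewrite (nth_map 0%N) // sb.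
split; [by rewrite size_map|by apply/ordered_succ|].
by rewrite sumn_succ sb sumb subnK.
Qed.

Lemma sum_pos_labellings V n :
  \sum_(a \in [set a | labellings V n a /\
                       forall i, (i < V)%N -> (0 < nth 0%N a i)%N]%classic) (1 : int) =
  (fpsX V * labelling_series V) n.
Proof.
rewrite pos_labellings fpsXM; case: ifP => _; last by rewrite fsbig_set0.
by rewrite fsum_image //; apply: set_inj_succ.
Qed.

Lemma zero_labellings V n :
  [set a | labellings V.+1 n a /\ nth 0%N a V = 0%N]%classic =
  (rcons^~ 0%N @` labellings V n)%classic.
Proof.
apply/seteqP; split=> a.
  case: (lastP a) => [|b x] [[sa oa suma]]; first by [].
  move: sa; rewrite size_rcons => -[sb]; rewrite nth_rcons sb ltnn eqxx => x0.
  move: oa suma; rewrite x0 sumn_rcons addn0 => /(ordered_rcons0 sb) ob sumb.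
  by exists b.
move=> [b [sb ob sumb] <-]; split; last by rewrite nth_rcons sb ltnn eqxx.
by split; rewrite ?size_rcons ?sb // ?sumn_rcons ?addn0 //; apply/ordered_rcons0.
Qed.

Lemma sum_zero_labellings V n :
  \sum_(a \in [set a | labellings V.+1 n a /\ nth 0%N a V = 0%N]%classic) (1 : int) =
  labelling_series V n.
Proof. by rewrite zero_labellings fsum_image //; apply: set_inj_rcons. Qed.

(** Adding a vertex which begins a layer: its label is 0, or all labels are
    positive. *)
Lemma labelling_first V : ~~ second V ->
  labelling_series V.+1 * (1 - fpsX V.+1) = labelling_series V.
Proof.
move=> sV; apply/eqP; rewrite mulrBr mulr1 subr_eq; apply/eqP.
apply: fpsP => n; rewrite fpsD [_ * fpsX _]mulrC -sum_pos_labellings -(sum_zero_labellings V).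
rewrite -fsbigU0.
- apply: eq_fsbigl; apply/seteqP; split=> a; last by case=> [[la _]|[la _]].
  move=> la; have [a0|a0] := posnP (nth 0%N a V); [by left; split|right; split=> //].
  have [_ oa _] := la; apply: (all_pos oa) => j jV lj.
  suff -> : j = V by []; apply/eqP; rewrite eqn_leq jV /= leqNgt; apply/negP => jV'.
  move/negP: sV; apply; rewrite /second (leq_ltn_trans _ jV') //= eqn_leq.
  have [h1 h2] : (j <= V.-1)%N /\ (V.-1 <= V)%N by lia.
  by rewrite (l_mono h2) -lj (l_mono h1).
- by apply: sub_finite_set (finite_labellings V.+1 n) => a [la _].
- by apply: sub_finite_set (finite_labellings V.+1 n) => a [la _].
- by move=> a [[_ a0] [_ /(_ V (ltnSn V))]]; rewrite a0.
Qed.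

Lemma below_top V i j : (j <= V)%N -> l j = (l i).+1 -> (l i < l V)%N.
Proof. by move=> jV lij; rewrite -lij l_mono. Qed.

Lemma ordered_swap V c x : l V.+1 = l V -> size c = V ->
  ordered V.+2 (rcons (rcons c 0%N) x) <-> ordered V.+1 (rcons c x).
Proof.
move=> lV sc.
have nl i : nth 0%N (rcons (rcons c 0%N) x) i =
    if (i < V)%N then nth 0%N c i else if i == V.+1 then x else 0%N.
  rewrite !nth_rcons size_rcons sc; case: (ltngtP i V) => [iV|iV|->].
  - by rewrite ltnS (ltnW iV).
  - by rewrite ltnS leqNgt iV.
  - by rewrite ltnSn (ltn_eqF (ltnSn V)).
have nr i : nth 0%N (rcons c x) i =
    if (i < V)%N then nth 0%N c i else if i == V then x else 0%N.
  by rewrite nth_rcons sc.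
have low i j : (j <= V.+1)%N -> l j = (l i).+1 -> (i < V)%N.
  move=> jV lij; rewrite ltnNge; apply/negP => /l_mono.
  by have := below_top jV lij; rewrite lV ltnNge => /negP.
split=> h i j iV jV lij.
  have i1 := low i j (leqW jV) lij; rewrite !nr i1; case: (ltnP j V) => jV'.
    by have := h i j (leqW iV) (leqW jV) lij; rewrite !nl i1 jV'.
  have e : j = V by apply/eqP; rewrite eqn_leq jV' andbT.
  have lij' : l V.+1 = (l i).+1 by rewrite lV -e.
  have := h i V.+1 (leqW iV) (ltnSn _) lij'.
  by rewrite !nl i1 eqxx ltnNge leqnSn /= e eqxx.
have i1 := low i j jV lij; rewrite !nl i1; case: (ltnP j V) => jV'.
  by have := h i j (leqW i1) (leqW jV') lij; rewrite !nr i1 jV'.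
case: eqP => [e|] //; have lij' : l V = (l i).+1 by rewrite -lV -e.
by have := h i V (leqW i1) (ltnSn _) lij'; rewrite !nr i1 ltnn eqxx.
Qed.

(** Adding the second vertex of a layer: if its label is positive and its
    twin has label 0, exchange the twins and delete the label 0. *)
Lemma labelling_second V : second V ->
  labelling_series V.+1 * (1 - fpsX V.+1) = labelling_series V * (1 + fpsX V).
Proof.
case: V => [//|V] /andP[_ /= /eqP lV].
have Vtop j : (j <= V)%N -> l j = l V -> j = V.
  move=> jV lj; apply/eqP; rewrite eqn_leq jV /= leqNgt; apply/negP => jV'.
  case: V lV jV lj jV' => // V lV jV lj jV'; apply: (@l_two V); rewrite lV.
  have jV1 : (j <= V)%N by rewrite -ltnS.
  by apply/eqP; rewrite eqn_leq -{1}lj (l_mono (leqnSn V)) (l_mono jV1).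
apply/eqP; rewrite mulrBr mulr1 subr_eq mulrDr mulr1; apply/eqP.
apply: fpsP => n; rewrite !fpsD ![_ * fpsX _]mulrC -!sum_pos_labellings -(sum_zero_labellings V.+1).
set Z := [set _ | _]%classic; set P1 := [set _ | _]%classic; set P2 := [set _ | _]%classic.
pose h b := rcons (rcons (take V b) 0%N) (nth 0%N b V).
have split_last b : size b = V.+1 -> b = rcons (take V b) (nth 0%N b V).
  by move=> sb; rewrite -take_nth ?sb // take_oversize ?sb.
have hi : set_inj P1 h.
  move=> b b' /set_mem[[sb _ _] _] /set_mem[[sb' _ _] _].
  move=> /rcons_inj[] /rcons_inj[] e e'.
  by rewrite (split_last b sb) (split_last b' sb') e e'.
rewrite -(fsum_image hi); set M := (h @` P1)%classic.
have finZ : finite_set Z.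
  by apply: sub_finite_set (finite_labellings V.+2 n) => a [la _].
have finP : finite_set P2.
  by apply: sub_finite_set (finite_labellings V.+2 n) => a [la _].
have finM : finite_set M.
  by apply: finite_image; apply: sub_finite_set (finite_labellings V.+1 n) => a [la _].
have ME : M = [set a | labellings V.+2 n a /\
    ((0 < nth 0%N a V.+1)%N /\ nth 0%N a V = 0%N)]%classic.
  apply/seteqP; split=> s.
    move=> [b [[sb ob sumb] pos] <-].
    have stk : size (take V b) = V by rewrite size_takel // sb.
    have eb := split_last b sb.
    split; [split|].
    - by rewrite !size_rcons stk.
    - by apply/(ordered_swap _ lV stk); rewrite -eb.
    - by rewrite !sumn_rcons addn0 -sumn_rcons -eb.
    - by rewrite /h !nth_rcons !size_rcons stk !ltnn !eqxx ltnSn; split=> //; apply: pos.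
  case: (lastP s) => {s} [|a' x] [[sa oa suma]]; first by [].
  case: (lastP a') sa oa suma => {a'} [|c y]; first by rewrite size_rcons.
  rewrite !size_rcons => -[sc] oc sumc.
  rewrite !nth_rcons !size_rcons sc !ltnn !eqxx ltnSn => -[x0 y0]; move: oc sumc; rewrite y0.
  move=> /(ordered_swap _ lV sc) ob; rewrite !sumn_rcons addn0 => sumc.
  exists (rcons c x); last first.
    have tk : take V (rcons c x) = c by rewrite -cats1 take_size_cat.
    by rewrite /h tk nth_rcons sc ltnn eqxx.
  split; first by split; rewrite ?size_rcons ?sc // sumn_rcons.
  move=> i iV; apply: (all_pos ob) => // j jV /(Vtop _ jV) ->.
  by rewrite nth_rcons sc ltnn eqxx.
have UE : labellings V.+2 n = (Z `|` M `|` P2)%classic.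
  apply/seteqP; split=> s; last first.
    by case=> [[[la _]|]|[la _]] //; rewrite ME => -[la _].
  move=> la; have [a0|a0] := posnP (nth 0%N s V.+1); first by left; left; split.
  have [b0|b0] := posnP (nth 0%N s V); first by left; right; rewrite ME; split.
  right; split=> //; have [_ oa _] := la; apply: (all_pos oa) => j jV lj.
  move: jV; rewrite leq_eqVlt => /orP[/eqP -> //|jV].
  by rewrite (Vtop j jV) // lj lV.
have -> : labelling_series V.+2 n = \sum_(a \in labellings V.+2 n) (1 : int) by [].
rewrite UE fsbigU0 ?finite_setU //.
  rewrite fsbigU0 //; move=> s [[_ a0]]; rewrite ME => -[_ [a1 _]].
  by rewrite a0 in a1.
move=> s [[[_ a0]|]].
  by case=> _ /(_ V.+1 (ltnSn _)); rewrite a0.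
by rewrite ME => -[_ [_ b0]] [_ /(_ V (leqW (ltnSn _)))]; rewrite b0.
Qed.

(** A labelling is built vertex by vertex; vertex [i] multiplies the series by
    [1 / (1 - X^(i + 1))], and by [1 + X^i] if it is the second of its layer. *)
Lemma labelling_seriesE V : labelling_series V =
  \prod_(0 <= i < V) ((if second i then 1 + fpsX i else 1) * geo i.+1).
Proof.
elim: V => [|V IH].
  rewrite big_geq //; apply: fpsP => n; rewrite fps1 /=.
  case: eqP => [->|n0].
    rewrite (_ : labellings 0 0 = [set [::]])%classic ?fsbig_set1 //.
    apply/seteqP; split=> a; first by case=> /size0nil.
    by move=> ->; split.
  rewrite (_ : labellings 0 n = set0)%classic ?fsbig_set0 //.
  by apply/seteqP; split=> a // [/size0nil -> _ /= e]; case: n0.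
rewrite big_nat_recr //= -IH.
have -> : labelling_series V.+1 = labelling_series V.+1 * (1 - fpsX V.+1) * geo V.+1.
  by rewrite -mulrA geoE // mulr1.
rewrite [RHS]mulrA; congr (_ * _).
by case: ifP => [/labelling_second|/negbT /labelling_first ->]; rewrite ?mulr1.
Qed.

End Labellings.

(** * The generating function of broken 2-diamond partitions *)

Definition labelled (l : nat -> nat) V N (a : {ffun 'I_V -> 'I_N.+1}) :=
  [forall i : 'I_V, forall j : 'I_V, (l j == (l i).+1) ==> (a j <= a i)%N].
Arguments labelled : clear implicits.

Lemma card_labellings l V N n : (n <= N)%N ->
  (#|[set a : {ffun 'I_V -> 'I_N.+1} | labelled l V N a & (\sum_i (a i : nat) == n)%N]|)%:Z =
  labelling_series l V n.
Proof.
move=> nN; set A := [set a | _].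
pose h (f : {ffun 'I_V -> 'I_N.+1}) : seq nat := [seq (f i : nat) | i <- enum 'I_V].
have nth_h f (i : 'I_V) : nth 0%N (h f) i = f i.
  by rewrite /h (nth_map i) ?size_enum_ord // nth_ord_enum.
have size_h f : size (h f) = V by rewrite size_map size_enum_ord.
have h_inj : injective h.
  move=> f g fg; apply/ffunP => i; apply: val_inj; by rewrite /= -!nth_h fg.
have sum_h f : sumn (h f) = (\sum_i (f i : nat))%N by rewrite sumnE big_map big_enum.
have -> : labelling_series l V n = \sum_(s \in labellings l V n) (1 : int) by [].
have -> : labellings l V n = (h @` [set` A])%classic.
  apply/seteqP; split=> s; last first.
    move=> [f]; rewrite /= inE => /andP[/forallP ok /eqP sumf] <-.
    split; rewrite ?size_h ?sum_h // => i j iV jV lij.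
    have := ok (Ordinal iV) => /forallP /(_ (Ordinal jV)) /=; rewrite lij eqxx /=.
    by rewrite -!nth_h.
  move=> [ss os sums]; exists [ffun i : 'I_V => inord (nth 0%N s i)].
    have le i : (i < V)%N -> (nth 0%N s i <= N)%N.
      move=> iV; apply: leq_trans nN; rewrite -sums.
      have ia : (i < size s)%N by rewrite ss.
      elim: s i ia {ss os sums iV} => // x s IH [|i] /= ia; first exact: leq_addr.
      by apply: leq_trans (IH i ia) (leq_addl _ _).
    rewrite /= inE; apply/andP; split.
      apply/forallP => i; apply/forallP => j; apply/implyP => /eqP lij.
      rewrite !ffunE !inordK ?ltnS ?le //; exact: os.
    apply/eqP; rewrite -sums sumnE (big_nth 0%N) ss big_mkord; apply: eq_bigr => i _.
    by rewrite ffunE inordK // ltnS le.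
  apply: (@eq_from_nth _ 0%N); first by rewrite size_h ss.
  move=> i; rewrite size_h => iV; rewrite (nth_h _ (Ordinal iV)) ffunE inordK //.
  rewrite ltnS; apply: leq_trans nN; rewrite -sums /=.
  have ia : (i < size s)%N by rewrite ss.
  elim: s i ia {ss os sums iV} => // x s IH [|i] /= ia; first exact: leq_addr.
  by apply: leq_trans (IH i ia) (leq_addl _ _).
rewrite fsbig_image; last by move=> x y _ _; apply: h_inj.
rewrite -sum1_card raddf_sum /= (@bigfs _ _ _ _ (index_enum _)) //.
  exact: index_enum_uniq.
by move=> i _; rewrite mem_index_enum.
Qed.

(** The layers of the chain of 2-diamonds, and of the one that starts at vertex 1. *)
Definition layer1 i := diamond_layer 2 i.
Definition layer2 i := diamond_layer 2 i.+1.

Lemma layerE i : diamond_layer 2 i = ((i %/ 5) * 3 + (i %% 5).+1 %/ 2)%N.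
Proof. by rewrite /diamond_layer uphalfE divn2. Qed.

Lemma layer_step i : diamond_layer 2 i.+1 = diamond_layer 2 i \/
                     diamond_layer 2 i.+1 = (diamond_layer 2 i).+1.
Proof. by rewrite !layerE; lia. Qed.

Lemma layer_two i : diamond_layer 2 i.+2 <> diamond_layer 2 i.
Proof. by rewrite !layerE; lia. Qed.

Lemma layer_second i : (diamond_layer 2 i.+1 == diamond_layer 2 i) =
  (i.+1 %% 5 == 2)%N || (i.+1 %% 5 == 4)%N.
Proof. by rewrite !layerE; lia. Qed.

Definition Delta2_fps := FPS (fun n => (Delta 2 n)%:Z).

Lemma Delta2_labellings N :
  Delta2_fps N = (labelling_series layer1 (5 * N).+1 * labelling_series layer2 (5 * N)) N.
Proof.
pose s V (a : {ffun 'I_V -> 'I_N.+1}) := (\sum_i (a i : nat))%N.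
pose A V l n := [set a : {ffun 'I_V -> 'I_N.+1} | labelled l V N a & s V a == n].
rewrite fpsM; transitivity (\sum_(i < N.+1)
    (#|A (5 * N).+1 layer1 i| * #|A (5 * N)%N layer2 (N - i)%N|)%N%:Z); last first.
  apply: eq_bigr => i _; rewrite PoszM !card_labellings ?leq_subr //.
  by rewrite -ltnS.
rewrite -(big_morph _ PoszD (erefl (Posz 0))) /= /Delta; congr Posz.
pose F i := finset.setX (A (5 * N).+1 layer1 i) (A (5 * N)%N layer2 (N - i)%N).
pose G i := (#|A (5 * N).+1 layer1 i| * #|A (5 * N)%N layer2 (N - i)%N|)%N.
have -> : broken_diamonds 2 N N = \bigcup_(i < N.+1) F i.
  apply/setP => -[a b]; rewrite inE /=; apply/and3P/bigcupP.
    move=> [oa ob /eqP sab].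
    have sa : (s _ a < N.+1)%N by rewrite ltnS -[X in (_ <= X)%N]sab leq_addr.
    exists (Ordinal sa) => //; rewrite !inE /= eqxx andbT; apply/and3P; split=> //.
    by rewrite -[X in (X - _)%N]sab addKn.
  move=> [i _]; rewrite !inE /= => /andP[/andP[oa /eqP sa] /andP[ob /eqP sb]].
  split=> //; rewrite -/(s _ a) -/(s _ b) sa sb subnKC //; by rewrite -ltnS.
rewrite -(big_mkord xpredT F) -(big_mkord xpredT G).
suff h m : #|\bigcup_(0 <= i < m) F i| = (\sum_(0 <= i < m) G i)%N by exact: h.
elim: m => [|m IH]; first by rewrite !big_geq // cards0.
rewrite !big_nat_recr //= cardsU IH cardsX (_ : _ :&: _ = finset.set0) ?cards0 ?subn0 //.
apply/setP => -[a b]; rewrite !inE; apply/negP => /andP[+ /andP[/andP[_ /eqP sa] _]].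
rewrite big_mkord => /bigcupP[i _]; rewrite !inE => /andP[/andP[_ /eqP sa'] _].
by have := ltn_ord i; rewrite -sa' sa ltnn.
Qed.

Definition distinct5 i := if (5 %| i.+1)%N then 1 else 1 + fpsX i.+1.

(** The product formula of Andrews and Paule. Vertex [i] of the chain is second in
    its layer when [i] is 2 or 4 modulo 5, and in the chain that starts at vertex 1
    when [i] is 1 or 3 modulo 5: together, [1 + X^i] occurs once for every [i] that
    is not divisible by 5. *)
Lemma Delta2_product : Delta2_fps = fprod distinct5 * (qinv 1 1 * qinv 1 1).
Proof.
pose F1 i := if second layer1 i.+1 then 1 + fpsX i.+1 else 1 : fps.
pose F2 i := if second layer2 i.+1 then 1 + fpsX i.+1 else 1 : fps.
have add1 i : eqm i.+1 (1 + fpsX i.+1) 1.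
  rewrite -[X in eqm _ _ X]addr0; apply: eqmD => //; exact: eqm_fpsX.
have p1 : prodable F1 by move=> i; rewrite /F1; case: ifP.
have p2 : prodable F2 by move=> i; rewrite /F2; case: ifP.
have -> : fprod distinct5 = fprod F1 * fprod F2.
  rewrite fprodM //; congr fprod; apply/funext => i.
  rewrite /distinct5 /F1 /F2 /second /= /layer1 /layer2 !layer_second.
  have : (i.+1 %% 5 < 5)%N by rewrite ltn_mod.
  have : (i.+2 %% 5 = (i.+1 %% 5).+1 %% 5)%N by lia.
  by rewrite /dvdn => ->; case: (i.+1 %% 5)%N => [|[|[|[|[|]]]]] //= _; rewrite ?mulr1 ?mul1r.
have pg : prodable (fun i => geo (1 + 1 * i)) by apply: prodable_geo.
have seriesE l V : (forall i, l i.+1 = l i \/ l i.+1 = (l i).+1) ->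
    (forall i, l i.+2 <> l i) ->
    labelling_series l V = (\prod_(0 <= i < V.-1) (if second l i.+1 then 1 + fpsX i.+1 else 1))
        * \prod_(0 <= i < V) geo (1 + 1 * i).
  move=> h1 h2; rewrite labelling_seriesE // big_split /=; congr (_ * _); last first.
    by apply: eq_bigr => i _; rewrite mul1n.
  by case: V => [|V]; [rewrite !big_geq|rewrite big_nat_recl //= mul1r].
apply: fpsP => N; rewrite Delta2_labellings.
rewrite (seriesE layer1 _ layer_step layer_two).
rewrite (seriesE layer2 _ (fun i => layer_step i.+1) (fun i => layer_two (i := i.+1))).
rewrite (mulrACA (fprod F1)).
suff h : forall l V, (N <= V.-1)%N ->
   prodable (fun i => if second l i.+1 then 1 + fpsX i.+1 else 1) ->
   eqm N.+1 ((\prod_(0 <= i < V.-1) (if second l i.+1 then 1 + fpsX i.+1 else 1)) *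
     \prod_(0 <= i < V) geo (1 + 1 * i))
     (fprod (fun i => if second l i.+1 then 1 + fpsX i.+1 else 1) * qinv 1 1).
  by apply: (eqmM (h _ _ _ p1) (h _ _ _ p2)) => //; lia.
move=> l V NV pl; apply: eqmM; apply: eqm_sym.
  by apply: (@eqm_le _ V.-1.+1) => //; apply: fprod_partial.
by apply: (@eqm_le _ V.+1); [lia|apply: fprod_partial].
Qed.

Section DeltaSeries.
Variable K : numFieldType.
Hypothesis hK : disc_analysis K.

Lemma goodprod_distinct5 : goodprod K distinct5.
Proof.
split.
  move=> i; rewrite /distinct5; case: ifP => // _.
  by rewrite -[X in eqm _ _ X]addr0; apply: eqmD => //; apply: eqm_fpsX.
move=> t /[dup] /andP[t0 t1] t01; exists 1 => // i; rewrite mul1r /distinct5.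
have t0' := ltW t0.
case: ifP => _; first by apply: bnd_le (bnd1 t0'); rewrite lerDl exprn_ge0.
apply: bnd_le (bndD t0' (bnd1 t0') (bndX i.+1 t0')).
by rewrite lerD2l expr_le_shift.
Qed.

Lemma good_Delta2 : good K Delta2_fps.
Proof.
rewrite Delta2_product; apply: goodM; last by apply: goodM; apply: good_qinv.
exact/good_fprod/goodprod_distinct5.
Qed.

Lemma ev_Delta2 (q : K) : `|q| < 1 ->
  ev Delta2_fps q =
  euler (q ^+ 2) * euler (q ^+ 5) / (euler q ^+ 3 * euler (q ^+ 10)).
Proof.
move=> q1; have gi : good K (qinv 1 1) by apply: good_qinv.
have gd : good K (fprod distinct5) by apply/good_fprod/goodprod_distinct5.
have e0 : euler q != 0 by apply: euler_neq0.
have e10 : euler (q ^+ 10) != 0 by rewrite euler_neq0 // norm_exprn_lt1.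
have -> : ev Delta2_fps q = ev (fprod distinct5) q * (ev (qinv 1 1) q * ev (qinv 1 1) q).
  by rewrite Delta2_product !evM //; apply: goodM.
have hinv : euler q * ev (qinv 1 1) q = 1.
  have := @qpoch_ev K hK 1 1 q isT isT q1; rewrite expr1 -/(euler q) => ->.
  by rewrite -evM ?qprodK ?ev1 //; apply: good_qprod.
have -> : ev (qinv 1 1) q = (euler q)^-1.
  by apply: (mulfI e0); rewrite hinv divff.
suff h : ev (fprod distinct5) q * euler q * euler (q ^+ 10) = euler (q ^+ 2) * euler (q ^+ 5).
  rewrite -h; field; exact/andP.
pose P x N : K := \prod_(0 <= n < N) (1 - x ^+ n.+1).
have tP x : `|x| < 1 -> tends (P x) (euler x).
  move=> x1; have := @qpoch_tends K hK 1 1 x isT isT x1; rewrite expr1 -/(euler x).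
  by apply: tends_eq => N; apply: eq_bigr => n _; rewrite mul1n.
have five N : (N <= N * 5)%N by rewrite leq_pmulr.
have evd i : ev (distinct5 i) q = if (5 %| i.+1)%N then 1 else 1 + q ^+ i.+1.
  rewrite /distinct5; case: ifP => _; first exact: ev1.
  by rewrite evD ?ev1 ?evX //; [exact: good1|exact: goodX].
pose D N : K := \prod_(0 <= i < N) (if (5 %| i.+1)%N then 1 else 1 + q ^+ i.+1).
have tD : tends D (ev (fprod distinct5) q).
  apply: tends_eq (ev_fprod hK goodprod_distinct5 q1) => N.
  by apply: eq_bigr => i _; rewrite evd.
have n2 := tP _ (norm_exprn_lt1 q1 (isT : (0 < 2)%N)).
have n5 := tP _ (norm_exprn_lt1 q1 (isT : (0 < 5)%N)).
have n10 := tP _ (norm_exprn_lt1 q1 (isT : (0 < 10)%N)).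
have L := tendsM (tendsM (tends_sub five tD) (tends_sub five (tP _ q1))) n10.
apply: tends_unique L _; apply: tends_eq (tendsM (tends_sub five n2) n5) => N.
elim: N => [|N IH]; first by rewrite /P /D !big_geq // !mulr1.
have block x : P x (N.+1 * 5)%N = P x (N * 5)%N *
    ((1 - x ^+ (N * 5).+1) * (1 - x ^+ (N * 5).+2) * (1 - x ^+ (N * 5).+3)
     * (1 - x ^+ (N * 5).+4) * (1 - x ^+ (N * 5).+4.+1)).
  by rewrite mulSn addnC /P !addnS addn0 !big_nat_recr //= !mulrA.
have blockD : D (N.+1 * 5)%N = D (N * 5)%N *
    ((1 + q ^+ (N * 5).+1) * (1 + q ^+ (N * 5).+2) * (1 + q ^+ (N * 5).+3)
     * (1 + q ^+ (N * 5).+4)).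
  have d1 : (5 %| (N * 5).+1)%N = false by lia.
  have d2 : (5 %| (N * 5).+2)%N = false by lia.
  have d3 : (5 %| (N * 5).+3)%N = false by lia.
  have d4 : (5 %| (N * 5).+4)%N = false by lia.
  have d5 : (5 %| (N * 5).+4.+1)%N by lia.
  rewrite mulSn addnC /D !addnS addn0 !big_nat_recr //=.
  by rewrite d1 d2 d3 d4 d5 mulr1 !mulrA.
have blockS x : P x N.+1 = P x N * (1 - x ^+ N.+1) by rewrite /P big_nat_recr.
rewrite !block blockD !blockS.
have sq m : 1 - (q ^+ 2) ^+ m = (1 - q ^+ m) * (1 + q ^+ m).
  by rewrite exprAC; ring.
have e1 : (q ^+ 5) ^+ N.+1 = q ^+ (N * 5).+4.+1 by rewrite -exprM; congr (_ ^+ _); lia.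
have e2 : (q ^+ 10) ^+ N.+1 = (q ^+ 2) ^+ (N * 5).+4.+1 by rewrite -!exprM; congr (_ ^+ _); lia.
rewrite e1 e2 !sq.
move: IH; move: (P (q ^+ 2) _) (P (q ^+ 5) _) (D _) (P q _) (P (q ^+ 10) _) => a b c d e IH.
move: (q ^+ (N * 5).+1) (q ^+ (N * 5).+2) (q ^+ (N * 5).+3) (q ^+ (N * 5).+4).
move: (q ^+ (N * 5).+4.+1) => x5 x1 x2 x3 x4.
transitivity ((a * b) * ((1 - x5) * (1 + x5) * (1 - x4) * (1 + x4) * (1 - x3) * (1 + x3) *
   (1 - x2) * (1 + x2) * (1 - x1) * (1 + x1) * (1 - x5))); first by ring.
by rewrite IH; ring.
Qed.

End DeltaSeries.

(** * Averages over fifth roots of unity as polynomials *)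

(** Polynomials as lists of coefficients in increasing degree. The binary
    integers [Z] make computation with them feasible. *)
Fixpoint padd (p r : seq Z) : seq Z :=
  match p, r with
  | [::], _ => r
  | _, [::] => p
  | a :: p', b :: r' => Z.add a b :: padd p' r'
  end.
Definition pscale (c : Z) (p : seq Z) : seq Z := map (Z.mul c) p.
Fixpoint pmul (p r : seq Z) : seq Z :=
  if p is a :: p' then padd (pscale a r) (Z0 :: pmul p' r) else [::].
Fixpoint ppow (p : seq Z) n : seq Z := if n is n'.+1 then pmul p (ppow p n') else [:: Zpos 1].
Fixpoint pzero (p : seq Z) : bool := if p is a :: p' then Z.eqb a Z0 && pzero p' else true.
Definition peq (p r : seq Z) : bool := pzero (padd p (pscale (Zneg 1) r)).

(** The polynomial [P] such that [X^r P(X^5)] is the part of degree [r] modulo 5. *)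
Fixpoint psection r (p : seq Z) : seq Z :=
  if p is a :: p' then
    if r is r'.+1 then psection r' p' else a :: psection 4 p'
  else [::].

(** Polynomials in [a^5] whose coefficients are polynomials in [k]. *)
Fixpoint madd (p r : seq (seq Z)) : seq (seq Z) :=
  match p, r with
  | [::], _ => r
  | _, [::] => p
  | a :: p', b :: r' => padd a b :: madd p' r'
  end.

Definition one_plus : seq Z := [:: Zpos 1; Zpos 1].
Definition one_minus : seq Z := [:: Zpos 1; Zneg 1].

(** Numerator and denominator, in the variable [k], of the value of such a
    polynomial at [a^5 = k ((1 - k) / (1 + k))^2]. *)
Fixpoint homog (M : seq (seq Z)) : seq Z * seq Z :=
  if M is m :: M' then
    let PD := homog M' in
    let D := pmul (ppow one_plus 2) PD.2 in
    (padd (pmul m D) (Z0 :: pmul (ppow one_minus 2) PD.1), D)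
  else ([::], [:: Zpos 1]).

(** The rows of the part of [A(a) V(a^2 (1 + k) / (1 - k))] whose degree in [a]
    is [r] modulo 5, as polynomials in [k], after multiplication by
    [(1 - k)^m]; [l] counts the coefficients of [V] that are already used. *)
Fixpoint mixed r (A V : seq Z) m l : seq (seq Z) :=
  if V is v :: V' then
    let U := pmul (ppow one_plus l) (ppow one_minus (m - l)%N) in
    madd (map (fun c => pscale (Z.mul v c) U) (psection r A))
         (mixed r [:: Z0, Z0 & A] V' m l.+1)
  else [::].

Definition adj_poly : seq Z :=
  [:: Zpos 1; Zpos 1; Zpos 2; Zpos 3; Zpos 5; Zneg 3; Zpos 2; Zneg 1; Zpos 1].
Definition dissect_poly : seq Z := [:: Zpos 1; Zneg 1; Zneg 1].

(** The part of degree [r] modulo 5 in [a] of the products that [component_sum]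
    averages; the powers of [a] and [b] in their denominators are left out. *)
Definition component r n m : seq Z * seq Z :=
  homog (mixed r (ppow adj_poly n) (ppow dissect_poly m) m.*2 0).

Lemma size_padd p r : size (padd p r) = maxn (size p) (size r).
Proof. by elim: p r => [|x p IH] [|y r] //=; rewrite ?max0n ?maxn0 // IH maxnSS. Qed.

Lemma size_dissect_pow m : size (ppow dissect_poly m) = m.*2.+1.
Proof.
elim: m => // m IH; rewrite /=; do 3![rewrite ?(size_padd, size_map) /=].
by rewrite IH; lia.
Qed.

Section ListEval.
Variable F : comNzRingType.
Implicit Types (x y : F) (p r : seq Z).

Definition zval (c : Z) : F := (int_of_Z c)%:~R.
Definition peval p x : F := foldr (fun c acc => zval c + x * acc) 0 p.
Definition meval (M : seq (seq Z)) x y : F := foldr (fun c acc => peval c x + y * acc) 0 M.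

Lemma zvalD a b : zval (Z.add a b) = zval a + zval b.
Proof. by rewrite /zval (rmorphD int_of_Z) intrD. Qed.
Lemma zvalM a b : zval (Z.mul a b) = zval a * zval b.
Proof. by rewrite /zval (rmorphM int_of_Z) intrM. Qed.

Lemma peval_add p r x : peval (padd p r) x = peval p x + peval r x.
Proof.
elim: p r => [|a p IH] [|b r] /=; rewrite ?add0r ?addr0 //.
by rewrite zvalD IH; ring.
Qed.
Lemma peval_scale c p x : peval (pscale c p) x = zval c * peval p x.
Proof. by elim: p => [|a p IH] /=; rewrite ?mulr0 // zvalM IH; ring. Qed.
Lemma peval_mul p r x : peval (pmul p r) x = peval p x * peval r x.
Proof.
elim: p => [|a p IH] /=; first by rewrite mul0r.
by rewrite peval_add peval_scale /= IH; rewrite /zval /=; ring.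
Qed.
Lemma peval_pow p n x : peval (ppow p n) x = peval p x ^+ n.
Proof.
elim: n => [|n IH] /=; first by rewrite mulr0 addr0 expr0.
by rewrite peval_mul IH exprS.
Qed.
Lemma peval_zero p x : pzero p -> peval p x = 0.
Proof.
by elim: p => //= a p IH /andP[/Z.eqb_eq -> /IH ->]; rewrite mulr0 addr0.
Qed.
Lemma peval_eq p r x : peq p r -> peval p x = peval r x.
Proof.
move=> /(peval_zero x); rewrite peval_add peval_scale => h.
apply/eqP; rewrite -subr_eq0 -[X in _ == X]h; apply/eqP; rewrite /zval /=; ring.
Qed.
Lemma meval_add M M' x y : meval (madd M M') x y = meval M x y + meval M' x y.
Proof.
elim: M M' => [|a p IH] [|b r] /=; rewrite ?add0r ?addr0 //.
by rewrite peval_add IH; ring.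
Qed.
Lemma meval_map v u p x y :
  meval (map (fun c => pscale (Z.mul v c) u) p) x y = zval v * peval u x * peval p y.
Proof.
elim: p => [|a p IH] /=; first by rewrite mulr0.
by rewrite IH peval_scale zvalM; ring.
Qed.

End ListEval.

Section Component.
Variable F : numClosedFieldType.
Variables (a b k : F).
Hypothesis k_plus : 1 + k != 0.
Hypothesis k_minus : 1 - k != 0.
Hypothesis ab2 : a * b ^+ 2 = k.
Hypothesis ab : b * (1 - k) = a ^+ 2 * (1 + k).
Hypothesis k0 : k != 0.

Let s := (1 + k) / (1 - k).

Lemma rel_a0 : a != 0.
Proof. by apply/eqP => a0; move: k0; rewrite -ab2 a0 mul0r eqxx. Qed.

Lemma rel_b : b = a ^+ 2 * s.
Proof. by rewrite /s mulrA -ab mulfK. Qed.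

Lemma rel_a5 : a ^+ 5 = k * ((1 - k) / (1 + k)) ^+ 2.
Proof.
have s0 : s != 0 by rewrite mulf_neq0 ?invr_neq0.
apply: (mulIf (expf_neq0 2 s0)); transitivity k.
  by rewrite -[RHS]ab2 rel_b; ring.
by rewrite /s; field; rewrite k_plus k_minus.
Qed.

Lemma peval_plus n : peval (ppow one_plus n) k = (1 + k) ^+ n.
Proof. by rewrite peval_pow /= mulr0 addr0 mulr1. Qed.
Lemma peval_minus n : peval (ppow one_minus n) k = (1 - k) ^+ n.
Proof. by rewrite peval_pow /= mulr0 addr0 mulrN1. Qed.

Lemma homogE M : peval (homog M).2 k = (1 + k) ^+ (2 * size M)%N /\
  meval M k (a ^+ 5) = peval (homog M).1 k / (1 + k) ^+ (2 * size M)%N.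
Proof.
elim: M => [|m M [IH1 IH2]].
  by rewrite /= mul0r expr0 mulr0 addr0.
set D := pmul (ppow one_plus 2) (homog M).2.
have -> : (homog (m :: M)).1 =
  padd (pmul m D) (Z0 :: pmul (ppow one_minus 2) (homog M).1) by [].
have -> : (homog (m :: M)).2 = D by [].
have eD : peval D k = (1 + k) ^+ (2 * size (m :: M))%N.
  by rewrite peval_mul peval_plus IH1 -exprD [size _]/= mulnS.
split; first exact: eD.
have -> : meval (m :: M) k (a ^+ 5) = peval m k + a ^+ 5 * meval M k (a ^+ 5) by [].
have eZ : peval (Z0 :: pmul (ppow one_minus 2) (homog M).1) k =
          k * ((1 - k) ^+ 2 * peval (homog M).1 k).
  by rewrite -peval_minus -peval_mul /= add0r.
rewrite peval_add eZ peval_mul eD IH2 rel_a5 [size _]/= mulnS exprD.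
have n0 : (1 + k) ^+ (2 * size M)%N != 0 by rewrite expf_neq0.
move: (peval (homog M).1 k) (peval m k) n0; move: ((1 + k) ^+ (2 * size M)%N).
by move=> d x y d0; field; rewrite k_plus d0.
Qed.

Variable z : F.
Hypothesis hz : zeta5 z.

Lemma psection_sum r e (A : seq Z) : (r < 5)%N -> (5 %| r + e)%N ->
  \sum_(j < 5) (z ^+ j) ^+ e * peval A (z ^+ j * a) =
  5 * a ^+ r * peval (psection r A) (a ^+ 5).
Proof.
have z5 := zeta5_expr5 hz.
have zero (i e' : nat) : \sum_(j < 5) (z ^+ j) ^+ e' * (z ^+ j * a) ^+ i =
    if (5 %| i + e')%N then 5 * a ^+ i else 0.
  transitivity (a ^+ i * \sum_(j < 5) (z ^+ j) ^+ (i + e')).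
    rewrite mulr_sumr; apply: eq_bigr => j _; rewrite exprMn exprD; ring.
  by rewrite zeta5_sum //; case: ifP; rewrite ?mulr0 // mulrC.
elim: A r e => [|c A IH] r e r5 re.
  by rewrite /= mulr0 big1 // => j _; rewrite mulr0.
have -> : \sum_(j < 5) (z ^+ j) ^+ e * peval (c :: A) (z ^+ j * a) =
   zval F c * (\sum_(j < 5) (z ^+ j) ^+ e * (z ^+ j * a) ^+ 0) +
   a * \sum_(j < 5) (z ^+ j) ^+ e.+1 * peval A (z ^+ j * a).
  rewrite !mulr_sumr -big_split; apply: eq_bigr => j _ /=.
  by rewrite expr0 exprS; ring.
rewrite zero add0n; case: r r5 re => [_ re|r r5 re].
  have e5 : (5 %| e)%N by [].
  by rewrite e5 (IH 4%N) // expr0 /=; ring.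
have -> : (5 %| e)%N = false by lia.
by rewrite (IH r) ?addnS -?addSn ?(ltnW r5) // mulr0 add0r /= (exprS a r); ring.
Qed.

Lemma mixed_sum r e (A V : seq Z) m l : (r < 5)%N -> (5 %| r + e)%N ->
  (l + size V <= m.+1)%N ->
  \sum_(j < 5) (z ^+ j) ^+ e * peval A (z ^+ j * a) * peval V ((z ^+ j) ^+ 2 * b)
    * s ^+ l * (1 - k) ^+ m =
  5 * a ^+ r * meval (mixed r A V m l) k (a ^+ 5).
Proof.
move=> r5 re; elim: V A l => [|v V IH] A l lm /=.
  by rewrite mulr0 big1 // => j _; rewrite mulr0 !mul0r.
rewrite meval_add meval_map mulrDr -IH; last by rewrite addSnnS.
transitivity (zval F v * s ^+ l * (1 - k) ^+ m *
   (\sum_(j < 5) (z ^+ j) ^+ e * peval A (z ^+ j * a)) +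
   \sum_(j < 5) (z ^+ j) ^+ e * peval [:: Z0, Z0 & A] (z ^+ j * a)
     * peval V ((z ^+ j) ^+ 2 * b) * s ^+ l.+1 * (1 - k) ^+ m).
  rewrite mulr_sumr -big_split; apply: eq_bigr => j _ /=.
  by rewrite rel_b (exprS s) [zval F 0]/zval /=; ring.
rewrite (psection_sum _ r5 re) peval_mul peval_plus peval_minus; congr (_ + _).
have lm' : (l <= m)%N by move: lm => /=; lia.
have -> : (1 - k) ^+ m = (1 - k) ^+ l * (1 - k) ^+ (m - l) by rewrite -exprD subnKC.
have -> : (1 + k) ^+ l = s ^+ l * (1 - k) ^+ l by rewrite -exprMn /s divfK.
by ring.
Qed.

Lemma peval_dissect (x : F) : x != 0 -> dissect x = x^-1 * peval dissect_poly x.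
Proof. by move=> x0; rewrite /dissect /zval /=; field. Qed.

(** By [dissect_adjE] and [dissect_norm], the product of the conjugates of
    [dissect x] other than itself. *)
Definition dissect_adj (x : F) := x ^- 4 * peval adj_poly x.

Lemma dissect_adjE (x : F) : x != 0 -> dissect x * dissect_adj x = x ^- 5 - 11 - x ^+ 5.
Proof. by move=> x0; rewrite /dissect /dissect_adj /zval /=; field. Qed.

(** [dissect] is invariant under the involution [x |-> -1/x], hence its norm and
    [dissect_adj] are. *)
Lemma dissect_opp (x : F) : x != 0 -> dissect (- x^-1) = dissect x.
Proof. by move=> x0; rewrite /dissect; field. Qed.

Lemma dissect_adj_opp (x : F) : x != 0 -> dissect_adj (- x^-1) = dissect_adj x.
Proof. by move=> x0; rewrite /dissect_adj /zval /=; field. Qed.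

Lemma rel_b0 : b != 0.
Proof. by apply/eqP => b0; move: k0; rewrite -ab2 b0 expr0n mulr0 eqxx. Qed.

Lemma conjugate_term (c : F) e n m : c ^+ 5 = 1 ->
  c ^+ e * dissect_adj (c * a) ^+ n * dissect (c ^+ 2 * b) ^+ m =
  c ^+ (e + 16 * n + 8 * m) * peval (ppow adj_poly n) (c * a)
  * peval (ppow dissect_poly m) (c ^+ 2 * b) / (a ^+ (4 * n) * b ^+ m).
Proof.
move=> c5; have a0 := rel_a0; have b0 := rel_b0.
have c0 : c != 0 by apply/eqP => c0; move: c5; rewrite c0 expr0n => /eqP; rewrite eq_sym oner_eq0.
have -> : c ^+ (e + 16 * n + 8 * m) = c ^+ e * (c ^+ 16) ^+ n * (c ^+ 8) ^+ m.
  by rewrite -!exprM -!exprD.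
rewrite !peval_pow peval_dissect ?mulf_neq0 ?expf_neq0 // /dissect_adj.
have -> : (c * a) ^- 4 = c ^+ 16 * (a ^+ 4)^-1.
  have -> : c ^+ 16 = c ^+ 5 * c ^+ 5 * c ^+ 5 * c by ring.
  rewrite c5; apply: (mulfI (expf_neq0 4 c0)).
  transitivity ((a ^+ 4)^-1); first by field; rewrite a0 c0.
  by transitivity (c ^+ 5 * (a ^+ 4)^-1); [rewrite c5 mul1r|ring].
have -> : (c ^+ 2 * b)^-1 = c ^+ 8 * b^-1.
  have -> : c ^+ 8 = c ^+ 5 * c ^+ 3 by ring.
  rewrite c5 mul1r; apply: (mulfI (expf_neq0 2 c0)).
  transitivity (b^-1); first by field; rewrite b0 c0.
  by transitivity (c ^+ 5 * b^-1); [rewrite c5 mul1r|ring].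
have a40 : a ^+ 4 != 0 by rewrite expf_neq0.
rewrite (exprM a 4%N); move: (peval _ _) (peval _ _) (c ^+ e) a40.
move: (c ^+ 16) (c ^+ 8) (a ^+ 4) => x1 x2 x3 x4 x5 x6 x30.
rewrite !exprMn !exprVn.
have n1 : x3 ^+ n != 0 by rewrite expf_neq0.
have n2 : b ^+ m != 0 by rewrite expf_neq0.
by field; rewrite n1 n2.
Qed.

(** By the relations between [a], [b] and [k], only [b = a^2 s] and [a^5] occur
    once the average has selected a residue class of degrees in [a]. *)
Lemma component_sum r e n m : (r < 5)%N -> (5 %| r + e + 16 * n + 8 * m)%N ->
  \sum_(j < 5) (z ^+ j) ^+ e * dissect_adj (z ^+ j * a) ^+ n
                * dissect ((z ^+ j) ^+ 2 * b) ^+ m =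
  5 * a ^+ r / (a ^+ (4 * n) * b ^+ m)
  * peval (component r n m).1 k
  / ((1 - k) ^+ m.*2 *
     (1 + k) ^+ (2 * size (mixed r (ppow adj_poly n) (ppow dissect_poly m) m.*2 0))).
Proof.
move=> r5 re; have z5 := zeta5_expr5 hz; have a0 := rel_a0.
have b0 := rel_b0.
set N := size _; have re' : (5 %| r + (e + 16 * n + 8 * m))%N by move: re; rewrite -!addnA.
have := @mixed_sum r (e + 16 * n + 8 * m) (ppow adj_poly n) (ppow dissect_poly m) m.*2 0 r5 re'.
rewrite size_dissect_pow leqnn => /(_ isT).
have [_ ->] := homogE (mixed r (ppow adj_poly n) (ppow dissect_poly m) m.*2 0).
rewrite -/N -/(component r n m) => h.
have mn0 : (1 - k) ^+ m.*2 != 0 by rewrite expf_neq0.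
have an0 : a ^+ (4 * n) != 0 by rewrite expf_neq0.
have bn0 : b ^+ m != 0 by rewrite expf_neq0.
have pn0 : (1 + k) ^+ (2 * N) != 0 by rewrite expf_neq0.
transitivity ((\sum_(j < 5) (z ^+ j) ^+ (e + 16 * n + 8 * m) *
    peval (ppow adj_poly n) (z ^+ j * a) *
    peval (ppow dissect_poly m) ((z ^+ j) ^+ 2 * b) * s ^+ 0 * (1 - k) ^+ m.*2)
    / (a ^+ (4 * n) * b ^+ m * (1 - k) ^+ m.*2)); last first.
  rewrite h; move: (peval _ _) mn0 an0 bn0 pn0 => P.
  move: (a ^+ (4 * n)) (b ^+ m) (a ^+ r) ((1 - k) ^+ m.*2) ((1 + k) ^+ (2 * N)).
  by move=> x1 x2 x3 x4 x5 n1 n2 n3 n4; field; rewrite n1 n2 n3 n4.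
rewrite mulr_suml; apply: eq_bigr => j _.
have c5 : (z ^+ j) ^+ 5 = 1 by rewrite exprAC z5 expr1n.
rewrite (conjugate_term _ _ _ c5) expr0 mulr1.
move: (_ * peval _ _ * peval _ _) mn0 an0 bn0 => x.
move: (a ^+ (4 * n)) (b ^+ m) ((1 - k) ^+ m.*2) => x1 x2 x3 n1 n2 n3.
by field; rewrite n1 n2 n3.
Qed.

End Component.

(** * The averages for the progressions modulo 5 and 25 *)

Section Witness.
Local Open Scope Z_scope.
(** The polynomial [S / 5] of the two progressions modulo 25: the quotient of
    [second_lhs] by the other factors of [second_rhs]. *)
Definition witness_poly : seq Z :=
  [:: 2089; 13133574; 6709184440; 930753578855; 52307344323750; 1457199255216492;
   22747904439168942; 215430048109030230; 1296651746588865525; 5011658880396186000;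
   11765506140483013080; 11991103216012898630; (-16410602408245105900);
   (-72767138936015934600); (-82235215381298900500); 42553662251396163520;
   211545300965172393045; 166357840641945030250; (-133387138521942982800);
   (-319772619890644185375); (-113124431645463630830); 213419101871116166020;
   234064469152531482850; (-6736197784500932450); (-151927653253635731375);
   (-81415714257026594276); 37071852321825347184; 54993623874155433140;
   (-2163642296520339720); (-1258464213856174000); 14707011130698435752;
   (-62008059219494198448); 14113996341812560555; 117739453542092703450;
   (-135807122775782377000); (-69521042791503325735); 258643421123868341290;
   (-120231195300349938700); (-201351682834377669550); 267559203330001047250;
   (-14806921197255393265); (-190386631438127674440); 135731726467431171000;
   17423831642523877350; (-74835637198278455500); 39899433283194152760; 15885912624150060;
   (-10840280572580821200); 6628297014844874775; (-2168532641002602250);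
   442344372387146496; (-57319515011711489); 4579411462623710; (-211558837418980);
   5104568966750; (-54710953222); 194129003; (-111780)].
(** The numerator of the norm of [dissect b], see [norm_val_b_k]. *)
Definition level_poly : seq Z := pmul [:: 1; -4; -1] (ppow [:: 1; 1; -1] 2).
(** The numerator of the generating function of Delta_2(5 n + 4), see
    [first_poly_val]. *)
Definition first_poly : seq Z := [:: 41; 204; 252; -228; -330; 228; 252; -204; 41].
(** The terms of [conj_series] after the average, with a common denominator: [X]
    stands for [level_poly], [U] and [V] for [1 - k] and [1 + k]. *)
Definition second_lhs (X U V P0 P1 P2 P3 P4 : seq Z) : seq Z :=
  padd (pscale 41 P0)
 (padd (pscale 204 (pmul (pmul X (pmul U V)) P1))
 (padd (pscale 416 (pmul (pmul (ppow X 2) (pmul (ppow U 2) (ppow V 2))) P2))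
 (padd (pscale 384 (0 :: pmul (pmul (ppow X 3) (pmul (ppow U 5) (ppow V 3))) P3))
       (pscale 256 (0 :: pmul (pmul (ppow X 4) (pmul (ppow U 6) (ppow V 4))) P4))))).
Definition second_rhs (X U V S : seq Z) : seq Z :=
  pscale 5 (pmul (pmul (ppow X 5) (pmul (ppow U 7) (ppow V 8))) S).
End Witness.

Lemma first_check :
  peq (component 4 3 1).1 (pmul (pmul level_poly (ppow one_plus 2)) first_poly).
Proof. by vm_compute. Qed.

Lemma second_check :
  peq (second_lhs level_poly one_minus one_plus (component 2 17 5).1 (component 1 16 4).1
         (component 0 15 3).1 (component 4 14 2).1 (component 3 13 1).1)
      (second_rhs level_poly one_minus one_plus witness_poly).
Proof. by vm_compute. Qed.

Section SecondEvaluation.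
Variables (F : comNzRingType) (y : F).
Let one : zval F 1 = 1. Proof. by []. Qed.

Lemma peval_first X V Q :
  peval (pmul (pmul X (ppow V 2)) Q) y = peval X y * peval V y ^+ 2 * peval Q y.
Proof. by rewrite !peval_mul /= one; ring. Qed.

Lemma peval_second_lhs X U V P0 P1 P2 P3 P4 :
  peval (second_lhs X U V P0 P1 P2 P3 P4) y =
  41 * peval P0 y + 204 * peval X y * (peval U y * peval V y) * peval P1 y
  + 416 * peval X y ^+ 2 * (peval U y ^+ 2 * peval V y ^+ 2) * peval P2 y
  + 384 * y * peval X y ^+ 3 * (peval U y ^+ 5 * peval V y ^+ 3) * peval P3 y
  + 256 * y * peval X y ^+ 4 * (peval U y ^+ 6 * peval V y ^+ 4) * peval P4 y.
Proof.
rewrite /second_lhs !(peval_add, peval_scale).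
have cons0 p : peval (Z0 :: p) y = y * peval p y by rewrite /= add0r.
have [c1 c2] : zval F 41 = 41 /\ zval F 204 = 204 by [].
have [c3 [c4 c5]] : zval F 416 = 416 /\ zval F 384 = 384 /\ zval F 256 = 256 by [].
by rewrite !cons0 !peval_mul /= one c1 c2 c3 c4 c5; ring.
Qed.

Lemma peval_second_rhs X U V S :
  peval (second_rhs X U V S) y = 5 * peval X y ^+ 5 * (peval U y ^+ 7 * peval V y ^+ 8) * peval S y.
Proof.
have c5 : zval F 5 = 5 by [].
by rewrite /second_rhs peval_scale !peval_mul /= one c5; ring.
Qed.

End SecondEvaluation.

Lemma peval_one_plus (F : comNzRingType) (x : F) : peval one_plus x = 1 + x.
Proof. by rewrite /= mulr0 addr0 mulr1. Qed.
Lemma peval_one_minus (F : comNzRingType) (x : F) : peval one_minus x = 1 - x.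
Proof. by rewrite /= mulr0 addr0 mulrN1. Qed.

Section Averages.
Variable F : numClosedFieldType.
Variables (a b k : F).
Hypothesis k_plus : 1 + k != 0.
Hypothesis k_minus : 1 - k != 0.
Hypothesis ab2 : a * b ^+ 2 = k.
Hypothesis ab : b * (1 - k) = a ^+ 2 * (1 + k).
Hypothesis k0 : k != 0.
Variable z : F.
Hypothesis hz : zeta5 z.

Let a0 := rel_a0 ab2 k0.
Let b0 := rel_b0 ab2 k0.

(** [component_sum] after elimination of [b] and [a^5]: what remains of the powers
    of [a] is [a^-f]. *)
Lemma component_sum_k r e n m d f N : (r < 5)%N -> (5 %| r + e + 16 * n + 8 * m)%N ->
  (r + f + 5 * d = 4 * n + 2 * m)%N ->
  size (mixed r (ppow adj_poly n) (ppow dissect_poly m) m.*2 0) = N ->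
  \sum_(j < 5) (z ^+ j) ^+ e * dissect_adj (z ^+ j * a) ^+ n
                * dissect ((z ^+ j) ^+ 2 * b) ^+ m =
  5 * a ^- f * peval (component r n m).1 k * (1 + k) ^+ (2 * d)
  / (k ^+ d * (1 - k) ^+ (2 * d + m) * (1 + k) ^+ (2 * N + m)).
Proof.
move=> r5 re rfd <-; rewrite (component_sum k_plus k_minus ab2 ab k0 hz r5 re).
set N' := size _; move: (peval _ _) => P.
have an0 : a ^+ f != 0 by rewrite expf_neq0.
have rn0 : a ^+ r != 0 by rewrite expf_neq0.
have e1 : a ^+ (4 * n) * b ^+ m =
   a ^+ r * a ^+ f * (k ^+ d * (1 - k) ^+ (2 * d)) * (1 + k) ^+ m
   / ((1 + k) ^+ (2 * d) * (1 - k) ^+ m).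
  have -> : b ^+ m = a ^+ (2 * m) * ((1 + k) ^+ m / (1 - k) ^+ m).
    by rewrite (rel_b k_minus ab) exprMn -exprM exprMn exprVn.
  have aE : a ^+ (5 * d) = k ^+ d * (1 - k) ^+ (2 * d) / (1 + k) ^+ (2 * d).
    rewrite exprM (rel_a5 k_plus k_minus ab2 ab) exprMn -exprM exprMn exprVn.
    by rewrite mulrA.
  rewrite mulrA -exprD -rfd (exprD _ (r + f)%N) (exprD _ r f) aE.
  have n1 : (1 + k) ^+ (2 * d) != 0 by rewrite expf_neq0.
  have n2 : (1 - k) ^+ m != 0 by rewrite expf_neq0.
  by field; rewrite n1 n2.
rewrite e1 -addnn (exprD _ m m) (exprD _ (2 * d)%N m) (exprD _ (2 * N')%N m); move: an0 rn0.
have n0 : k ^+ d != 0 by rewrite expf_neq0.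
have n1 : (1 + k) ^+ (2 * d) != 0 by rewrite expf_neq0.
have n2 : (1 - k) ^+ m != 0 by rewrite expf_neq0.
have n3 : (1 - k) ^+ (2 * d) != 0 by rewrite expf_neq0.
have n4 : (1 + k) ^+ m != 0 by rewrite expf_neq0.
have n5 : (1 + k) ^+ (2 * N') != 0 by rewrite expf_neq0.
move: n0 n1 n2 n3 n4 n5; move: (k ^+ d) ((1 + k) ^+ (2 * d)) ((1 - k) ^+ m).
move: ((1 - k) ^+ (2 * d)) ((1 + k) ^+ m) ((1 + k) ^+ (2 * N')) (a ^+ f) (a ^+ r).
move=> x1 x2 x3 x4 x5 x6 x7 x8 n1 n2 n3 n4 n5 n6 n7 n8.
by field; rewrite n1 n2 n3 n4 n5 n6 n7 n8.
Qed.

Let lev := peval level_poly k.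

Lemma first_average :
  \sum_(j < 5) dissect_adj (z ^+ j * a) ^+ 3 * dissect ((z ^+ j) ^+ 2 * b) =
  5 * lev * peval first_poly k / (k ^+ 2 * (1 - k) ^+ 5 * (1 + k) ^+ 5).
Proof.
have := @component_sum_k 4 0 3 1 2 0 5 isT isT erefl erefl.
under eq_bigr do rewrite expr0 mul1r expr1.
move=> ->; rewrite (peval_eq _ first_check) peval_first peval_one_plus -/lev.
move: lev (peval _ _) (1 + k) (1 - k) k_plus k_minus => x y v u v0 u0.
by field; rewrite k0 v0 u0.
Qed.

(** The value at a conjugate of [q] of the generating function of the numbers
    Delta_2(5 n + 4), up to an explicit factor ([ev_first_conj]). The coefficients
    41, 204, 416, 384, 256 are those of [first_series]. *)
Definition conj_series (w x y : F) :=
  41 * (dissect_adj x ^+ 17 * dissect y ^+ 5)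
  + 204 * w * (dissect_adj x ^+ 16 * dissect y ^+ 4)
  + 416 * w ^+ 2 * (dissect_adj x ^+ 15 * dissect y ^+ 3)
  + 384 * w ^+ 3 * (dissect_adj x ^+ 14 * dissect y ^+ 2)
  + 256 * w ^+ 4 * (dissect_adj x ^+ 13 * dissect y).

Lemma second_average (w : F) : w = lev / (k * (1 - k) ^+ 2 * (1 + k) ^+ 2) ->
  \sum_(j < 5) z ^+ j * conj_series w (z ^+ j * a) ((z ^+ j) ^+ 2 * b) =
  5 * a^-1 * (5 * peval witness_poly k) * lev ^+ 5
  / (k ^+ 15 * (1 - k) ^+ 28 * (1 + k) ^+ 29).
Proof.
move=> wE.
have h0 := @component_sum_k 2 1 17 5 15 1 31 isT isT erefl erefl.
have h1 := @component_sum_k 1 1 16 4 14 1 29 isT isT erefl erefl.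
have h2 := @component_sum_k 0 1 15 3 13 1 27 isT isT erefl erefl.
have h3 := @component_sum_k 4 1 14 2 11 1 24 isT isT erefl erefl.
have h4 := @component_sum_k 3 1 13 1 10 1 22 isT isT erefl erefl.
have -> : \sum_(j < 5) z ^+ j * conj_series w (z ^+ j * a) ((z ^+ j) ^+ 2 * b) =
  41 * (\sum_(j < 5) (z ^+ j) ^+ 1 * dissect_adj (z ^+ j * a) ^+ 17
                     * dissect ((z ^+ j) ^+ 2 * b) ^+ 5)
  + 204 * w * (\sum_(j < 5) (z ^+ j) ^+ 1 * dissect_adj (z ^+ j * a) ^+ 16
                     * dissect ((z ^+ j) ^+ 2 * b) ^+ 4)
  + 416 * w ^+ 2 * (\sum_(j < 5) (z ^+ j) ^+ 1 * dissect_adj (z ^+ j * a) ^+ 15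
                     * dissect ((z ^+ j) ^+ 2 * b) ^+ 3)
  + 384 * w ^+ 3 * (\sum_(j < 5) (z ^+ j) ^+ 1 * dissect_adj (z ^+ j * a) ^+ 14
                     * dissect ((z ^+ j) ^+ 2 * b) ^+ 2)
  + 256 * w ^+ 4 * (\sum_(j < 5) (z ^+ j) ^+ 1 * dissect_adj (z ^+ j * a) ^+ 13
                     * dissect ((z ^+ j) ^+ 2 * b) ^+ 1).
  rewrite !mulr_sumr -!big_split; apply: eq_bigr => j _ /=.
  rewrite /conj_series !expr1.
  move: (dissect_adj (z ^+ j * a)) (dissect ((z ^+ j) ^+ 2 * b)) (z ^+ j) => x y c.
  by ring.
rewrite h0 h1 h2 h3 h4 wE.
have := etrans (esym (peval_second_lhs k _ _ _ _ _ _ _ _))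
  (etrans (peval_eq k second_check) (peval_second_rhs k _ _ _ _)).
rewrite -/lev peval_one_plus peval_one_minus.
move: (peval (component 2 17 5).1 k) (peval (component 1 16 4).1 k) => P0 P1.
move: (peval (component 0 15 3).1 k) (peval (component 4 14 2).1 k) => P2 P3.
move: (peval (component 3 13 1).1 k) (peval witness_poly k) lev a0 => P4 S x an0.
move=> {h0 h1 h2 h3 h4}; move: (1 + k) (1 - k) k_plus k_minus => v u v0 u0 h.
transitivity (5 * a^-1 * (41 * P0 + 204 * x * (u * v) * P1
  + 416 * x ^+ 2 * (u ^+ 2 * v ^+ 2) * P2
  + 384 * k * x ^+ 3 * (u ^+ 5 * v ^+ 3) * P3
  + 256 * k * x ^+ 4 * (u ^+ 6 * v ^+ 4) * P4)
  / (k ^+ 15 * u ^+ 35 * v ^+ 37)); last first.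
  by rewrite h; field; rewrite k0 v0 u0.
by field; rewrite k0 v0 u0 an0.
Qed.
End Averages.

(** * The two progressions modulo 25 *)

Lemma level_poly_val (F : comNzRingType) (x : F) :
  peval level_poly x = (1 - 4 * x - x ^+ 2) * (1 + x - x ^+ 2) ^+ 2.
Proof. by rewrite /level_poly peval_mul peval_pow /zval /=; ring. Qed.

(** [first_poly] is a polynomial in the other Hauptmodul [k / (1 - k^2)], whose
    powers are eta quotients. *)
Lemma first_poly_val (F : fieldType) (k : F) : 1 + k != 0 -> 1 - k != 0 ->
  let H := k / ((1 - k) * (1 + k)) in
  peval first_poly k = ((1 - k) * (1 + k)) ^+ 4
    * (41 + 204 * H + 416 * H ^+ 2 + 384 * H ^+ 3 + 256 * H ^+ 4).
Proof.
move=> k_plus k_minus H; rewrite /first_poly /zval /= /H.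
by field; rewrite k_plus k_minus.
Qed.

Section Progressions.
Variable K : numClosedFieldType.
Hypothesis hK : disc_analysis K.

(** By [dissect_norm], the product of the conjugates of [dissect x]. *)
Definition norm_val (x : K) := x ^- 5 - 11 - x ^+ 5.

Lemma euler_dissect (q : K) : q != 0 -> `|q| < 1 ->
  euler q = euler ((q ^+ 5) ^+ 5) * (q * dissect (q * rrcf (q ^+ 5))).
Proof.
move=> q0 q1; rewrite {1}(euler_dissection hK q1); congr (_ * _).
have r0 : rrcf (q ^+ 5) != 0 by apply: (rrcf_neq0 hK); apply: norm_exprn_lt1.
by rewrite /dissect; move: (rrcf _) r0 => r r0; field; rewrite r0 q0.
Qed.

(** The product of the Euler products at the conjugates of [q] is computed by
    [euler_norm] and by [euler_dissect]. *)
Lemma norm_val_euler (q : K) : q != 0 -> `|q| < 1 ->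
  norm_val (q * rrcf (q ^+ 5)) =
  euler (q ^+ 5) ^+ 6 / (q ^+ 5 * euler ((q ^+ 5) ^+ 5) ^+ 6).
Proof.
move=> q0 q1; have [z hz] := @zeta5_exists K; have z5 := zeta5_expr5 hz.
have p1 : `|q ^+ 5| < 1 by apply: norm_exprn_lt1.
have r0 : rrcf (q ^+ 5) != 0 by apply: (rrcf_neq0 hK).
have e0 : euler ((q ^+ 5) ^+ 5) != 0 by apply/(euler_neq0 hK)/norm_exprn_lt1.
have z0 : z != 0 by apply/eqP => z0; move: z5; rewrite z0 expr0n => /eqP; rewrite eq_sym oner_eq0.
have pw (j : 'I_5) : (z ^+ j * q) ^+ 5 = q ^+ 5.
  by rewrite exprMn exprAC z5 expr1n mul1r.
have := euler_norm hK hz q1.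
under eq_bigr => j _.
  rewrite euler_dissect ?mulf_neq0 ?expf_neq0 // ?(norm_zeta _ _ hz) //.
  rewrite pw -(mulrA (z ^+ j) q (rrcf _)).
over.
rewrite !big_split /= !prodr_const card_ord (dissect_norm hz (mulf_neq0 q0 r0)).
have -> : \prod_(j < 5) z ^+ j = 1.
  rewrite !big_ord_recl big_ord0 /=.
  by transitivity ((z ^+ 5) ^+ 2); [ring|rewrite z5 expr1n].
rewrite (exprM q 5 5) -/(norm_val _) => <-.
by move: (euler _) (norm_val _) e0 => e x e0; field; rewrite e0 q0.
Qed.

Section Base.
Variables (p : K).
Hypotheses (p0 : p != 0) (p1 : `|p| < 1).
Let k := kparam p.
Let E n := euler (p ^+ n).

Lemma E_neq0 n : (0 < n)%N -> E n != 0.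
Proof. by move=> n0; apply/(euler_neq0 hK)/norm_exprn_lt1. Qed.

Lemma hauptmodul_ratio : k / ((1 - k) * (1 + k)) = p * E 1 * E 10 ^+ 5 / (E 2 * E 5 ^+ 5).
Proof.
rewrite /E expr1 (euler1_bracket hK p1) (euler2_bracket hK p1) (euler5_bracket hK p1).
rewrite /k (one_plus_k hK p1) (one_minus_k hK p1) (kparam_bracket hK p1).
move: (bracket_neq0 hK p1 (isT : (0 < 1 < 10)%N)) (bracket_neq0 hK p1 (isT : (0 < 2 < 10)%N)).
move: (bracket_neq0 hK p1 (isT : (0 < 3 < 10)%N)) (bracket_neq0 hK p1 (isT : (0 < 4 < 10)%N)).
move: (f_neq0 hK p1) (E_neq0 (isT : (0 < 10)%N)); rewrite /E.
move: (bracket p 1) (bracket p 2) (bracket p 3) (bracket p 4) (qpoch _ _) (euler _).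
by move=> a b c d x y nx ny nc nd na nb; field; rewrite na nb nc nd nx ny.
Qed.

Section Root.
Variables (q z : K).
Hypotheses (q5 : q ^+ 5 = p) (hz : zeta5 z).

Let a := q * rrcf p.
Let b := q ^+ 2 * rrcf (p ^+ 2).

Lemma q_neq0 : q != 0.
Proof. by apply: contraNneq p0 => q0; rewrite -q5 q0 expr0n. Qed.

Lemma norm_q : `|q| < 1.
Proof.
rewrite real_ltNge ?normr_real ?real1 //; apply/negP => h.
by have := exprn_ege1 5 h; rewrite -normrX q5 => /(lt_le_trans p1); rewrite ltxx.
Qed.
Let q0 := q_neq0.
Let q1 := norm_q.

Let k_plus : 1 + k != 0 := one_plus_k_neq0 hK p1.
Let k_minus : 1 - k != 0 := one_minus_k_neq0 hK p1.
Let k0 : k != 0 := kparam_neq0 hK p1 p0.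

Lemma rel_ab2 : a * b ^+ 2 = k.
Proof. by rewrite /k /kparam -q5 /a /b -q5; ring. Qed.

Lemma rel_ab : b * (1 - k) = a ^+ 2 * (1 + k).
Proof.
rewrite /b -mulrA (rrcf2_rrcf hK p1) /a; move: (rrcf p) => r; rewrite -/k; ring.
Qed.

Lemma norm_val_a : norm_val a = E 1 ^+ 6 / (p * E 5 ^+ 6).
Proof. by have := norm_val_euler q0 q1; rewrite q5 /E expr1. Qed.

Lemma norm_val_b : norm_val b = E 2 ^+ 6 / (p ^+ 2 * E 10 ^+ 6).
Proof.
have := norm_val_euler (expf_neq0 2 q0) (norm_exprn_lt1 q1 (isT : (0 < 2)%N)).
by rewrite (exprAC q) q5 -(exprM p 2 5) -/b -/(E 2) -/(E 10).
Qed.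

Lemma norm_val_b_k :
  norm_val b = peval level_poly k / (k ^+ 2 * ((1 - k) * (1 + k))).
Proof.
have b5 : b ^+ 5 = k ^+ 2 * ((1 + k) / (1 - k)).
  rewrite (rel_b k_minus rel_ab); transitivity ((a ^+ 5) ^+ 2 * ((1 + k) / (1 - k)) ^+ 5).
    by ring.
  rewrite (rel_a5 k_plus k_minus rel_ab2 rel_ab).
  by field; rewrite k_plus k_minus.
rewrite /norm_val b5 level_poly_val.
by field; rewrite k_plus k_minus k0.
Qed.

Lemma conj_euler (c : K) : c ^+ 5 = 1 ->
  [/\ euler (c * q) = E 5 * (c * q * dissect (c * a)),
      euler ((c * q) ^+ 2) = E 10 * ((c * q) ^+ 2 * dissect (c ^+ 2 * b)),
      euler ((c * q) ^+ 5) = E 1 & euler ((c * q) ^+ 10) = E 2].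
Proof.
move=> c5; have c0 : c != 0.
  by apply/eqP => c0; move: c5; rewrite c0 expr0n => /eqP; rewrite eq_sym oner_eq0.
have c1 : `|c| = 1 by apply/eqP; rewrite -(@pexpr_eq1 _ _ 5) // -normrX c5 normr1.
have x0 : c * q != 0 by rewrite mulf_neq0.
have x1 : `|c * q| < 1 by rewrite normrM c1 mul1r.
have x5 : (c * q) ^+ 5 = p by rewrite exprMn c5 mul1r.
have x10 : ((c * q) ^+ 2) ^+ 5 = p ^+ 2 by rewrite exprAC x5.
split; last 2 first.
- by rewrite x5 /E expr1.
- by rewrite (exprM _ 2 5) x10.
- by rewrite {1}(euler_dissect x0 x1) x5 -(mulrA c q (rrcf p)).
rewrite {1}(euler_dissect (expf_neq0 2 x0) (norm_exprn_lt1 x1 (isT : (0 < 2)%N))) x10.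
by rewrite -(exprM p 2 5) (exprMn _ c q) -(mulrA (c ^+ 2) (q ^+ 2) (rrcf _)).
Qed.

Lemma conj_norm (c : K) : c ^+ 5 = 1 -> dissect (c * a) * dissect_adj (c * a) = norm_val a.
Proof.
move=> c5; have c0 : c != 0.
  by apply/eqP => c0; move: c5; rewrite c0 expr0n => /eqP; rewrite eq_sym oner_eq0.
have a0 : a != 0 by apply: (rel_a0 rel_ab2 k0).
by rewrite (dissect_adjE (mulf_neq0 c0 a0)) (exprMn _ c a) c5 mul1r.
Qed.

Lemma norm_a_neq0 : norm_val a != 0.
Proof.
rewrite norm_val_a; apply: mulf_neq0; first by apply/expf_neq0/E_neq0.
by apply/invr_neq0/mulf_neq0 => //; apply/expf_neq0/E_neq0.
Qed.

Lemma conj_dissect_neq0 (c : K) : c ^+ 5 = 1 -> dissect (c * a) != 0.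
Proof.
move=> c5; apply: contraNneq norm_a_neq0 => h.
by rewrite -(conj_norm c5) h mul0r.
Qed.

Lemma conj_inv (c : K) : c ^+ 5 = 1 -> (dissect (c * a))^-1 = dissect_adj (c * a) / norm_val a.
Proof.
move=> c5; have n0 := conj_dissect_neq0 c5.
by apply: (mulfI n0); rewrite divff // mulrA (conj_norm c5) divff // norm_a_neq0.
Qed.

Let zj5 (j : nat) : (z ^+ j) ^+ 5 = 1.
Proof. by rewrite exprAC (zeta5_expr5 hz) expr1n. Qed.

(** The generating function of Delta_2(5 n + 4) at [p], with [Ej] the Euler product
    at [p^j] and [H = p E1 E10^5 / (E2 E5^5)]. *)
Definition first_series (E1 E2 E5 E10 H : K) : K :=
  E5 ^+ 15 * E2 ^+ 5 / (E1 ^+ 17 * E10 ^+ 5)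
  * (41 + 204 * H + 416 * H ^+ 2 + 384 * H ^+ 3 + 256 * H ^+ 4).

Lemma ev_first_root : ev (section5 4 Delta2_fps) p =
  first_series (E 1) (E 2) (E 5) (E 10) (p * E 1 * E 10 ^+ 5 / (E 2 * E 5 ^+ 5)).
Proof.
have e1 := E_neq0 (isT : (0 < 1)%N); have e2 := E_neq0 (isT : (0 < 2)%N).
have e5 := E_neq0 (isT : (0 < 5)%N); have e10 := E_neq0 (isT : (0 < 10)%N).
have term (j : 'I_5) : (z ^+ j) ^+ 1 * ev Delta2_fps (z ^+ j * q) =
    E 10 * E 1 / (q * E 5 ^+ 3 * E 2 * norm_val a ^+ 3)
    * (dissect_adj (z ^+ j * a) ^+ 3 * dissect ((z ^+ j) ^+ 2 * b)).
  have c0 : z ^+ j != 0.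
    by apply/eqP => c0; move: (zj5 j); rewrite c0 expr0n => /eqP; rewrite eq_sym oner_eq0.
  have [h1 h2 h5 h10] := conj_euler (zj5 j).
  rewrite (ev_Delta2 hK) ?(norm_zeta _ _ hz) ?q1 // h1 h2 h5 h10.
  have := conj_inv (zj5 j); have := conj_dissect_neq0 (zj5 j); move: norm_a_neq0.
  move: e1 e2 e5 e10 c0 q0; move: (E 1) (E 2) (E 5) (E 10) (z ^+ j) => x1 x2 x5 x10 c.
  move: (dissect_adj _) (norm_val a) (dissect (c ^+ 2 * _)) (dissect _) => A X e d.
  move=> n1 n2 n5 n10 c0 y0 X0 d0 h.
  transitivity (x10 * x1 / (q * x5 ^+ 3 * x2) * (d^-1 ^+ 3 * e)).
    by field; rewrite ?n2 ?n5 ?n10 ?c0 ?y0 ?d0.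
  by rewrite h; field; rewrite ?n2 ?n5 ?y0 ?X0.
have := ev_section5 hK hz (isT : (4 < 5)%N) (isT : (5 %| 4 + 1)%N) (good_Delta2 hK) q1 q0.
under eq_bigr do rewrite term.
rewrite -mulr_sumr (first_average k_plus k_minus rel_ab2 rel_ab k0 hz) q5 => h.
have lev : peval level_poly k =
    E 2 ^+ 6 / (p ^+ 2 * E 10 ^+ 6) * (k ^+ 2 * ((1 - k) * (1 + k))).
  by rewrite -norm_val_b norm_val_b_k; field; rewrite k_plus k_minus k0.
have five : 5 != 0 :> K by rewrite pnatr_eq0.
apply: (mulfI (mulf_neq0 (mulf_neq0 five (expf_neq0 4 q0)) q0)).
rewrite mulrAC -h -hauptmodul_ratio /first_series norm_val_a lev first_poly_val //.
have -> : 5 * q ^+ 4 * q = 5 * p by rewrite -q5; ring.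
move: e1 e2 e5 e10; move: (E 1) (E 2) (E 5) (E 10) (1 + k) (1 - k) k_plus k_minus (41 + _).
move=> x1 x2 x5 x10 u v u0 v0 y n1 n2 n5 n10.
by field; rewrite ?n1 ?n2 ?n5 ?n10 ?u0 ?v0 ?p0 ?q0 ?k0.
Qed.


End Root.
End Base.

Lemma ev_first (p : K) : p != 0 -> `|p| < 1 ->
  ev (section5 4 Delta2_fps) p =
  first_series (euler p) (euler (p ^+ 2)) (euler (p ^+ 5)) (euler (p ^+ 10))
    (p * euler p * euler (p ^+ 10) ^+ 5 / (euler (p ^+ 2) * euler (p ^+ 5) ^+ 5)).
Proof.
move=> p0 p1; have [q q5 _] := root5_exists p1; have [z hz] := @zeta5_exists K.
by rewrite (ev_first_root p0 p1 q5 hz) expr1.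
Qed.

End Progressions.

Section Second.
Variable K : numClosedFieldType.
Hypothesis hK : disc_analysis K.
Variables (p q z : K).
Hypotheses (p0 : p != 0) (p1 : `|p| < 1) (q5 : q ^+ 5 = p) (hz : zeta5 z).

Let k := kparam p.
Let E n := euler (p ^+ n).
Let a := q * rrcf p.
Let b := q ^+ 2 * rrcf (p ^+ 2).
Let q0 : q != 0 := q_neq0 p0 q5.
Let q1 : `|q| < 1 := norm_q p1 q5.
Let k_plus : 1 + k != 0 := one_plus_k_neq0 hK p1.
Let k_minus : 1 - k != 0 := one_minus_k_neq0 hK p1.
Let k0 : k != 0 := kparam_neq0 hK p1 p0.
Let ab2 : a * b ^+ 2 = k := rel_ab2 q5.
Let ab : b * (1 - k) = a ^+ 2 * (1 + k) := rel_ab hK p1 q.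
Let a0 : a != 0 := rel_a0 ab2 k0.
Let b0 : b != 0 := rel_b0 ab2 k0.

Let zj5 (j : nat) : (z ^+ j) ^+ 5 = 1.
Proof. by rewrite exprAC (zeta5_expr5 hz) expr1n. Qed.

(** At a conjugate of [q], the argument [H] of [first_series] is
    [weight / (dissect_adj x * dissect y)], in the notation of [conj_series]. *)
Definition weight := E 1 * E 2 ^+ 5 / (p * E 10 * E 5 ^+ 5).

Let lev : peval level_poly k = norm_val b * (k ^+ 2 * ((1 - k) * (1 + k))).
Proof. by rewrite (norm_val_b_k hK p0 p1 q5) -/k; field; rewrite k_plus k_minus k0. Qed.

Lemma weight_k : weight = peval level_poly k / (k * (1 - k) ^+ 2 * (1 + k) ^+ 2).
Proof.
have e1 := E_neq0 hK p1 (isT : (0 < 1)%N); have e2 := E_neq0 hK p1 (isT : (0 < 2)%N).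
have e5 := E_neq0 hK p1 (isT : (0 < 5)%N); have e10 := E_neq0 hK p1 (isT : (0 < 10)%N).
transitivity (norm_val b * (k / ((1 - k) * (1 + k)))).
  rewrite (norm_val_b hK p0 p1 q5) -/k (hauptmodul_ratio hK p1) /weight /E.
  rewrite -/(E 1) -/(E 2) -/(E 5) -/(E 10).
  move: e1 e2 e5 e10; rewrite -/(E 1) -/(E 2) -/(E 5) -/(E 10).
  move: (E 1) (E 2) (E 5) (E 10) => x1 x2 x5 x10.
  by move=> n1 n2 n5 n10; field; rewrite ?n1 ?n2 ?n5 ?n10 ?p0.
rewrite lev; move: (norm_val b) (1 + k) (1 - k) k_plus k_minus => x u v u0 v0.
by field; rewrite u0 v0 k0.
Qed.

(** What the value of [first_series] at a conjugate of [q] has in common for all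
    conjugates, except for a power of [q]. *)
Definition second_factor := E 1 ^+ 15 * E 10 ^+ 5 / (E 5 ^+ 17 * E 2 ^+ 5 * norm_val a ^+ 17).

Lemma ev_first_conj (c : K) : c ^+ 5 = 1 ->
  ev (section5 4 Delta2_fps) (c * q) =
  (c * q) ^- 7 * second_factor * conj_series weight (c * a) (c ^+ 2 * b).
Proof.
move=> c5.
have e1 := E_neq0 hK p1 (isT : (0 < 1)%N); have e2 := E_neq0 hK p1 (isT : (0 < 2)%N).
have e5 := E_neq0 hK p1 (isT : (0 < 5)%N); have e10 := E_neq0 hK p1 (isT : (0 < 10)%N).
have c0 : c != 0.
  by apply/eqP => c0; move: c5; rewrite c0 expr0n => /eqP; rewrite eq_sym oner_eq0.
have c1 : `|c| = 1 by apply/eqP; rewrite -(@pexpr_eq1 _ _ 5) // -normrX c5 normr1.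
have x1 : `|c * q| < 1 by rewrite normrM c1 mul1r.
have [h1 h2 h5 h10] := conj_euler hK p0 p1 q5 c5.
have eps0 : dissect (c ^+ 2 * b) != 0.
  have := euler_neq0 hK (norm_exprn_lt1 x1 (isT : (0 < 2)%N)).
  by apply: contraNneq; rewrite h2 => ->; rewrite !mulr0.
have := conj_inv hK p0 p1 q5 c5; have := conj_dissect_neq0 hK p0 p1 q5 c5.
have := norm_a_neq0 hK p0 p1 q5; have wE := norm_val_a hK p0 p1 q5.
rewrite (ev_first hK (mulf_neq0 c0 q0) x1) h1 h2 h5 h10.
rewrite -/a -/b in wE eps0 *; rewrite /first_series /second_factor /conj_series /weight.
move: wE e1 e2 e5 e10 c0 q0 eps0; rewrite -/(E 1) -/(E 2) -/(E 5) -/(E 10).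
move: (E 1) (E 2) (E 5) (E 10) => y1 y2 y5 y10.
rewrite -/a -/b.
move: (dissect_adj (c * a)) (norm_val a) (dissect (c ^+ 2 * b)) (dissect (c * a)) => A X e d.
move=> wE n1 n2 n5 n10 c0' q0' e0 X0 d0 h.
have w' : y1 * y2 ^+ 5 / (p * y10 * y5 ^+ 5) = y5 * y2 ^+ 5 / (y10 * y1 ^+ 5) * X.
  by rewrite wE; field; rewrite n1 n5 n10 p0.
have A' : A = X / d by rewrite mulrC h -mulrA mulVf // mulr1.
rewrite w' A' => {wE h w' A'}.
by field; rewrite ?n1 ?n2 ?n5 ?n10 ?c0' ?q0' ?e0 ?X0 ?d0.
Qed.

Let nonzero_data : [/\ E 1 != 0, E 2 != 0, E 5 != 0 & E 10 != 0].
Proof. by split; apply: (E_neq0 hK p1). Qed.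

Let five : 5 != 0 :> K. Proof. by rewrite pnatr_eq0. Qed.

(** The power [(c q)^-7] of [ev_first_conj] and the weight [c^3] of the average give
    [c^-4 = c], as in [second_average]. *)
Lemma ev_second_2_root : ev (section5 2 (section5 4 Delta2_fps)) p =
  p ^+ 5 * E 5 ^+ 85 * E 2 ^+ 25 / (E 1 ^+ 87 * E 10 ^+ 25 * rrcf p)
  * (5 * peval witness_poly k) / (k ^+ 5 * (1 - k) ^+ 23 * (1 + k) ^+ 24).
Proof.
have term (j : 'I_5) : (z ^+ j) ^+ 3 * ev (section5 4 Delta2_fps) (z ^+ j * q) =
    q ^- 7 * second_factor * (z ^+ j * conj_series weight (z ^+ j * a) ((z ^+ j) ^+ 2 * b)).
  rewrite ev_first_conj //; have c5 := zj5 j.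
  have c0 : z ^+ j != 0.
    by apply/eqP => c0; move: c5; rewrite c0 expr0n => /eqP; rewrite eq_sym oner_eq0.
  move: (z ^+ j) c0 c5 (conj_series _ _ _) second_factor => c c0 c5 x y.
  transitivity ((c ^+ 5)^-1 * c * q ^- 7 * y * x); first by field; rewrite c0 q0.
  by rewrite c5 invr1 mul1r; ring.
have gf : good K (section5 4 Delta2_fps) by apply/good_section5/good_Delta2.
have := ev_section5 hK hz (isT : (2 < 5)%N) (isT : (5 %| 2 + 3)%N) gf q1 q0.
under eq_bigr do rewrite term.
rewrite -mulr_sumr (second_average k_plus k_minus ab2 ab k0 hz weight_k) q5 lev => h.
apply: (mulfI (mulf_neq0 five (expf_neq0 2 q0))); rewrite -h /second_factor.
rewrite (norm_val_a hK p0 p1 q5) (norm_val_b hK p0 p1 q5) -/(E 1) -/(E 2) -/(E 5) -/(E 10).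
have [n1 n2 n5 n10] := nonzero_data; have r0 := rrcf_neq0 hK p1.
rewrite /a; move: n1 n2 n5 n10 r0 k_plus k_minus.
move: (E 1) (E 2) (E 5) (E 10) (rrcf p) (peval _ _) => y1 y2 y5 y10 r S.
move: (1 + k) (1 - k) => u v n1 n2 n5 n10 r0 u0 v0.
rewrite -q5.
by field; rewrite ?n1 ?n2 ?n5 ?n10 ?r0 ?u0 ?v0 ?k0 ?q0.
Qed.

(** Here the weight is [c^-6 = c^4], and [second_average] is applied at [z^4],
    [-1/a], [-1/b], [-1/k]: replacing [c] by [c^4 = 1/c] turns the conjugates of
    [-1/a] into the images of those of [a], at which [dissect] and [dissect_adj]
    take the same values. *)
Lemma ev_second_4_root : ev (section5 4 (section5 4 Delta2_fps)) p =
  p ^+ 5 * E 5 ^+ 85 * E 2 ^+ 25 * rrcf p / (E 1 ^+ 87 * E 10 ^+ 25)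
  * (5 * peval witness_poly (- k^-1)) * k ^+ 52 / ((1 - k) ^+ 24 * (1 + k) ^+ 23).
Proof.
have z5 := zeta5_expr5 hz.
have z0 : z != 0 by apply/eqP => z0; move: z5; rewrite z0 expr0n => /eqP; rewrite eq_sym oner_eq0.
have hz4 : zeta5 (z ^+ 4) by apply: zeta5_expr.
pose k' := - k^-1; pose a' := - a^-1; pose b' := - b^-1.
have k'_plus : 1 + k' != 0.
  have -> : 1 + k' = - ((1 - k) / k) by rewrite /k'; field.
  by rewrite oppr_eq0 mulf_neq0 ?invr_neq0.
have k'_minus : 1 - k' != 0.
  have -> : 1 - k' = (1 + k) / k by rewrite /k'; field.
  by rewrite mulf_neq0 ?invr_neq0.
have k'0 : k' != 0 by rewrite oppr_eq0 invr_neq0.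
have ab2' : a' * b' ^+ 2 = k'.
  by rewrite /k' -ab2 /a' /b'; field; rewrite a0 b0.
have ab' : b' * (1 - k') = a' ^+ 2 * (1 + k').
  transitivity (- (a ^+ 2 * (1 + k)) / (k * b * a ^+ 2)).
    by rewrite /b' /k'; field; rewrite a0 b0 k0.
  by rewrite -ab /a' /k'; field; rewrite a0 b0 k0.
have weight_k' : weight = peval level_poly k' / (k' * (1 - k') ^+ 2 * (1 + k') ^+ 2).
  rewrite weight_k !level_poly_val /k'.
  have k_plus' : k + 1 != 0 by rewrite addrC.
  have k_minus' : k - 1 != 0 by rewrite -oppr_eq0 opprB.
  by field; rewrite ?k_plus' ?k_minus' ?k_plus ?k_minus ?k0.
have lev' : peval level_poly k' = - k ^- 6 * peval level_poly k.
  by rewrite !level_poly_val /k'; field.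
have term (j : 'I_5) : (z ^+ j) ^+ 1 * ev (section5 4 Delta2_fps) (z ^+ j * q) =
    q ^- 7 * second_factor * ((z ^+ 4) ^+ j *
      conj_series weight ((z ^+ 4) ^+ j * a') (((z ^+ 4) ^+ j) ^+ 2 * b')).
  rewrite ev_first_conj //; have c5 := zj5 j.
  have c0 : z ^+ j != 0.
    by apply/eqP => c0; move: c5; rewrite c0 expr0n => /eqP; rewrite eq_sym oner_eq0.
  have -> : (z ^+ 4) ^+ j = (z ^+ j) ^+ 4 by rewrite exprAC.
  move: (z ^+ j) c0 c5 => c c0 c5.
  have cV : c ^+ 4 = c^-1 by apply: (mulfI c0); rewrite divff // -exprS.
  have -> : c ^+ 4 * a' = - (c * a)^-1 by rewrite cV /a'; field; rewrite c0 a0.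
  have -> : (c ^+ 4) ^+ 2 * b' = - (c ^+ 2 * b)^-1 by rewrite cV /b'; field; rewrite c0 b0.
  have ca0 : c * a != 0 by rewrite mulf_neq0.
  have cb0 : c ^+ 2 * b != 0 by rewrite mulf_neq0 ?expf_neq0.
  have -> : conj_series weight (- (c * a)^-1) (- (c ^+ 2 * b)^-1) =
            conj_series weight (c * a) (c ^+ 2 * b).
    by rewrite /conj_series !dissect_adj_opp // !dissect_opp.
  move: (conj_series _ _ _) second_factor => x y.
  transitivity ((c ^+ 5)^-1 * (c ^+ 5)^-1 * c ^+ 4 * q ^- 7 * y * x).
    by field; rewrite c0 q0.
  by rewrite c5 invr1 !mul1r; ring.
have gf : good K (section5 4 Delta2_fps) by apply/good_section5/good_Delta2.
have := ev_section5 hK hz (isT : (4 < 5)%N) (isT : (5 %| 4 + 1)%N) gf q1 q0.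
under eq_bigr do rewrite term.
rewrite -mulr_sumr (second_average k'_plus k'_minus ab2' ab' k'0 hz4 weight_k') q5 lev' lev => h.
apply: (mulfI (mulf_neq0 five (expf_neq0 4 q0))); rewrite -h /second_factor.
rewrite (norm_val_a hK p0 p1 q5) (norm_val_b hK p0 p1 q5) -/(E 1) -/(E 2) -/(E 5) -/(E 10).
have [n1 n2 n5 n10] := nonzero_data; have r0 := rrcf_neq0 hK p1.
have -> : 1 + k' = - ((1 - k) / k) by rewrite /k'; field.
have -> : 1 - k' = (1 + k) / k by rewrite /k'; field.
rewrite -/k' /a' /a; move: n1 n2 n5 n10 r0 k_plus k_minus.
move: (E 1) (E 2) (E 5) (E 10) (rrcf p) (peval _ _) => y1 y2 y5 y10 r S.
rewrite /k'; move: (1 + k) (1 - k) => u v n1 n2 n5 n10 r0 u0 v0.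
rewrite -q5.
by field; rewrite ?n1 ?n2 ?n5 ?n10 ?r0 ?u0 ?v0 ?k0 ?q0.
Qed.

End Second.

(** * The two polynomials *)

Section Final.
Variable K : numClosedFieldType.
Hypothesis hK : disc_analysis K.

Lemma qseries_ev (c : nat -> nat) (q : K) : qseries c q = ev (FPS (fun n => (c n)%:Z)) q.
Proof. by []. Qed.

Lemma section5_2 : section5 2 (section5 4 Delta2_fps) = FPS (fun n => (Delta 2 (25 * n + 14))%:Z).
Proof. by apply: fpsP => n /=; congr (Delta 2 _)%:Z; lia. Qed.

Lemma section5_4 : section5 4 (section5 4 Delta2_fps) = FPS (fun n => (Delta 2 (25 * n + 24))%:Z).
Proof. by apply: fpsP => n /=; congr (Delta 2 _)%:Z; lia. Qed.

Section Series.
Variable p : K.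
Hypotheses (p0 : p != 0) (p1 : `|p| < 1).
Let k := kparam p.

Lemma ev_14 : qseries (fun n => Delta 2 (25 * n + 14)) p =
  p ^+ 5 * euler (p ^+ 5) ^+ 85 * euler (p ^+ 2) ^+ 25
  / (euler p ^+ 87 * euler (p ^+ 10) ^+ 25 * rrcf p)
  * (5 * peval witness_poly k) / (k ^+ 5 * (1 - k) ^+ 23 * (1 + k) ^+ 24).
Proof.
have [q q5 _] := root5_exists p1; have [z hz] := @zeta5_exists K.
by rewrite qseries_ev -section5_2 (ev_second_2_root hK p0 p1 q5 hz) expr1.
Qed.

Lemma ev_24 : qseries (fun n => Delta 2 (25 * n + 24)) p =
  p ^+ 5 * euler (p ^+ 5) ^+ 85 * euler (p ^+ 2) ^+ 25 * rrcf p
  / (euler p ^+ 87 * euler (p ^+ 10) ^+ 25)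
  * (5 * peval witness_poly (- k^-1)) * k ^+ 52 / ((1 - k) ^+ 24 * (1 + k) ^+ 23).
Proof.
have [q q5 _] := root5_exists p1; have [z hz] := @zeta5_exists K.
by rewrite qseries_ev -section5_4 (ev_second_4_root hK p0 p1 q5 hz) expr1.
Qed.

(** All factors are monomials in [p], the four brackets, [(p^5; p^10)] and the Euler
    product at [p^10]. *)
Lemma prefactor_14 :
  (qpoch p p ^+ 92 * qpoch (p ^+ 5) (p ^+ 5) ^+ 14
     * qpochs [:: p; p ^+ 4] (p ^+ 5) ^+ 52 * qpochs [:: p ^+ 4; p ^+ 6] (p ^+ 10) ^+ 4)
  / (p ^+ 57 * qpoch (p ^+ 2) (p ^+ 2) ^+ 58 * qpoch (p ^+ 10) (p ^+ 10) ^+ 46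
     * qpochs [:: p; p ^+ 9] (p ^+ 10) ^+ 109 * qpoch (p ^+ 5) (p ^+ 10) ^+ 10)
  * qseries (fun n => Delta 2 (25 * n + 14)) p
  = k ^- 57 * (5 * peval witness_poly k).
Proof.
rewrite ev_14; move: (5 * _) => S.
rewrite -!/(euler _) (euler1_bracket hK p1) (euler2_bracket hK p1) (euler5_bracket hK p1).
rewrite qpochs_bracket1 qpochs_bracket4 (qpochs_bracket14 hK p1) (rrcf_bracket hK p1).
rewrite (one_plus_k hK p1) (one_minus_k hK p1) /k (kparam_bracket hK p1).
move: (bracket_neq0 hK p1 (isT : (0 < 1 < 10)%N)) (bracket_neq0 hK p1 (isT : (0 < 2 < 10)%N)).
move: (bracket_neq0 hK p1 (isT : (0 < 3 < 10)%N)) (bracket_neq0 hK p1 (isT : (0 < 4 < 10)%N)).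
move: (f_neq0 hK p1) (E_neq0 hK p1 (isT : (0 < 10)%N)).
move: (bracket p 1) (bracket p 2) (bracket p 3) (bracket p 4) (qpoch _ _) (euler _).
move=> a b c d x y nx ny nc nd na nb.
by field; rewrite ?na ?nb ?nc ?nd ?nx ?ny ?p0.
Qed.

Lemma prefactor_24 :
  (qpoch p p ^+ 92 * qpochs [:: p; p ^+ 4] (p ^+ 5) ^+ 62 * qpoch (p ^+ 5) (p ^+ 10) ^+ 6)
  / (p ^+ 57 * qpoch (p ^+ 2) (p ^+ 2) ^+ 59 * qpoch (p ^+ 5) (p ^+ 5) ^+ 2
     * qpoch (p ^+ 10) (p ^+ 10) ^+ 29 * qpochs [:: p; p ^+ 9] (p ^+ 10) ^+ 119
     * qpochs [:: p ^+ 4; p ^+ 6] (p ^+ 10) ^+ 4)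
  * qseries (fun n => Delta 2 (25 * n + 24)) p
  = 5 * peval witness_poly (- k^-1).
Proof.
rewrite ev_24; move: (5 * _) => S.
rewrite -!/(euler _) (euler1_bracket hK p1) (euler2_bracket hK p1) (euler5_bracket hK p1).
rewrite qpochs_bracket1 qpochs_bracket4 (qpochs_bracket14 hK p1) (rrcf_bracket hK p1).
rewrite (one_plus_k hK p1) (one_minus_k hK p1) /k (kparam_bracket hK p1).
move: (bracket_neq0 hK p1 (isT : (0 < 1 < 10)%N)) (bracket_neq0 hK p1 (isT : (0 < 2 < 10)%N)).
move: (bracket_neq0 hK p1 (isT : (0 < 3 < 10)%N)) (bracket_neq0 hK p1 (isT : (0 < 4 < 10)%N)).
move: (f_neq0 hK p1) (E_neq0 hK p1 (isT : (0 < 10)%N)).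
move: (bracket p 1) (bracket p 2) (bracket p 3) (bracket p 4) (qpoch _ _) (euler _).
move=> a b c d x y nx ny nc nd na nb.
by field; rewrite ?na ?nb ?nc ?nd ?nx ?ny ?p0.
Qed.

End Series.
End Final.

Definition poly_of_Z (s : seq Z) : {poly int} := Poly (map int_of_Z s).

Lemma size_poly_of_Z (s : seq Z) : last (Zpos 1) s != Z0 -> size (poly_of_Z s) = size s.
Proof.
move=> h; rewrite /poly_of_Z (@PolyK _ 1) ?size_map //.
rewrite -[1]/(int_of_Z 1) last_map; apply: contraNneq h => e.
by apply/eqP/(can_inj int_of_ZK).
Qed.

Lemma horner_poly_of_Z (F : comNzRingType) s (x : F) :
  (map_poly intr (poly_of_Z s)).[x] = peval s x.
Proof.
rewrite /poly_of_Z; elim: s => [|c s IH] /=; first by rewrite map_poly0 horner0.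
rewrite cons_poly_def rmorphD rmorphM /= map_polyC map_polyX hornerMXaddC IH.
by rewrite addrC mulrC.
Qed.

Lemma peval_rcons (F : comNzRingType) s c (x : F) :
  peval (rcons s c) x = peval s x + x ^+ size s * zval F c.
Proof.
elim: s => [|d s IH] /=; first by rewrite mulr0 !addr0 add0r expr0 mul1r.
by rewrite IH exprS mulrDr mulrA addrA.
Qed.

Lemma peval_rev (F : fieldType) s (x : F) : x != 0 ->
  peval (rev s) x^-1 * x ^+ size s = x * peval s x.
Proof.
move=> x0; elim: s => [|c s IH] /=; first by rewrite mul0r mulr0.
rewrite rev_cons peval_rcons size_rev mulrDl exprS mulrCA IH exprVn.
have n0 : x ^+ size s != 0 by rewrite expf_neq0.
by field.
Qed.

Lemma size_divisible (S Q : {poly int}) (n : nat) : size S = n -> size Q = 2 ->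
  size (5 *: (S \Po Q)) = n /\ forall i, (5 %| (5 *: (S \Po Q))`_i)%Z.
Proof.
move=> <- hQ; split; first by rewrite size_scale // size_comp_poly2.
by move=> i; rewrite coefZ dvdz_mulr.
Qed.

(** [S(k) / k^57] is the reverse of [S] at [1/k = zfun q - 1], and [S(-1/k)] is [S]
    at [1 - zfun q]. *)
Theorem theorem9p1 (R : realType) :
  (exists P : {poly int},
    [/\ size P = 58%N,
        (forall i : nat, (5 %| P`_i)%Z)
      & forall q : R[i], 0 < `|q| < 1 ->
        (qpoch q q ^+ 92
           * qpoch (q ^+ 5) (q ^+ 5) ^+ 14
           * qpochs [:: q; q ^+ 4] (q ^+ 5) ^+ 52
           * qpochs [:: q ^+ 4; q ^+ 6] (q ^+ 10) ^+ 4)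
        / (q ^+ 57
           * qpoch (q ^+ 2) (q ^+ 2) ^+ 58
           * qpoch (q ^+ 10) (q ^+ 10) ^+ 46
           * qpochs [:: q; q ^+ 9] (q ^+ 10) ^+ 109
           * qpoch (q ^+ 5) (q ^+ 10) ^+ 10)
        * qseries (fun n => Delta 2 (25 * n + 14)) q
        = (map_poly intr P).[zfun q] ])
  /\
  (exists P : {poly int},
    [/\ size P = 58%N,
        (forall i : nat, (5 %| P`_i)%Z)
      & forall q : R[i], 0 < `|q| < 1 ->
        (qpoch q q ^+ 92
           * qpochs [:: q; q ^+ 4] (q ^+ 5) ^+ 62
           * qpoch (q ^+ 5) (q ^+ 10) ^+ 6)
        / (q ^+ 57
           * qpoch (q ^+ 2) (q ^+ 2) ^+ 59
           * qpoch (q ^+ 5) (q ^+ 5) ^+ 2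
           * qpoch (q ^+ 10) (q ^+ 10) ^+ 29
           * qpochs [:: q; q ^+ 9] (q ^+ 10) ^+ 119
           * qpochs [:: q ^+ 4; q ^+ 6] (q ^+ 10) ^+ 4)
        * qseries (fun n => Delta 2 (25 * n + 24)) q
        = (map_poly intr P).[zfun q] ]).
Proof.
have hK := complex_disc_analysis R.
have size_W (s : seq Z) (Q : {poly int}) : last (Zpos 1) s != Z0 -> size s = 58 -> size Q = 2 ->
    size (5 *: (poly_of_Z s \Po Q)) = 58 /\ forall i, (5 %| (5 *: (poly_of_Z s \Po Q))`_i)%Z.
  by move=> sl ss; apply: size_divisible; rewrite size_poly_of_Z.
have val_W (s : seq Z) (Q : {poly int}) (x : R[i]) :
    (map_poly intr (5 *: (poly_of_Z s \Po Q))).[x] = 5 * peval s (map_poly intr Q).[x].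
  by rewrite map_polyZ hornerZ /= map_comp_poly horner_comp horner_poly_of_Z.
split.
- have [] := size_W (rev witness_poly) ('X - 1); [by vm_compute|by vm_compute|exact: size_XsubC|].
  move=> h1 h2; exists (5 *: (poly_of_Z (rev witness_poly) \Po ('X - 1))).
  split=> // q /andP[]; rewrite normr_gt0 => q0 q1.
  have k0 := kparam_neq0 hK q1 q0.
  rewrite (prefactor_14 hK q0 q1) val_W (zfun_k hK q1 q0).
  have -> : (map_poly intr ('X - 1 : {poly int})).[1 + (kparam q)^-1] = (kparam q)^-1.
    by rewrite rmorphB rmorph1 /= map_polyX hornerD hornerN hornerX hornerC addrC addKr.
  have kn : kparam q ^+ 58 != 0 by rewrite expf_neq0.
  apply: (mulIf kn); rewrite -(mulrA 5) -[58%N]/(size witness_poly) (peval_rev _ k0).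
  rewrite [size _]/=; move: (kparam q) (peval _ _) k0 => x S x0.
  by field.
- have [] := size_W witness_poly (1 - 'X); [by vm_compute|by vm_compute| |].
    by rewrite -opprB size_polyN; exact: size_XsubC.
  move=> h1 h2; exists (5 *: (poly_of_Z witness_poly \Po (1 - 'X))).
  split=> // q /andP[]; rewrite normr_gt0 => q0 q1.
  rewrite (prefactor_24 hK q0 q1) val_W (zfun_k hK q1 q0); congr (5 * peval _ _).
  by rewrite rmorphB rmorph1 /= map_polyX hornerD hornerN hornerX hornerC opprD addNKr.
Qed.
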